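(* Let $\mathbb{L}=\{z:\operatorname{Re}z\le0\}$ and $F=\gamma*\mathbf 1_{(-\infty,0)}$, and suppose that $R(z)=\Phi(z+\bar z)\cdot\mathbf 1_{\mathbb{L}}(z)$ with $\Phi=\gamma*\varphi$ of error function-type. Then $R$ solves Ward's equation $$\bar\partial C=R-1-\Delta\log R\quad\text{in (the interior of) }\mathbb{L},\qquad\text{where}\quad C(z)=\int_{\mathbb{L}}\frac{B(z,w)}{z-w}\,dA(w),$$ if and only if there is an interval $I$ of positive measure such that $$\Phi=H_I:=\gamma*\Big[\frac{\mathbf 1_I}{F}\Big].$$ Also, a function $\Phi=\gamma*\varphi\not\equiv0$ of error function-type gives rise to a solution to the mass-one equation in $\mathbb{L}$, i.e. the equation $$\int_{\mathbb{L}}e^{-|z-w|^2}|\Phi(z+\bar w)|^2\,dA(w)=\Phi(z+\bar z),\qquad z\in\mathbb{L},$$ if and only if $\Phi=H_E:=\gamma*\big[\frac{\mathbf 1_E}{F}\big]$ for some Borel set $E\subset\mathbb{R}$ of positive measure.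
   Context: $\Delta=\partial\bar\partial$ (one quarter of the usual Laplacian) and $dA$ is Lebesgue measure on $\mathbb{C}$ divided by $\pi$. Let $\gamma(z)=\frac1{\sqrt{2\pi}}e^{-z^2/2}$ and $\gamma*\varphi(z)=\int_{-\infty}^{+\infty}\gamma(z-t)\varphi(t)\,dt$. A function $\Phi$ is of error function-type if $\Phi=\gamma*\varphi$ for some measurable window function $\varphi$ on $\mathbb{R}$ of moderate increase (a tempered distribution). Explicitly, $F(z)=\gamma*\mathbf 1_{(-\infty,0)}(z)=\frac12\operatorname{erfc}(z/\sqrt2)$ and $H_E(z)=\frac1{\sqrt{2\pi}}\int_E\frac{e^{-(z-t)^2/2}}{F(t)}\,dt$, where identities $\Phi=H_E$ are understood on $\{\operatorname{Re}z<0\}$, where the integral always converges. In Ward's equation, $B(z,w)=|K(z,w)|^2/R(z)$ with $K(z,w)=G(z,w)\,\Phi(z+\bar w)\,\mathbf 1_{\mathbb{L}}(z)\mathbf 1_{\mathbb{L}}(w)$ and $G(z,w)=e^{z\bar w-|z|^2/2-|w|^2/2}$; satisfying it presupposes that $R>0$ in the interior of $\mathbb{L}$. *)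

(* Defs.v *)
From HB Require Import structures.
From mathcomp Require Import all_boot all_order all_algebra.
From mathcomp Require Import all_classical all_reals all_analysis.
Set Implicit Arguments.
Unset Strict Implicit.
Unset Printing Implicit Defensive.
Import Order.TTheory GRing.Theory Num.Theory.
Import numFieldNormedType.Exports.
From mathcomp Require Import complex.
Local Open Scope classical_set_scope.
Local Open Scope complex_scope.
Local Open Scope ring_scope.

Definition cexp {R : realType} (z : R[i]) : R[i] :=
  (expR (Re z))%:C * (cos (Im z) +i* sin (Im z)).

Section ComplexIntegral.
Context {d : measure_display} {T : measurableType d} {R : realType}.
Variable mu : {measure set T -> \bar R}.

Definition cintegrable (D : set T) (f : T -> R[i]) : Prop :=
  mu.-integrable D (fun x => (Re (f x))%:E) /\
  mu.-integrable D (fun x => (Im (f x))%:E).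

Definition cintegral (D : set T) (f : T -> R[i]) : R[i] :=
  (\int[mu]_(x in D) Re (f x)) +i* (\int[mu]_(x in D) Im (f x)).

End ComplexIntegral.

Definition ofpair {R : realType} (p : R * R) : R[i] := p.1 +i* p.2.

Definition plane_measure (R : realType) :
    {measure set (measurableTypeR R * measurableTypeR R) -> \bar R} :=
  (@lebesgue_measure R \x @lebesgue_measure R)%E.
Arguments plane_measure R : clear implicits.

Definition area_integrable {R : realType} (A : set R[i]) (f : R[i] -> R[i]) :=
  cintegrable (plane_measure R) (ofpair @^-1` A) (f \o ofpair).

(* The area element is Lebesgue measure divided by pi. *)
Definition area_integral {R : realType} (A : set R[i]) (f : R[i] -> R[i]) :
    R[i] :=
  (pi^-1)%:C *
  cintegral (plane_measure R) (ofpair @^-1` A) (f \o ofpair).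

Definition partial_x {R : realType} (f : R[i] -> R[i]) (z : R[i]) : R[i] :=
  'D_(1, 0) (fun p : R * R => Re (f (ofpair p))) (Re z, Im z) +i*
  'D_(1, 0) (fun p : R * R => Im (f (ofpair p))) (Re z, Im z).

Definition partial_y {R : realType} (f : R[i] -> R[i]) (z : R[i]) : R[i] :=
  'D_(0, 1) (fun p : R * R => Re (f (ofpair p))) (Re z, Im z) +i*
  'D_(0, 1) (fun p : R * R => Im (f (ofpair p))) (Re z, Im z).

Definition del {R : realType} (f : R[i] -> R[i]) (z : R[i]) : R[i] :=
  (partial_x f z - 'i%C * partial_y f z) / 2.

Definition delbar {R : realType} (f : R[i] -> R[i]) (z : R[i]) : R[i] :=
  (partial_x f z + 'i%C * partial_y f z) / 2.

(* One quarter of the usual Laplacian. *)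
Definition lap {R : realType} (f : R[i] -> R[i]) : R[i] -> R[i] :=
  del (delbar f).

Definition real_differentiable {R : realType} (f : R[i] -> R[i]) (z : R[i]) :=
  differentiable (fun p : R * R => Re (f (ofpair p))) (Re z, Im z) /\
  differentiable (fun p : R * R => Im (f (ofpair p))) (Re z, Im z).

Definition gauss {R : realType} (z : R[i]) : R[i] :=
  ((Num.sqrt (2 * pi))^-1)%:C * cexp (- (z ^+ 2) / 2).

Definition gauss_conv {R : realType} (phi : R -> R[i]) (z : R[i]) : R[i] :=
  cintegral lebesgue_measure setT (fun t : R => gauss (z - t%:C) * phi t).

(* phi is locally integrable and polynomially bounded in the mean, the absolute
   growth condition under which a function is a tempered distribution. *)
Definition moderate_increase {R : realType} (phi : R -> R[i]) : Prop :=
  exists N : nat,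
    cintegrable lebesgue_measure setT
      (fun t : R => phi t / (1 + `|t|)%:C ^+ N).

Definition measurable_window {R : realType} (phi : R -> R[i]) : Prop :=
  measurable_fun [set: R] (fun t => Re (phi t)) /\
  measurable_fun [set: R] (fun t => Im (phi t)).

Definition error_function_type {R : realType} (Phi : R[i] -> R[i]) : Prop :=
  exists phi : R -> R[i],
    [/\ measurable_window phi, moderate_increase phi & Phi = gauss_conv phi].

Definition Ffun {R : realType} : R[i] -> R[i] :=
  gauss_conv (\1_([set` `]-oo, 0[] : set R) : R -> R[i]).

Definition Hfun {R : realType} (E : set R) : R[i] -> R[i] :=
  gauss_conv (fun t : R => \1_E t / Ffun t%:C).

(* For z in the open left half-plane the integral defining Hfun E z converges
   for every measurable E; for other z it may diverge. *)
Definition eq_Hfun {R : realType} (Phi : R[i] -> R[i]) (E : set R) : Prop :=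
  forall z : R[i], Re z < 0 -> Phi z = Hfun E z.

Definition halfplane {R : realType} : set R[i] := [set z | Re z <= 0].

Definition open_halfplane {R : realType} : set R[i] := [set z | Re z < 0].

Section Ward.
Context {R : realType}.
Variable Phi : R[i] -> R[i].
Local Notation L := (@halfplane R).

Definition onepoint (z : R[i]) : R[i] := Phi (z + z^*%C) * \1_L z.

Definition Gkernel (z w : R[i]) : R[i] :=
  cexp (z * w^*%C - `|z| ^+ 2 / 2 - `|w| ^+ 2 / 2).

Definition Kkernel (z w : R[i]) : R[i] :=
  Gkernel z w * Phi (z + w^*%C) * \1_L z * \1_L w.

Definition berezin (z w : R[i]) : R[i] := `|Kkernel z w| ^+ 2 / onepoint z.

Definition cauchy_berezin (z : R[i]) : R[i] :=
  area_integral L (fun w => berezin z w / (z - w)).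

Definition log_onepoint (z : R[i]) : R[i] := (ln (Re (onepoint z)))%:C.

(* The order on R[i] makes 0 < onepoint z mean "real and positive".
   When Phi is of error function-type, log_onepoint is then smooth on the open
   half-plane, so no differentiability hypothesis on it is needed. *)
Definition solves_ward : Prop :=
  (forall z, open_halfplane z -> 0 < onepoint z) /\
  (forall z, open_halfplane z ->
    [/\ area_integrable L (fun w => berezin z w / (z - w)),
        real_differentiable cauchy_berezin z &
        delbar cauchy_berezin z = onepoint z - 1 - lap log_onepoint z]).

Definition mass_one_integrand (z w : R[i]) : R[i] :=
  cexp (- `|z - w| ^+ 2) * `|Phi (z + w^*%C)| ^+ 2.

Definition solves_mass_one : Prop :=
  forall z, L z ->
    area_integrable L (mass_one_integrand z) /\
    area_integral L (mass_one_integrand z) = Phi (z + z^*%C).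

End Ward.

(* Main.v *)
Require Import Defs.
From HB Require Import structures.
From mathcomp Require Import all_boot all_order all_algebra.
From mathcomp Require Import all_classical all_reals all_analysis.
From mathcomp Require Import measurable_realfun ring lra.
Import Order.TTheory GRing.Theory Num.Theory.
Import numFieldNormedType.Exports.
From mathcomp Require Import complex.
Local Open Scope classical_set_scope.
Local Open Scope complex_scope.
Local Open Scope ring_scope.
Set Implicit Arguments.
Unset Strict Implicit.
Unset Printing Implicit Defensive.

(** Error-function windows solving Ward's equation and the mass-one equation.

Write gamma for the standard normal density and P = gamma * rho on the real
axis. Both equations are translated into identities between Gaussian averages
on the half-line x < 0, where such an average determines the window almost
everywhere ([gauss_inj]: up to elementary factors it is a Laplace transform
near a point; when it vanishes so do all moments of an exponentially small
function, and multiplication by small-frequency cosines and sines propagates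
this to the whole Fourier transform). In particular the window may be taken
real, since both equations and the identity with H_E force P to be real.

On the vertical line through a, the modulus of Phi is, after removal of the
factor exp(b^2/2), the modulus of the Fourier transform of t |-> gamma(a - t)
rho(t). Two quadratic formulas for Fourier transforms of integrable functions
are therefore decisive, and both are instances of [Rint_weight]: Plancherel's
formula ([plancherel], Gaussian weights tending to 1) and the formula for the
weight a/(a^2 + s^2), whose own transform is pi exp(-a|t|) ([Rint_lorentz]).

Mass one. By Plancherel's formula on vertical lines and integration over the
half-plane, the area integral at z is the Gaussian average of F rho^2 at
2 Re z ([mass_formula]); F appears as the integral of gamma(2u - t) over
u <= 0. Hence the equation says F rho^2 = rho, that is rho = 1_E / F with E
the set where rho does not vanish.

Ward's equation. The real part of 1/(z - w) is the weight a/(a^2 + s^2) with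
a = Re(z - w), while its imaginary part is odd in s and contributes nothing.
Completing squares, the factor exp(-|a||t - t'|) turns the double integral of
the two Gaussians into one over t < t' ([Rint_slice_kernel]), and integrating
over the half-plane gives
  C(z) = A(2x)/P(2x) - (integral of 2 P(2u) for x < u <= 0),   x = Re z,
where A is the average of rho psi and psi(t) is the integral of F rho over
]t, +oo[ ([Rint_cauchy], [mass_tail]). So C is a function of Re z alone, the
last term is differentiated to P, and Ward's equation collapses to W' = 0 for
W = gamma * (rho (psi + id)) / P ([ward_equation]). Thus W is a constant c, and
by uniqueness rho (psi + id - c) = 0 almost everywhere. Off the closed set
Z = (psi + id = c) the window vanishes and psi + id has slope one, so that it
cannot return to c: Z is an interval ([slope_one_zeros]). On Z one has
psi = c - id, so that F rho = 1 ([mass_tail_interval]). Conversely, for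
rho = 1_I / F the growth of 1/F forces I to be bounded above, psi = sup I - id
on I, and W is the constant sup I ([ward_window_conv]); the window is then
bounded, which makes the Cauchy integral converge absolutely
([intg2_berezin]). *)

(** * Affine changes of variable on the line *)

Section affine_change.
Context {R : realType}.
Notation mu := (@lebesgue_measure R).

Definition affine_map (b a : R) : measurableTypeR R -> measurableTypeR R :=
  fun x => b * x + a.

Lemma measurable_affine_map b a : measurable_fun setT (affine_map b a).
Proof. by apply: measurable_funD => //; apply: measurable_funM. Qed.

HB.instance Definition _ b a :=
  isMeasurableFun.Build _ _ _ _ (affine_map b a) (measurable_affine_map b a).

(** Both sides are measures that agree on half-open intervals. *)
Lemma lebesgue_measure_affine (b a : R) (b0 : 0 < b) A : measurable A ->
  mu A = (b%:E * pushforward mu (affine_map b a) A)%E.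
Proof.
move=> mA.
have bn0 : 0 <= b by exact: ltW.
pose m := pushforward mu (affine_map b a).
rewrite (_ : (b%:E * _)%E = mscale (NngNum bn0) m A)//.
apply: lebesgue_measure_unique => // _ [[c d]] _ <- /=.
rewrite /mscale/= /pushforward.
rewrite (_ : affine_map b a @^-1` _ = `](c - a) / b, (d - a) / b]%classic); last first.
  apply/seteqP; split => x /=; rewrite /affine_map !in_itv/= ltr_pdivrMr// ler_pdivlMr//
    mulrC ltrBlDr lerBrDr//.
rewrite !lebesgue_measure_itv/= !lte_fin ltr_pM2r ?invr_gt0// ltrD2r.
case: ifP => _; last by rewrite mule0.
by rewrite -!EFinD -EFinM; congr EFin; field; rewrite gt_eqF.
Qed.

Lemma ge0_integral_affine (b a : R) (f : R -> \bar R) : 0 < b ->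
  measurable_fun setT f -> (forall x, 0 <= f x)%E ->
  (\int[mu]_x f x = b%:E * \int[mu]_x f (b * x + a)%R)%E.
Proof.
move=> b0 mf f0.
have bn0 : 0 <= b by exact: ltW.
pose m : {measure set (measurableTypeR R) -> \bar R} :=
  pushforward mu (affine_map b a).
transitivity (\int[mscale (NngNum bn0) (m (measurable_affine_map b a))]_x f x)%E.
  by apply: eq_measure_integral => A mA _; exact: (lebesgue_measure_affine a b0 mA).
rewrite ge0_integral_mscale//=; congr (_ * _)%E.
rewrite ge0_integral_pushforward//.
Qed.

Lemma ge0_integral_opp (f : R -> \bar R) :
  measurable_fun setT f -> (forall x, 0 <= f x)%E ->
  (\int[mu]_x f x = \int[mu]_x f (- x)%R)%E.
Proof.
move=> mf f0.
pose m := pushforward mu (-%R : _ -> measurableTypeR R).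
transitivity (\int[m]_x f x)%E.
  by apply: eq_measure_integral => A mA _; rewrite [RHS]lebesgue_measureN.
by rewrite ge0_integral_pushforward.
Qed.

Lemma ge0_integral_reflect (a : R) (f : R -> \bar R) :
  measurable_fun setT f -> (forall x, 0 <= f x)%E ->
  (\int[mu]_x f x = \int[mu]_x f (a - x)%R)%E.
Proof.
move=> mf f0; rewrite (ge0_integral_affine a ltr01)// mul1e.
rewrite ge0_integral_opp//; last first.
  by apply: (measurableT_comp mf); apply: measurable_funD => //; apply: measurable_funM.
by apply: eq_integral => x _; congr f; rewrite mul1r addrC.
Qed.

End affine_change.

(** * Real-valued integrals over the line and the plane *)

Section toolkit.
Context {R : realType}.
Notation mu := (@lebesgue_measure R).

Implicit Types (f g : R -> R).

Definition intg (f : R -> R) := mu.-integrable setT (EFin \o f).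

Lemma intgP (f : R -> R) : intg f <->
  measurable_fun setT f /\ (\int[mu]_x `|f x|%:E < +oo)%E.
Proof.
split => [/integrableP[/measurable_EFinP mf foo]|[mf foo]]; first by split.
by apply/integrableP; split => //; exact/measurable_EFinP.
Qed.

Lemma intg_meas f : intg f -> measurable_fun setT f.
Proof. by case/intgP. Qed.

Lemma intg_le f g : measurable_fun setT f -> (forall x, `|f x| <= g x) ->
  intg g -> intg f.
Proof.
move=> mf fg; apply: le_integrable => //; first exact/measurable_EFinP.
by move=> x _ /=; rewrite lee_fin (le_trans (fg x)) ?ler_norm.
Qed.

Lemma eq_intg f g : (forall x, f x = g x) -> intg f -> intg g.
Proof. by move=> fg; rewrite (_ : f = g)//; apply/funext. Qed.

Lemma intgD f g : intg f -> intg g -> intg (fun x => f x + g x).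
Proof. exact: integrableD. Qed.
Lemma intgB f g : intg f -> intg g -> intg (fun x => f x - g x).
Proof. move=> fi gi; exact: (integrableB measurableT fi gi). Qed.
Lemma intgZ c f : intg f -> intg (fun x => c * f x).
Proof. exact: integrableZl. Qed.
Lemma intg_norm f : intg f -> intg (fun x => `|f x|).
Proof. exact: integrable_norm. Qed.

Lemma RintD f g : intg f -> intg g ->
  \int[mu]_x (f x + g x) = \int[mu]_x f x + \int[mu]_x g x.
Proof. by move=> *; apply: RintegralD. Qed.
Lemma RintB f g : intg f -> intg g ->
  \int[mu]_x (f x - g x) = \int[mu]_x f x - \int[mu]_x g x.
Proof. by move=> *; apply: RintegralB. Qed.
Lemma RintZ c f : intg f -> \int[mu]_x (c * f x) = c * \int[mu]_x f x.
Proof. by move=> *; apply: RintegralZl. Qed.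
Lemma Rint_zero : \int[mu]_x (0 : R) = 0.
Proof. by rewrite /Rintegral integral0. Qed.
Lemma eq_Rint f g : (forall x, f x = g x) -> \int[mu]_x f x = \int[mu]_x g x.
Proof. by move=> fg; congr Rintegral; apply/funext. Qed.
Lemma le_Rint f g : intg f -> intg g -> (forall x, f x <= g x) ->
  \int[mu]_x f x <= \int[mu]_x g x.
Proof. by move=> *; apply: le_Rintegral. Qed.
Lemma le_norm_Rint f : intg f -> `|\int[mu]_x f x| <= \int[mu]_x `|f x|.
Proof. by move=> *; apply: le_normr_Rintegral. Qed.
Lemma EFin_Rint f : intg f -> (\int[mu]_x f x)%:E = (\int[mu]_x (f x)%:E)%E.
Proof. by move=> fi; rewrite fineK//; apply: integrable_fin_num. Qed.

Lemma intg_ge0_lty f : measurable_fun setT f -> (forall x, 0 <= f x) ->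
  (\int[mu]_x (f x)%:E < +oo)%E -> intg f.
Proof.
move=> mf f0 foo; apply/intgP; split => //.
by under eq_integral do rewrite ger0_norm//.
Qed.

Lemma RintE (f : R -> R) : \int[mu]_x f x =
  fine (\int[mu]_x ((EFin \o f)^\+ x) - \int[mu]_x ((EFin \o f)^\- x))%E.
Proof. by rewrite /Rintegral -/(EFin \o f) integralE. Qed.

Lemma measurable_EFin_pos f : measurable_fun setT f ->
  measurable_fun setT ((EFin \o f)^\+)%E.
Proof. by move=> mf; apply: measurable_funepos; exact/measurable_EFinP. Qed.

Lemma measurable_EFin_neg f : measurable_fun setT f ->
  measurable_fun setT ((EFin \o f)^\-)%E.
Proof. by move=> mf; apply: measurable_funeneg; exact/measurable_EFinP. Qed.

Lemma Rint_reflect a f : measurable_fun setT f ->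
  \int[mu]_x f x = \int[mu]_x f (a - x).
Proof.
move=> mf; rewrite !RintE; congr (fine (_ - _)%E).
  rewrite (ge0_integral_reflect a (measurable_EFin_pos mf))//.
  by apply: eq_integral => x _; rewrite !funeposE.
rewrite (ge0_integral_reflect a (measurable_EFin_neg mf))//.
by apply: eq_integral => x _; rewrite !funenegE.
Qed.

Lemma intg_reflect a f : intg f -> intg (fun x => f (a - x)).
Proof.
move=> /intgP[mf foo]; apply/intgP; split.
  by apply: (measurableT_comp mf); apply: measurable_funB.
rewrite (ge0_integral_reflect a) in foo => //.
apply/measurable_EFinP; exact: measurableT_comp.
Qed.

Lemma Rint_shift a f : measurable_fun setT f ->
  \int[mu]_x f x = \int[mu]_x f (x + a).
Proof.
move=> mf; rewrite (Rint_reflect a)// (Rint_reflect 0).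
  by apply: eq_Rint => x; congr f; ring.
by apply: (measurableT_comp mf); apply: measurable_funB.
Qed.

(** Infinite values give 0 on either side, which is what lets real-valued
integrals scale without an integrability hypothesis. *)
Lemma fineZB (b : R) (p n : \bar R) : 0 < b -> (0 <= p)%E -> (0 <= n)%E ->
  fine (b%:E * p - b%:E * n)%E = b * fine (p - n)%E.
Proof.
move=> b0; move: p n => [p| |] [n| |] //= _ _;
  rewrite ?gt0_muley ?lte_fin//= ?mulr0//.
ring.
Qed.

Lemma Rint_scale b f : 0 < b -> measurable_fun setT f ->
  \int[mu]_x f x = b * \int[mu]_x f (b * x).
Proof.
move=> b0 mf; rewrite !RintE -fineZB//; [|exact: integral_ge0..].
congr (fine (_ - _)%E).
  rewrite (ge0_integral_affine 0 b0 (measurable_EFin_pos mf))//.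
  by congr (_ * _)%E; apply: eq_integral => x _; rewrite addr0 !funeposE.
rewrite (ge0_integral_affine 0 b0 (measurable_EFin_neg mf))//.
by congr (_ * _)%E; apply: eq_integral => x _; rewrite addr0 !funenegE.
Qed.

(** Dominated convergence, pointwise everywhere and with real values; the limit
inherits the bound, so that it is integrable. *)
Lemma dominated_cvg_Rint (f_ : nat -> R -> R) f (g : R -> R) :
  (forall n, measurable_fun setT (f_ n)) -> measurable_fun setT f ->
  (forall x, f_ ^~ x @ \oo --> f x) -> intg g ->
  (forall n x, `|f_ n x| <= g x) ->
  \int[mu]_x f_ n x @[n --> \oo] --> \int[mu]_x f x.
Proof.
move=> mf_ mf f_f ig fg.
have fi : intg f.
  apply: intg_le ig => // x.
  have h : `|f_ n x| @[n --> \oo] --> `|f x| by exact: cvg_norm.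
  by rewrite -(cvg_lim _ h)//; apply: limr_le; [apply/cvg_ex; eexists; exact: h|exact: nearW].
apply/fine_cvg; rewrite /Rintegral fineK; last exact: integrable_fin_num.
have := @dominated_convergence _ _ _ mu setT measurableT
  (fun n => EFin \o f_ n) (EFin \o f) (EFin \o g).
case => //.
- by move=> n; apply/measurable_EFinP; exact: mf_.
- by apply/measurable_EFinP; exact: mf.
- by apply: aeW => x _; apply: cvg_EFin; [exact: nearW|exact: f_f].
- by apply: aeW => x n _ /=; rewrite lee_fin.
Qed.

Lemma measurable_Rint_param d (T : measurableType d) (f : T * R -> R) :
  measurable_fun setT f -> measurable_fun setT (fun x => \int[mu]_y f (x, y)).
Proof.
move=> mf.
have mE : measurable_fun setT (EFin \o f) by exact/measurable_EFinP.
have mp := measurable_fun_fubini_tonelli_F (m2 := mu) _ (measurable_funepos mE)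
  (fun x => funepos_ge0 _ x).
have mn := measurable_fun_fubini_tonelli_F (m2 := mu) _ (measurable_funeneg mE)
  (fun x => funeneg_ge0 _ x).
apply: measurableT_comp => //.
rewrite (_ : (fun x => _) = (fun x => fubini_F mu ((EFin \o f)^\+)%E x -
  fubini_F mu ((EFin \o f)^\-)%E x)%E); first exact: emeasurable_funB.
apply/funext => x; rewrite integralE /fubini_F.
by congr (_ - _)%E; apply: eq_integral => y _; rewrite ?funeposE ?funenegE.
Qed.

(** Absolute integrability over the plane; the iterated integrals of such a
function are finite, equal, and can be taken with real values. *)
Definition intg2 (f : R * R -> R) := (mu \x mu)%E.-integrable setT (EFin \o f).

Lemma intg2P (f : R * R -> R) : measurable_fun setT f ->
  intg2 f <-> (\int[mu]_x \int[mu]_y `|f (x, y)|%:E < +oo)%E.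
Proof. by move=> mf; apply: integrable12ltyP; exact/measurable_EFinP. Qed.

Lemma intg2P' (f : R * R -> R) : measurable_fun setT f ->
  intg2 f <-> (\int[mu]_y \int[mu]_x `|f (x, y)|%:E < +oo)%E.
Proof. by move=> mf; apply: integrable21ltyP; exact/measurable_EFinP. Qed.

Lemma Rint_fine (H : R -> \bar R) : mu.-integrable setT H ->
  intg (fine \o H) /\ \int[mu]_x fine (H x) = fine (\int[mu]_x H x)%E.
Proof.
move=> Hi.
have mH := measurable_int _ Hi.
have mfH : measurable_fun setT (EFin \o (fine \o H)).
  by apply/measurable_EFinP; exact: measurableT_comp.
have ae : ae_eq mu setT (EFin \o (fine \o H)) H.
  have := integrable_ae measurableT Hi; apply: filterS => x /= fx _.
  by rewrite fineK// fx.
split; last first.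
  by congr fine; exact: ae_eq_integral.
apply/integrableP; split => //.
case/integrableP : Hi => _; congr (_ < _)%E.
apply: ae_eq_integral => //; [exact: measurableT_comp..|].
by move: ae; apply: filterS => x /= h Ix; rewrite -h.
Qed.

Lemma Rint_fubini1 (f : R * R -> R) : intg2 f ->
  intg (fun x => \int[mu]_y f (x, y)) /\
  \int[mu]_x \int[mu]_y f (x, y) = fine (\int[(mu \x mu)%E]_z (f z)%:E)%E.
Proof.
move=> fi; have [h ->] := Rint_fine (integrable_fubini_F fi).
by split; first exact: h; rewrite integral12_prod_meas1.
Qed.

Lemma intg2_swap (f : R * R -> R) : intg2 f -> intg2 (fun z => f (z.2, z.1)).
Proof.
move=> fi; have mf : measurable_fun setT f.
  by apply/measurable_EFinP; exact: measurable_int fi.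
apply/intg2P'; last exact/(intg2P mf).
apply: (measurableT_comp mf); exact: measurable_fun_pair.
Qed.

Lemma Rint_fubini2 (f : R * R -> R) : intg2 f ->
  intg (fun y => \int[mu]_x f (x, y)) /\
  \int[mu]_y \int[mu]_x f (x, y) = fine (\int[(mu \x mu)%E]_z (f z)%:E)%E.
Proof.
move=> fi.
have [h e] := @Rint_fine (fubini_G mu (EFin \o f)) (integrable_fubini_F (intg2_swap fi)).
split; first exact: h.
transitivity (fine (\int[mu]_x fubini_G mu (EFin \o f) x)%E); first exact: e.
by rewrite integral21_prod_meas1.
Qed.

Lemma Rint_fubini (f : R * R -> R) : intg2 f ->
  \int[mu]_x \int[mu]_y f (x, y) = \int[mu]_y \int[mu]_x f (x, y).
Proof. by move=> fi; rewrite (Rint_fubini1 fi).2 (Rint_fubini2 fi).2. Qed.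

Lemma intg2_prod f g : intg f -> intg g -> intg2 (fun z => f z.1 * g z.2).
Proof.
move=> /intgP[mf foo] /intgP[mg goo].
apply/intg2P.
  by apply: measurable_funM; apply: measurableT_comp.
under eq_integral => x _.
  under eq_integral do rewrite normrM EFinM.
  rewrite /= ge0_integralZl//; last first.
    by apply/measurable_EFinP; exact: measurableT_comp.
  over.
rewrite ge0_integralZr//; last 2 first.
- by apply/measurable_EFinP; exact: measurableT_comp.
- exact: integral_ge0.
by rewrite lte_mul_pinfty// ?integral_ge0// ge0_fin_numE ?integral_ge0.
Qed.

Lemma intg2_le (f g : R * R -> R) : measurable_fun setT f ->
  (forall z, `|f z| <= g z) -> intg2 g -> intg2 f.
Proof.
move=> mf fg; apply: le_integrable => //; first exact/measurable_EFinP.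
by move=> x _ /=; rewrite lee_fin (le_trans (fg x)) ?ler_norm.
Qed.

End toolkit.

(** * Derivatives on the line *)

Section derive_rules.
Context {R : realType}.
Implicit Types (f g : R -> R) (x a b : R).

(** A copy of is_derive that is not a type class, so that instance search does
not interfere with the syntax-directed rules below. *)
Definition has_deriv f x a : Prop := is_derive x (1 : R) f a.

Lemma has_deriv_eq f x a b : has_deriv f x a -> a = b -> has_deriv f x b.
Proof. by move=> h <-. Qed.
Lemma has_deriv_id x : has_deriv (fun y : R => y) x 1.
Proof. exact: is_derive_id. Qed.
Lemma has_deriv_cst c x : has_deriv (fun _ : R => c : R) x 0.
Proof. exact: is_derive_cst. Qed.
Lemma has_deriv_D f g x a b : has_deriv f x a -> has_deriv g x b -> has_deriv (fun y => f y + g y) x (a + b).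
Proof. by move=> h1 h2; exact: (is_deriveD h1 h2). Qed.
Lemma has_deriv_N f x a : has_deriv f x a -> has_deriv (fun y => - f y) x (- a).
Proof. by move=> h1; exact: (is_deriveN h1). Qed.
Lemma has_deriv_B f g x a b : has_deriv f x a -> has_deriv g x b -> has_deriv (fun y => f y - g y) x (a - b).
Proof. by move=> h1 h2; exact: (is_deriveB h1 h2). Qed.
Lemma has_deriv_M f g x a b : has_deriv f x a -> has_deriv g x b ->
  has_deriv (fun y => f y * g y) x (a * g x + f x * b).
Proof.
move=> h1 h2; have h := @is_deriveM _ _ f g x 1 a b h1 h2.
apply: (has_deriv_eq h).
by rewrite /GRing.scale/=; ring.
Qed.
Lemma has_deriv_sqr f x a : has_deriv f x a -> has_deriv (fun y => f y ^+ 2) x (2 * f x * a).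
Proof. move=> h; apply: (has_deriv_eq (has_deriv_M h h)); ring. Qed.
Lemma has_deriv_comp f g x a b : has_deriv g x b -> has_deriv f (g x) a ->
  has_deriv (fun y => f (g y)) x (a * b).
Proof. by move=> h1 h2; exact: (is_derive1_comp h2 h1). Qed.
Lemma has_deriv_exp f x a : has_deriv f x a -> has_deriv (fun y => expR (f y)) x (expR (f x) * a).
Proof. by move=> h; exact: (has_deriv_comp h (is_derive_expR _)). Qed.
Lemma has_deriv_cos f x a : has_deriv f x a -> has_deriv (fun y => cos (f y)) x (- sin (f x) * a).
Proof. by move=> h; exact: (has_deriv_comp h (is_derive_cos _)). Qed.
Lemma has_deriv_sin f x a : has_deriv f x a -> has_deriv (fun y => sin (f y)) x (cos (f x) * a).
Proof. by move=> h; exact: (has_deriv_comp h (is_derive_sin _)). Qed.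
Lemma has_deriv_derivable f x a : has_deriv f x a -> derivable f x 1.
Proof. by case. Qed.
Lemma has_deriv_val f x a : has_deriv f x a -> 'D_1 f x = a.
Proof. by case. Qed.
Lemma has_deriv_V f x a : f x != 0 -> has_deriv f x a ->
  has_deriv (fun y => (f y)^-1) x (- a / (f x) ^+ 2).
Proof.
move=> fx h; have h1 := @derivableV _ _ f x 1 fx (has_deriv_derivable h).
apply: (has_deriv_eq (derivableP h1)).
rewrite (deriveV fx (has_deriv_derivable h)).
by rewrite (has_deriv_val h) /GRing.scale/= mulrC mulNr mulrN.
Qed.
Lemma has_deriv_ln f x a : 0 < f x -> has_deriv f x a ->
  has_deriv (fun y => ln (f y)) x (a / f x).
Proof.
move=> fx h; apply: (has_deriv_eq (has_deriv_comp h (is_derive1_ln fx))); exact: mulrC.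
Qed.
Lemma has_deriv_derive1 f x a : has_deriv f x a -> f^`()%classic x = a.
Proof. by move=> h; rewrite derive1E (has_deriv_val h). Qed.
Lemma has_deriv_cont f x a : has_deriv f x a -> {for x, continuous f}.
Proof.
by move=> h; apply/differentiable_continuous/derivable1_diffP;
  exact: has_deriv_derivable h.
Qed.
Lemma has_deriv_is f x a : has_deriv f x a -> is_derive x (1 : R) f a.
Proof. by []. Qed.
End derive_rules.

Ltac deriv := repeat first [ eassumption | apply: has_deriv_id | apply: has_deriv_cst
  | apply: has_deriv_D | apply: has_deriv_B | apply: has_deriv_N | apply: has_deriv_sqr | apply: has_deriv_M
  | apply: has_deriv_exp | apply: has_deriv_cos | apply: has_deriv_sin ].

(** * Measurability by syntax *)

Section meas_rules.
Context {R : realType} d (T : measurableType d).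
Implicit Types f g : T -> R.
Lemma meas_exp f : measurable_fun setT f -> measurable_fun setT (fun x => expR (f x)).
Proof. by move=> ?; apply: measurableT_comp. Qed.
Lemma meas_cos f : measurable_fun setT f -> measurable_fun setT (fun x => cos (f x)).
Proof.
by move=> ?; apply: measurableT_comp => //; apply: continuous_measurable_fun;
  exact: continuous_cos.
Qed.
Lemma meas_sin f : measurable_fun setT f -> measurable_fun setT (fun x => sin (f x)).
Proof.
by move=> ?; apply: measurableT_comp => //; apply: continuous_measurable_fun;
  exact: continuous_sin.
Qed.
Lemma meas_norm f : measurable_fun setT f -> measurable_fun setT (fun x => `|f x|).
Proof. by move=> ?; apply: measurableT_comp. Qed.
Lemma meas_pow f n : measurable_fun setT f -> measurable_fun setT (fun x => f x ^+ n).
Proof. exact: measurable_funX. Qed.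
Lemma meas_N f : measurable_fun setT f -> measurable_fun setT (fun x => - f x).
Proof. by move=> ?; apply: measurableT_comp. Qed.
(** Inversion is total, with 0 inverse to 0; the identity
1/x = x (x^2)^(-1) reduces it to a real power, which is measurable. *)
Lemma meas_inv f : measurable_fun setT f -> measurable_fun setT (fun x => (f x)^-1).
Proof.
move=> mf; rewrite (_ : (fun x => _) = (fun x => f x * (f x ^+ 2) `^ (-1))).
  apply: measurable_funM => //.
  exact: (measurableT_comp (@measurable_powR R (-1)) (measurable_funX 2 mf)).
apply/funext => x; rewrite powR_inv1 ?sqr_ge0//.
have [->|f0] := eqVneq (f x) 0; first by rewrite mul0r invr0.
by rewrite expr2 invfM mulrA divff// mul1r.
Qed.
Lemma meas_lt f g : measurable_fun setT f -> measurable_fun setT g ->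
  measurable_fun setT (fun x => ((f x < g x)%R)%:R : R).
Proof.
move=> mf mg; rewrite (_ : (fun x => _) = (fun x => if f x < g x then 1 else 0)).
  by apply: measurable_fun_ifT => //; exact: measurable_fun_ltr.
by apply/funext => x; case: ifP.
Qed.
Lemma meas_le f g : measurable_fun setT f -> measurable_fun setT g ->
  measurable_fun setT (fun x => ((f x <= g x)%R)%:R : R).
Proof.
move=> mf mg; rewrite (_ : (fun x => _) = (fun x => if f x <= g x then 1 else 0)).
  by apply: measurable_fun_ifT => //; exact: measurable_fun_ler.
by apply/funext => x; case: ifP.
Qed.
Lemma meas_cst (c : R) : measurable_fun setT (fun _ : T => c).
Proof. exact: measurable_cst. Qed.
End meas_rules.

Ltac meas_leaf := first [ assumption | apply: meas_cst | exact: measurable_id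
  | exact: measurable_fst | exact: measurable_snd
  | by apply: meas_N; exact: measurable_id ].
Ltac meas := repeat lazymatch goal with
  | |- measurable_fun _ (fun x => @GRing.add _ _ _) => first [assumption | apply: measurable_funD]
  | |- measurable_fun _ (fun x => @GRing.opp _ _) => first [assumption | apply: meas_N]
  | |- measurable_fun _ (fun x => @GRing.inv _ _) => first [assumption | apply: meas_inv]
  | |- measurable_fun _ (fun x => @GRing.mul _ _ _) => first [assumption | apply: measurable_funM]
  | |- measurable_fun _ (fun x => @GRing.exp _ _ _) => first [assumption | apply: meas_pow | meas_leaf]
  | |- measurable_fun _ (fun x => expR _) => first [assumption | apply: meas_exp]
  | |- measurable_fun _ (fun x => cos _) => first [assumption | apply: meas_cos]
  | |- measurable_fun _ (fun x => sin _) => first [assumption | apply: meas_sin]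
  | |- measurable_fun _ (fun x => Num.norm _) => first [assumption | apply: meas_norm]
  | |- measurable_fun _ (fun x => @GRing.natmul _ _ (nat_of_bool _)) =>
      first [assumption | apply: meas_lt | apply: meas_le]
  | |- measurable_fun _ _ => meas_leaf
  end.

Lemma cvg0_of_norm_le {R : realType} (f g : nat -> R) :
  (forall n, `|f n| <= g n) -> g n @[n --> \oo] --> 0 -> f n @[n --> \oo] --> 0.
Proof.
move=> fg g0; apply: norm_cvg0.
apply: (squeeze_cvgr _ (cvg_cst 0) g0).
by apply: nearW => n; rewrite normr_ge0/= fg.
Qed.

(** * Differentiation under the integral sign *)

Section param.
Context {R : realType}.
Notation mu := (@lebesgue_measure R).

(** Differentiation under the integral sign needs the domination of the derivative
only near the point. *)
Lemma has_deriv_Rint (f f' : R -> R -> R) (a e : R) (G : R -> R) : 0 < e ->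
  (forall t, a - e < t < a + e -> intg (f t)) ->
  (forall t y, a - e < t < a + e -> has_deriv (f^~ y) t (f' t y)) ->
  intg G -> (forall t y, a - e < t < a + e -> `|f' t y| <= G y) ->
  has_deriv (fun t => \int[mu]_y f t y) a (\int[mu]_y f' a y).
Proof.
move=> e0 fi fd Gi fG.
have aI : `]a - e, a + e[%classic a.
  by rewrite /= in_itv/= ltrBlDr !ltrDl e0.
have G0 y : 0 <= G y by apply: le_trans (fG a y aI).
have dE t y : a - e < t < a + e -> partial1of2 f t y = f' t y.
  by move=> h; rewrite partial1of2E (has_deriv_val (fd _ _ h)).
have fi' t : `]a - e, a + e[%classic t -> mu.-integrable setT (EFin \o f t).
  by move=> h; exact: fi.
have der t y : `]a - e, a + e[%classic t -> [set: R] y -> derivable (f^~ y) t 1.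
  by move=> h _; exact: has_deriv_derivable (fd _ _ h).
have ub t y : `]a - e, a + e[%classic t -> [set: R] y -> `|partial1of2 f t y| <= G y.
  by move=> h _; rewrite dE//; exact: fG.
have D1 := derivable_under_integral measurableT aI fi' der G0 Gi ub.
have D2 := differentiation_under_integral measurableT aI fi' der G0 Gi ub.
have D3 := derivableP D1.
apply: (has_deriv_eq D3); rewrite -derive1E D2.
by apply: eq_Rint => y; rewrite dE.
Qed.

End param.

(** * The fundamental theorem of calculus on an exhausted domain *)

Section ftc_line.
Context {R : realType}.
Notation mu := (@lebesgue_measure R).

Lemma Rint_itv_indic (D : set R) (f : R -> R) :
  \int[mu]_(x in D) f x = \int[mu]_x (f x * \1_D x).
Proof.
rewrite Rintegral_mkcond; apply: eq_Rint => x; rewrite patchE indicE.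
by case: ifP => _; rewrite ?mulr1 ?mulr0.
Qed.

Lemma FTC_itv (H h : R -> R) (a b : R) : a < b ->
  (forall x, has_deriv H x (h x)) -> continuous h ->
  \int[mu]_(x in `[a, b]) h x = H b - H a.
Proof.
move=> ab dH ch.
have cH x : {for x, continuous H} by exact: has_deriv_cont (dH x).
rewrite /Rintegral (@continuous_FTC2 _ h H)//=.
- exact: continuous_subspaceT.
- split; first by move=> x _; exact: has_deriv_derivable (dH x).
  + by apply: cvg_at_right_filter; exact: cH.
  + by apply: cvg_at_left_filter; exact: cH.
- by move=> x _; rewrite (has_deriv_derive1 (dH x)).
Qed.

(** Dominated convergence along an exhaustion by segments; the boundary values
of the primitive become limits. *)
Lemma FTC_exhaust (D : set R) (H h : R -> R) (a b : nat -> R) (l1 l2 : R) :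
  measurable D ->
  (forall n, a n < b n) -> (forall n x, a n <= x <= b n -> D x) ->
  (forall x, D x -> \forall n \near \oo, a n <= x <= b n) ->
  (forall x, has_deriv H x (h x)) -> continuous h ->
  intg (fun x => h x * \1_D x) ->
  H (b n) @[n --> \oo] --> l1 -> H (a n) @[n --> \oo] --> l2 ->
  \int[mu]_x (h x * \1_D x) = l1 - l2.
Proof.
move=> mD ab abD Dab dH ch hi Hb Ha.
have mh : measurable_fun setT h by exact: continuous_measurable_fun.
have c1 : \int[mu]_x (h x * \1_(`[a n, b n]%classic) x) @[n --> \oo] -->
   \int[mu]_x (h x * \1_D x).
  apply: (dominated_cvg_Rint _ _ _ (intg_norm hi)).
  - by move=> n; apply: measurable_funM => //; exact: measurable_indic.
  - by apply: measurable_funM => //; exact: measurable_indic.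
  - move=> x; apply: cvg_near_cst.
    have [Dx|nDx] := pselect (D x).
      have := Dab _ Dx; apply: filterS => n abx.
      by rewrite !indicE !mem_set.
    apply: nearW => n; rewrite !indicE !memNset//= in_itv/= => abx.
    by apply: nDx; exact: abD abx.
  - move=> n x; rewrite !normrM ler_wpM2l// !indicE.
    case: (boolP (x \in `[a n, b n]%classic)) => [|_]; last by rewrite normr0.
    by rewrite inE/= in_itv/= => /abD Dx; rewrite mem_set.
have c2 : \int[mu]_x (h x * \1_(`[a n, b n]%classic) x) @[n --> \oo] --> l1 - l2.
  rewrite (_ : (fun n => _) = (fun n => H (b n) - H (a n))); first exact: cvgB.
  by apply/funext => n; rewrite -Rint_itv_indic (FTC_itv _ dH).
exact: (cvg_unique _ c1 c2).
Qed.

End ftc_line.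

(** The centred normal density of standard deviation s, sealed because unfolding the exponential makes unification diverge. *)
HB.lock Definition gdens {R : realType} (s x : R) : R :=
  (s * Num.sqrt (2 * pi))^-1 * expR (- (x ^+ 2) / (2 * s ^+ 2)).

(** * Normal densities *)

Section gaussian.
Context {R : realType}.
Notation mu := (@lebesgue_measure R).
Implicit Types (s x t c : R).

Lemma s2pi_gt0 : 0 < Num.sqrt (2 * pi) :> R.
Proof. by rewrite sqrtr_gt0 mulr_gt0// pi_gt0. Qed.

Lemma gdens_ge0 s x : 0 < s -> 0 <= gdens s x.
Proof. by move=> s0; rewrite gdens.unlock mulr_ge0 ?expR_ge0// invr_ge0 mulr_ge0 ?ltW// s2pi_gt0. Qed.

Lemma gdens_gt0 s x : 0 < s -> 0 < gdens s x.
Proof. by move=> s0; rewrite gdens.unlock mulr_gt0 ?expR_gt0// invr_gt0 mulr_gt0 ?s2pi_gt0. Qed.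

Lemma gdensN s x : gdens s (- x) = gdens s x.
Proof. by rewrite gdens.unlock sqrrN. Qed.

Lemma gdensE s : 0 < s -> gdens s = normal_pdf 0 s.
Proof.
move=> s0; apply/funext => x; rewrite normal_pdfE ?gt_eqF// gdens.unlock /normal_peak /normal_fun.
rewrite subr0; congr (_ ^-1 * expR (_ / _)).
  have -> : s ^+ 2 * pi *+ 2 = s ^+ 2 * (2 * pi) by rewrite -mulr_natl; ring.
  by rewrite [RHS]sqrtrM ?sqr_ge0// sqrtr_sqr gtr0_norm.
by rewrite mulr_natl.
Qed.

Lemma measurable_gdens s : measurable_fun setT (gdens s).
Proof. by rewrite gdens.unlock; meas. Qed.

Lemma intg_gdens s : 0 < s -> intg (gdens s).
Proof. by move=> s0; rewrite gdensE//; exact: integrable_normal_pdf. Qed.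

Lemma int_gdens s : 0 < s -> \int[mu]_x gdens s x = 1.
Proof. by move=> s0; rewrite gdensE// /Rintegral integral_normal_pdf. Qed.

Lemma eint_gdens s : 0 < s -> (\int[mu]_x (gdens s x)%:E = 1)%E.
Proof. by move=> s0; rewrite gdensE// integral_normal_pdf. Qed.

Lemma eint_gdens_shift s a : 0 < s -> (\int[mu]_x (gdens s (a - x)%R)%:E = 1)%E.
Proof.
move=> s0; rewrite -(ge0_integral_reflect a (f := EFin \o gdens s)) ?eint_gdens//.
  by apply/measurable_EFinP; exact: measurable_gdens.
by move=> x; rewrite lee_fin gdens_ge0.
Qed.

(** An exponential factor only shifts the mean of a normal law. *)
Lemma gdens_tilt s c x : 0 < s ->
  expR (c * x) * gdens s x = expR (c ^+ 2 * s ^+ 2 / 2) * gdens s (c * s ^+ 2 - x).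
Proof.
move=> s0; rewrite gdens.unlock mulrCA [RHS]mulrCA -!expRD; congr (_ * expR _).
by field; rewrite gt_eqF.
Qed.

Lemma intg_exp_gdens s c : 0 < s -> intg (fun x => expR (c * x) * gdens s x).
Proof.
move=> s0; apply: (@eq_intg _ (fun x => expR (c ^+ 2 * s ^+ 2 / 2) * gdens s (c * s ^+ 2 - x))).
  by move=> x; rewrite gdens_tilt.
by apply: intgZ; apply: intg_reflect; exact: intg_gdens.
Qed.

Lemma exp_norm_le c x : expR (c * `|x|) <= expR (c * x) + expR (- c * x).
Proof.
have [x0|x0] := ger0P x; first by rewrite lerDl expR_ge0.
by rewrite mulrN mulNr lerDr expR_ge0.
Qed.

Lemma intg_expn_gdens s c : 0 < s -> intg (fun x => expR (c * `|x|) * gdens s x).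
Proof.
move=> s0.
apply: (@intg_le _ _ (fun x => expR (c * x) * gdens s x + expR (- c * x) * gdens s x)).
- apply: measurable_funM; last exact: measurable_gdens.
  by meas.
- move=> x; rewrite normrM (ger0_norm (gdens_ge0 _ s0)) (ger0_norm (expR_ge0 _)).
  by rewrite -mulrDl ler_wpM2r ?gdens_ge0// exp_norm_le.
- by apply: intgD; exact: intg_exp_gdens.
Qed.

Lemma pow_le_exp n x : 0 <= x -> x ^+ n <= n`!%:R * expR x.
Proof.
move=> x0; case: n => [|n]; first by rewrite expr0 fact0 mul1r -expR0 ler_expR.
have := expR_ge1Dxn n x0; have := @fact_gt0 n.+1; rewrite -(ltr0n R) => f0.
set e := expR x; set p := x ^+ _ => h.
have : p / n.+1`!%:R <= e by apply: le_trans h; rewrite lerDr.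
by rewrite ler_pdivrMr// mulrC.
Qed.

Lemma intg_xgd s : 0 < s -> intg (fun x => `|x| * gdens s x).
Proof.
move=> s0; apply: (intg_le _ _ (intg_expn_gdens 1 s0)).
  by apply: measurable_funM; [meas|exact: measurable_gdens].
move=> x; rewrite normrM (ger0_norm (gdens_ge0 _ s0)) normr_id mul1r.
apply: ler_wpM2r; first exact: gdens_ge0.
by have := pow_le_exp 1 (normr_ge0 x); rewrite expr1 (_ : 1`! = 1)%N// mul1r.
Qed.

Lemma intg_gdens_bdd s (h : R -> R) M : 0 < s -> measurable_fun setT h ->
  (forall x, `|h x| <= M) -> intg (fun x => gdens s x * h x).
Proof.
move=> s0 mh hM; apply: (@intg_le _ _ (fun x => M * gdens s x)).
- by apply: measurable_funM => //; exact: measurable_gdens.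
- move=> x; rewrite normrM (ger0_norm (gdens_ge0 _ s0)) mulrC.
  by rewrite ler_wpM2r ?gdens_ge0.
- by apply: intgZ; exact: intg_gdens.
Qed.

Lemma has_deriv_gdens s x : 0 < s -> has_deriv (gdens s) x (- x / s ^+ 2 * gdens s x).
Proof.
move=> s0; rewrite gdens.unlock; eapply has_deriv_eq; first by deriv.
by rewrite /=; field; rewrite ?gt_eqF ?s2pi_gt0.
Qed.

Lemma gdens_norm s x y : `|x| = `|y| -> gdens s x = gdens s y.
Proof. by move=> xy; rewrite gdens.unlock -(real_normK (num_real x)) xy (real_normK (num_real y)). Qed.

Lemma cvg_gdens s : 0 < s -> gdens s n%:R @[n --> \oo] --> (0 : R).
Proof.
move=> s0.
have c0 : 0 <= (s * Num.sqrt (2 * pi))^-1.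
  by rewrite invr_ge0 mulr_ge0 ?ltW// s2pi_gt0.
have h : (s * Num.sqrt (2 * pi))^-1 * expR (- n%:R) @[n --> \oo] --> (0 : R).
  rewrite -[X in _ --> X](mulr0 (s * Num.sqrt (2 * pi))^-1).
  by apply: cvgM; [exact: cvg_cst|exact: cvgn_expR].
apply: (squeeze_cvgr _ (cvg_cst 0) h).
near=> n; rewrite gdens_ge0//=.
rewrite gdens.unlock.
rewrite ler_wpM2l// ler_expR mulNr lerN2.
rewrite ler_pdivlMr ?mulr_gt0 ?exprn_gt0// expr2 ler_wpM2l//.
by near: n; exact: nbhs_infty_ger.
Unshelve. all: by end_near. Qed.

Definition gdens_cos s t := \int[mu]_x (gdens s x * cos (t * x)).

Lemma has_deriv_gdens_cos s t : 0 < s ->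
  has_deriv (gdens_cos s) t (\int[mu]_x (gdens s x * (- sin (t * x) * x))).
Proof.
move=> s0; apply: (@has_deriv_Rint _ (fun t x => gdens s x * cos (t * x))
   (fun t x => gdens s x * (- sin (t * x) * x)) t 1 (fun x => `|x| * gdens s x)) => //.
- move=> u _; apply: (intg_gdens_bdd (M := 1) s0); first by meas.
  by move=> x; exact: cos_max.
- by move=> u x _; eapply has_deriv_eq; [by deriv|rewrite /=; ring].
- exact: intg_xgd.
- move=> u x _; rewrite !normrM normrN (ger0_norm (gdens_ge0 _ s0)) mulrC.
  apply: ler_wpM2r; first exact: gdens_ge0.
  by rewrite -[leRHS]mul1r ler_wpM2r// sin_max.
Qed.

(** Integration by parts: x times the density is - s^2 times its derivative. *)
Lemma int_xgd_sin s t : 0 < s ->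
  \int[mu]_x (gdens s x * (- sin (t * x) * x)) = - (s ^+ 2 * t) * gdens_cos s t.
Proof.
move=> s0.
have i1 : intg (fun x => gdens s x * (- sin (t * x) * x)).
  apply: (intg_le _ _ (intg_xgd s0)); first by apply: measurable_funM; [exact: measurable_gdens|meas].
  move=> x; rewrite !normrM normrN (ger0_norm (gdens_ge0 _ s0)) mulrC.
  apply: ler_wpM2r; first exact: gdens_ge0.
  by rewrite -[leRHS]mul1r ler_wpM2r// sin_max.
have i2 : intg (fun x => gdens s x * cos (t * x)).
  apply: (intg_gdens_bdd (M := 1) s0); first by meas.
  by move=> x; exact: cos_max.
(* the derivative of x |-> gdens s x * sin (t * x), which tends to 0 at both ends *)
pose h x := s ^- 2 * (gdens s x * (- sin (t * x) * x)) + t * (gdens s x * cos (t * x)).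
have ih : intg h by apply: intgD; exact: intgZ.
have dH x : has_deriv (fun x => gdens s x * sin (t * x)) x (h x).
  have dg := has_deriv_gdens x s0.
  by eapply has_deriv_eq; [by deriv|rewrite /h /=; ring].
have ch : continuous h.
  move=> x; have dg := has_deriv_gdens x s0.
  by eapply has_deriv_cont; rewrite /h; deriv.
have Hc (e : nat -> R) : (forall n, `|e n| = n.+1%:R) ->
    gdens s (e n) * sin (t * e n) @[n --> \oo] --> (0 : R).
  move=> en; apply: (@cvg0_of_norm_le _ _ (fun n => gdens s n.+1%:R)) => [n|]; last first.
    by have := cvg_gdens s0; rewrite -cvg_shiftS.
  rewrite normrM (ger0_norm (gdens_ge0 _ s0)).
  have -> : gdens s n.+1%:R = gdens s (e n) by apply: gdens_norm; rewrite en ger0_norm.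
  by rewrite -[leRHS]mulr1 ler_wpM2l ?gdens_ge0// sin_max.
have : \int[mu]_x (h x * \1_setT x) = 0 - 0.
  apply: (@FTC_exhaust _ setT (fun x => gdens s x * sin (t * x)) h
    (fun n => - n.+1%:R) (fun n => n.+1%:R)) => //.
  - by move=> n; have : 0 < n.+1%:R :> R by []; lra.
  - move=> x _; near=> n; rewrite -ler_norml.
    have : `|x| <= n%:R by near: n; exact: nbhs_infty_ger.
    by move=> /le_trans; apply; rewrite ler_nat.
  - by apply: eq_intg ih => x; rewrite indicE in_setT mulr1.
  - by apply: Hc => n; rewrite ger0_norm.
  - by apply: Hc => n; rewrite normrN ger0_norm.
under eq_Rintegral do rewrite indicE in_setT mulr1.
rewrite subrr RintD; [|exact: intgZ..].
rewrite !RintZ// -/(gdens_cos s t) => /eqP; rewrite addr_eq0 => /eqP.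
set I := \int[mu]_x _ => e.
have -> : I = s ^+ 2 * (s ^- 2 * I) by field; rewrite gt_eqF.
by rewrite e; ring.
Unshelve. all: by end_near. Qed.

(** As a function of t, both sides solve y' = - s^2 t y with y(0) = 1, by
differentiation under the integral sign and the previous integration by parts. *)
Lemma gdens_cosE s t : 0 < s -> gdens_cos s t = expR (- (s ^+ 2 * t ^+ 2) / 2).
Proof.
move=> s0.
(* the quotient of the two solutions, which is constant *)
pose k t := gdens_cos s t * expR (s ^+ 2 * t ^+ 2 / 2).
have dk u : is_derive u (1 : R) k 0.
  have := has_deriv_gdens_cos u s0; rewrite int_xgd_sin// => h.
  by eapply has_deriv_eq; [rewrite /k; by deriv|rewrite /=; field].
have : k t = k 0 by apply: is_derive_0_is_cst.
rewrite /k expr0n/= mulr0 mul0r expR0 mulr1 => h.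
have -> : gdens_cos s t = gdens_cos s t * expR (s ^+ 2 * t ^+ 2 / 2) * expR (- (s ^+ 2 * t ^+ 2) / 2).
  by rewrite -mulrA -expRD -mulrDl subrr mul0r expR0 mulr1.
rewrite h /gdens_cos; under eq_Rintegral do rewrite mul0r cos0 mulr1.
by rewrite int_gdens// mul1r.
Qed.

(** The transform of a wide Gaussian is a narrow one. This is the only instance
of Fourier inversion that is computed; all others are deduced from it. *)
Lemma gdens_cos_dual n t : 0 < n ->
  Num.sqrt (2 * pi) * n * gdens_cos n t = 2 * pi * gdens (n^-1) t.
Proof.
move=> n0; rewrite gdens_cosE// gdens.unlock.
set q := Num.sqrt (2 * pi); have q0 : 0 < q := s2pi_gt0.
have -> : 2 * pi = q ^+ 2 by rewrite /q sqr_sqrtr// mulr_ge0// pi_ge0.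
have -> : - t ^+ 2 / (2 * n^-1 ^+ 2) = - (n ^+ 2 * t ^+ 2) / 2.
  by field; rewrite gt_eqF.
by field; rewrite ?gt_eqF.
Qed.

Lemma gdens_scale b x : 0 < b -> gdens b (b * x) = b^-1 * gdens 1 x.
Proof.
move=> b0; rewrite gdens.unlock.
have -> : - (b * x) ^+ 2 / (2 * b ^+ 2) = - x ^+ 2 / (2 * 1 ^+ 2).
  by field; rewrite gt_eqF.
by field; rewrite !gt_eqF// s2pi_gt0.
Qed.

(** After rescaling, the kernel is fixed and the argument of h tends to a. *)
Lemma gdens_approx (h : R -> R) (M : R) a : continuous h -> (forall x, `|h x| <= M) ->
  \int[mu]_x (h x * gdens (n.+1%:R^-1) (a - x)) @[n --> \oo] --> h a.
Proof.
move=> ch hM.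
have mh : measurable_fun setT h by exact: continuous_measurable_fun.
have e n : \int[mu]_x (h x * gdens (n.+1%:R^-1) (a - x)) =
           \int[mu]_x (gdens 1 x * h (a - n.+1%:R^-1 * x)).
  have b0 : 0 < n.+1%:R^-1 :> R by rewrite invr_gt0.
  move: (n.+1%:R^-1) b0 => b b0.
  have mha : measurable_fun setT (fun x => h (a - b * x)).
    by apply: (measurableT_comp mh); meas.
  have hi : intg (fun x => b^-1 * (gdens 1 x * h (a - b * x))).
    by apply: intgZ; apply: (intg_gdens_bdd (M := M)).
  rewrite (Rint_reflect a); last first.
    by apply: measurable_funM => //; apply: (measurableT_comp (measurable_gdens _)); meas.
  rewrite (@Rint_scale _ b)//; last first.
    apply: measurable_funM; first by apply: (measurableT_comp mh); meas.
    by apply: (measurableT_comp (measurable_gdens _)); meas.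
  have E x : h (a - b * x) * gdens b (a - (a - b * x)) = b^-1 * (gdens 1 x * h (a - b * x)).
    by rewrite opprB addrCA subrr addr0 gdens_scale//; ring.
  rewrite (eq_Rint E) -RintZ//.
  by apply: eq_Rint => x; rewrite mulrA divff ?gt_eqF// mul1r.
rewrite (_ : (fun n => _) = (fun n => \int[mu]_x (gdens 1 x * h (a - n.+1%:R^-1 * x)))); last first.
  by apply/funext => n; exact: e.
have -> : h a = \int[mu]_x (gdens 1 x * h a).
  under eq_Rintegral do rewrite mulrC.
  by rewrite RintZ ?int_gdens ?mulr1//; exact: intg_gdens.
apply: (@dominated_cvg_Rint _ _ _ (fun x => M * gdens 1 x)).
- move=> n; apply: measurable_funM; first exact: measurable_gdens.
  by apply: (measurableT_comp mh); meas.
- by apply: measurable_funM; [exact: measurable_gdens|meas].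
- move=> x; apply: cvgM; first exact: cvg_cst.
  have c0 : (a - n.+1%:R^-1 * x) @[n --> \oo] --> a.
    rewrite -[X in _ --> X]subr0; apply: cvgB; first exact: cvg_cst.
    rewrite -[X in _ --> X](mul0r x); apply: cvgM; last exact: cvg_cst.
    exact: cvg_harmonic.
  exact: (cvg_comp _ _ c0 (ch a)).
- by apply: intgZ; exact: intg_gdens.
- move=> n x; rewrite normrM (ger0_norm (gdens_ge0 _ ltr01)) mulrC.
  by rewrite ler_wpM2r ?gdens_ge0.
Qed.

End gaussian.

(** * Fourier transform: weighted norms, Plancherel, uniqueness *)

Section fourier.
Context {R : realType}.
Notation mu := (@lebesgue_measure R).
Implicit Types (g h k w : R -> R) (s t x : R).

Lemma intg_mulb g h M : intg g -> measurable_fun setT h ->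
  (forall x, `|h x| <= M) -> intg (fun x => g x * h x).
Proof.
move=> gi mh hM; apply: (@intg_le _ _ (fun x => M * `|g x|)).
- by apply: measurable_funM => //; exact: intg_meas.
- by move=> x; rewrite normrM mulrC ler_wpM2r.
- by apply: intgZ; exact: intg_norm.
Qed.

Lemma norm_Rint_mulb g h M : intg g -> measurable_fun setT h ->
  (forall x, `|h x| <= M) -> `|\int[mu]_x (g x * h x)| <= M * \int[mu]_x `|g x|.
Proof.
move=> gi mh hM; have i := intg_mulb gi mh hM.
apply: (le_trans (le_norm_Rint i)); rewrite -RintZ; last exact: intg_norm.
apply: le_Rint; [exact: intg_norm|by apply: intgZ; exact: intg_norm|].
by move=> x; rewrite normrM mulrC ler_wpM2r.
Qed.

Lemma normb_le1 (b : bool) : `|b%:R : R| <= 1.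
Proof. by case: b; rewrite ?normr1 ?normr0. Qed.

Lemma aeS (P Q : R -> Prop) : (forall x, P x -> Q x) ->
  {ae mu, forall x, P x} -> {ae mu, forall x, Q x}.
Proof.
by move=> PQ; apply: filterS => //; exact: (ae_filter_ringOfSetsType mu).
Qed.

(** When the integral of g diverges, both sides are still given by the same
conventions on infinite integrals. *)
Lemma RintZ' c g : measurable_fun setT g ->
  \int[mu]_x (c * g x) = c * \int[mu]_x g x.
Proof.
move=> mg.
have P b (f : R -> R) : measurable_fun setT f -> 0 < b ->
    \int[mu]_x (b * f x) = b * \int[mu]_x f x.
  move=> mf b0; rewrite !RintE -fineZB//; [|exact: integral_ge0..].
  congr (fine (_ - _)%E).
    rewrite -ge0_integralZl//; [|exact: measurable_EFin_pos|by rewrite lee_fin ltW].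
    by apply: eq_integral => x _; rewrite !funeposE/= EFinM maxeMr ?lee_fin ?ltW// mule0.
  rewrite -ge0_integralZl//; [|exact: measurable_EFin_neg|by rewrite lee_fin ltW].
  by apply: eq_integral => x _; rewrite !funenegE/= -!EFin_max -EFinM maxr_pMr ?ltW// mulr0 mulrN.
have N (f : R -> R) : \int[mu]_x (- f x) = - \int[mu]_x f x.
  have pE : (\int[mu]_x (EFin \o (fun x => (- f x)%R))^\+ x = \int[mu]_x (EFin \o f)^\- x)%E.
    by apply: eq_integral => x _; rewrite funeposE funenegE.
  have nE : (\int[mu]_x (EFin \o (fun x => (- f x)%R))^\- x = \int[mu]_x (EFin \o f)^\+ x)%E.
    by apply: eq_integral => x _; rewrite funeposE funenegE/= opprK.
  rewrite !RintE pE nE.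
  have p0 : (0 <= \int[mu]_x (EFin \o f)^\+ x)%E by exact: integral_ge0.
  have n0 : (0 <= \int[mu]_x (EFin \o f)^\- x)%E by exact: integral_ge0.
  move: p0 n0; set p := (\int[mu]_x _)%E; set n := (\int[mu]_x _)%E.
  by move: p n => [p| |] [n| |] //= _ _; rewrite ?oppr0 ?opprB.
have [c0|c0|->] := ltgtP c 0; last by rewrite mul0r; under eq_Rintegral do rewrite mul0r; rewrite Rint_zero.
  rewrite -[c]opprK mulNr -P ?oppr_gt0// -N.
  by apply: eq_Rint => x; rewrite mulNr.
exact: P.
Qed.

(** The real and imaginary parts of the Fourier transform are kept apart, so
that all integrals stay real. *)
Definition cosT g s := \int[mu]_t (g t * cos (s * t)).
Definition sinT g s := \int[mu]_t (g t * sin (s * t)).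

Lemma intg_cos g s : intg g -> intg (fun t => g t * cos (s * t)).
Proof. by move=> gi; apply: (intg_mulb (M := 1) gi) => [|x]; [meas|exact: cos_max]. Qed.
Lemma intg_sin g s : intg g -> intg (fun t => g t * sin (s * t)).
Proof. by move=> gi; apply: (intg_mulb (M := 1) gi) => [|x]; [meas|exact: sin_max]. Qed.
Lemma cosT_le g s : intg g -> `|cosT g s| <= \int[mu]_x `|g x|.
Proof.
move=> gi; rewrite -[leRHS]mul1r; apply: norm_Rint_mulb => //; first by meas.
by move=> x; exact: cos_max.
Qed.
Lemma sinT_le g s : intg g -> `|sinT g s| <= \int[mu]_x `|g x|.
Proof.
move=> gi; rewrite -[leRHS]mul1r; apply: norm_Rint_mulb => //; first by meas.
by move=> x; exact: sin_max.
Qed.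
Lemma measurable_cosT g : intg g -> measurable_fun setT (cosT g).
Proof.
move=> gi; apply: (@measurable_Rint_param R _ (measurableTypeR R) (fun z => g z.2 * cos (z.1 * z.2))).
by apply: measurable_funM; [apply: (measurableT_comp (intg_meas gi))|meas].
Qed.
Lemma measurable_sinT g : intg g -> measurable_fun setT (sinT g).
Proof.
move=> gi; apply: (@measurable_Rint_param R _ (measurableTypeR R) (fun z => g z.2 * sin (z.1 * z.2))).
by apply: measurable_funM; [apply: (measurableT_comp (intg_meas gi))|meas].
Qed.

Lemma cosT_sinT_shift g s t : intg g ->
  cos (s * t) * cosT g s + sin (s * t) * sinT g s = \int[mu]_u (g u * cos (s * (t - u))).
Proof.
move=> gi; rewrite -!RintZ; [|exact: intg_sin|exact: intg_cos].
rewrite -RintD; [|apply: intgZ; exact: intg_cos|apply: intgZ; exact: intg_sin].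
by apply: eq_Rint => u; rewrite mulrBr cosB; ring.
Qed.

(** Fubini, after writing the bracket as a single cosine integral. *)
Lemma Rint_weight_shift w g t : intg w -> intg g ->
  \int[mu]_s (w s * (cos (s * t) * cosT g s + sin (s * t) * sinT g s)) =
  \int[mu]_u (g u * cosT w (t - u)).
Proof.
move=> wi gi.
pose f (z : R * R) := w z.1 * (g z.2 * cos (z.1 * (t - z.2))).
have fi : intg2 f.
  apply: (intg2_le _ _ (intg2_prod (intg_norm wi) (intg_norm gi))).
    apply: measurable_funM; first by apply: (measurableT_comp (intg_meas wi)).
    by apply: measurable_funM; [apply: (measurableT_comp (intg_meas gi))|meas].
  move=> z; rewrite /f !normrM ler_wpM2l// -[leRHS]mulr1 ler_wpM2l//.
  exact: cos_max.
transitivity (\int[mu]_s \int[mu]_u f (s, u)).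
  apply: eq_Rint => s; rewrite cosT_sinT_shift// -RintZ//.
  apply: (intg_mulb (M := 1) gi) => [|x]; [meas|exact: cos_max].
rewrite Rint_fubini//; apply: eq_Rint => u; rewrite /cosT -RintZ; last exact: intg_cos.
by apply: eq_Rint => s; rewrite /f/= mulrCA mulrC [in RHS]mulrC (mulrC s).
Qed.

(** Expand the square of the transform and integrate in s first: what is left
of the weight is its own transform at t - u. With Gaussian weights this yields
Plancherel's formula, with the Lorentz weight it yields the Cauchy transform
of the Berezin kernel. *)
Lemma Rint_weight w g : intg w -> intg g ->
  intg (fun s => w s * (cosT g s ^+ 2 + sinT g s ^+ 2)) /\
  \int[mu]_s (w s * (cosT g s ^+ 2 + sinT g s ^+ 2)) =
  \int[mu]_t (g t * \int[mu]_u (g u * cosT w (t - u))).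
Proof.
move=> wi gi; set M := \int[mu]_x `|g x|.
have M0 : 0 <= M by apply: le_trans (cosT_le 0 gi).
have mC := measurable_cosT gi; have mS := measurable_sinT gi.
split.
  apply: (intg_mulb (M := M ^+ 2 + M ^+ 2) wi); first by meas.
  move=> s; rewrite ger0_norm ?addr_ge0 ?sqr_ge0//.
  by rewrite -(real_normK (num_real (cosT g s))) -(real_normK (num_real (sinT g s)))
    lerD// lerXn2r ?nnegrE// ?cosT_le ?sinT_le.
pose f (z : R * R) := w z.1 * (g z.2 * (cos (z.1 * z.2) * cosT g z.1 + sin (z.1 * z.2) * sinT g z.1)).
have fi : intg2 f.
  have := intg2_prod (intg_norm wi) (intgZ (M + M) (intg_norm gi)).
  apply: intg2_le.
    apply: measurable_funM; first by apply: (measurableT_comp (intg_meas wi)).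
    apply: measurable_funM; first by apply: (measurableT_comp (intg_meas gi)).
    have mC1 : measurable_fun setT (fun z : R * R => cosT g z.1) by apply: measurableT_comp.
    have mS1 : measurable_fun setT (fun z : R * R => sinT g z.1) by apply: measurableT_comp.
    by meas.
  move=> z; rewrite /f/= !normrM ler_wpM2l// mulrC ler_wpM2r//.
  apply: (le_trans (ler_normD _ _)); rewrite !normrM lerD//.
    by rewrite -[leRHS]mul1r ler_pM// ?cos_max ?cosT_le.
  by rewrite -[leRHS]mul1r ler_pM// ?sin_max ?sinT_le.
transitivity (\int[mu]_s \int[mu]_t f (s, t)).
  apply: eq_Rint => s.
  rewrite /f /= RintZ; last first.
    apply: (intg_mulb (M := M + M) gi); first by meas.
    move=> t; apply: (le_trans (ler_normD _ _)); rewrite !normrM lerD//.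
      by rewrite -[leRHS]mul1r ler_pM// ?cos_max ?cosT_le.
    by rewrite -[leRHS]mul1r ler_pM// ?sin_max ?sinT_le.
  congr (_ * _).
  transitivity (cosT g s * \int[mu]_t (g t * cos (s * t)) + sinT g s * \int[mu]_t (g t * sin (s * t))).
    by rewrite -/(cosT g s) -/(sinT g s) !expr2.
  rewrite -!RintZ; [|exact: intg_sin|exact: intg_cos].
  rewrite -RintD; [|apply: intgZ; exact: intg_cos|apply: intgZ; exact: intg_sin].
  by apply: eq_Rint => t; ring.
rewrite Rint_fubini//; apply: eq_Rint => t.
rewrite -Rint_weight_shift// -RintZ; last first.
  apply: (intg_mulb (M := M + M) wi); first by meas.
  move=> s; apply: (le_trans (ler_normD _ _)); rewrite !normrM lerD//.
    by rewrite -[leRHS]mul1r ler_pM// ?cos_max ?cosT_le.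
  by rewrite -[leRHS]mul1r ler_pM// ?sin_max ?sinT_le.
by apply: eq_Rint => s; rewrite /f/=; ring.
Qed.

(** Fatou's lemma, in the form in which a uniform bound passes to the limit. *)
Lemma fatou_bound (f_ : nat -> R -> R) (f : R -> R) (B : \bar R) :
  (forall n, measurable_fun setT (f_ n)) -> measurable_fun setT f ->
  (forall n x, 0 <= f_ n x) -> (forall x, 0 <= f x) ->
  {ae mu, forall x, f_ ^~ x @ \oo --> f x} ->
  (forall n, (\int[mu]_x (f_ n x)%:E <= B)%E) -> (\int[mu]_x (f x)%:E <= B)%E.
Proof.
move=> mf_ mf f0_ f0 ff fB.
have mE n : measurable_fun setT (EFin \o f_ n) by exact/measurable_EFinP.
have := fatou mu measurableT mE (fun n x _ => f0_ n x).
have -> : (\int[mu]_x limn_einf (fun n => (EFin \o f_ n) x) = \int[mu]_x (f x)%:E)%E.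
  apply: ge0_ae_eq_integral => //.
  - rewrite (_ : (fun x => _) = (fun x => - limn_esup (fun n => - (EFin \o f_ n) x))%E).
      apply: measurableT_comp => //; apply: measurable_fun_limn_esup => n.
      by apply: measurableT_comp => //; exact: mE.
    by apply/funext => x; rewrite -[RHS]limn_einfN; congr limn_einf; apply/funext => n /=; rewrite opprK.
  - exact/measurable_EFinP.
  - move=> x _; rewrite limn_einf_lim; apply: lime_ge; first exact: is_cvg_einfs.
    by apply: nearW => n; apply: le_ereal_inf_tmp => _ [m _ <-]; rewrite lee_fin.
  - by move=> x _; rewrite lee_fin.
  - move: ff; apply: aeS => x fx _.
    have fx' : (EFin \o f_ n) x @[n --> \oo] --> (f x)%:E by apply: cvg_EFin; [exact: nearW|exact: fx].
    by rewrite (is_cvg_limn_einfE _) ?(cvg_lim _ fx')//; apply/cvg_ex; eexists; exact: fx'.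
move=> /le_trans; apply.
rewrite limn_einf_lim; apply: lime_le; first exact: is_cvg_einfs.
apply: nearW => n; apply: le_trans (fB n).
by apply: ereal_inf_lbound; exists n => //=.
Qed.

(** A multiple of a normal density, so that its transform is known; it increases
to 1 with n. *)
Definition gweight (n : nat) s := Num.sqrt (2 * pi) * n.+1%:R * gdens n.+1%:R s.

Lemma gweightE n s : gweight n s = expR (- (s ^+ 2) / (2 * n.+1%:R ^+ 2)).
Proof.
rewrite /gweight gdens.unlock; have := @s2pi_gt0 R => q0.
by field; rewrite gt_eqF//= pnatr_eq0.
Qed.

Lemma gweight_ge0 n s : 0 <= gweight n s.
Proof. by rewrite gweightE expR_ge0. Qed.

Lemma gweight_le1 n s : gweight n s <= 1.
Proof.
by rewrite gweightE expR_le1 mulNr oppr_le0 mulr_ge0 ?sqr_ge0.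
Qed.

Lemma cvg_gweight s : gweight n s @[n --> \oo] --> (1 : R).
Proof.
have -> : (fun n => gweight n s) = (fun n => expR (- (s ^+ 2 / 2 * (n.+1%:R^-1 ^+ 2)))).
  apply/funext => n; rewrite gweightE; have : n.+1%:R != 0 :> R by rewrite pnatr_eq0.
  by move: (n.+1%:R) => N N0; congr expR; field.
have c0 : - (s ^+ 2 / 2 * (n.+1%:R^-1 ^+ 2)) @[n --> \oo] --> (0 : R).
  rewrite -oppr0; apply: cvgN; rewrite -(mulr0 (s ^+ 2 / 2)).
  apply: cvgM; first exact: cvg_cst.
  rewrite -(mulr0 0); under eq_fun do rewrite expr2.
  by apply: cvgM; exact: cvg_harmonic.
have := cvg_comp _ _ c0 (@continuous_expR R 0); rewrite expR0; exact.
Qed.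

Lemma intg_gweight n : intg (gweight n).
Proof. by apply: intgZ; exact: intg_gdens. Qed.

Lemma measurable_gweight n : measurable_fun setT (gweight n).
Proof. exact: intg_meas (intg_gweight n). Qed.

Lemma cosT_gweight n t : cosT (gweight n) t = 2 * pi * gdens (n.+1%:R^-1) t.
Proof.
rewrite -gdens_cos_dual// /cosT /gdens_cos -RintZ.
  by apply: eq_Rint => x; rewrite mulrA.
by apply: intg_cos; exact: intg_gdens.
Qed.

Definition fnorm2 g s := cosT g s ^+ 2 + sinT g s ^+ 2.
Lemma fnorm2_ge0 g s : 0 <= fnorm2 g s.
Proof. by rewrite addr_ge0 ?sqr_ge0. Qed.
Lemma measurable_fnorm2 g : intg g -> measurable_fun setT (fnorm2 g).
Proof.
by move=> gi; have mC := measurable_cosT gi; have mS := measurable_sinT gi; rewrite /fnorm2; meas.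
Qed.

Lemma gdens_le s x : 0 < s -> gdens s x <= (s * Num.sqrt (2 * pi))^-1.
Proof.
move=> s0; rewrite gdens.unlock ler_piMr//.
  by rewrite invr_ge0 mulr_ge0 ?ltW// s2pi_gt0.
rewrite expR_le1 mulNr oppr_le0 mulr_ge0 ?sqr_ge0//.
by rewrite invr_ge0 mulr_ge0 ?sqr_ge0.
Qed.

(** Since g(t) g(u) is at most the mean of the squares, Tonelli and the unit mass
of the density bound the form by the integral of g^2. *)
Lemma gdens_form_le s g : 0 < s -> intg g -> intg (fun t => g t ^+ 2) ->
  \int[mu]_t (g t * \int[mu]_u (g u * gdens s (t - u))) <= \int[mu]_t (g t ^+ 2).
Proof.
move=> s0 gi g2i; set c := (s * Num.sqrt (2 * pi))^-1.
have mg := intg_meas gi; have mg2 := intg_meas g2i.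
have mN : measurable_fun setT (fun z : R * R => gdens s (z.1 - z.2)).
  by apply: (measurableT_comp (measurable_gdens s)); meas.
have mNt t : measurable_fun setT (fun u : R => gdens s (t - u)).
  by apply: (measurableT_comp (measurable_gdens s)); meas.
have Nb x : `|gdens s x| <= c by rewrite ger0_norm ?gdens_ge0 ?gdens_le.
have c0 : 0 <= c by apply: le_trans (Nb 0).
pose f (z : R * R) := g z.1 * g z.2 * gdens s (z.1 - z.2).
pose p (z : R * R) := g z.1 ^+ 2 * gdens s (z.1 - z.2).
have mg1 : measurable_fun setT (fun z : R * R => g z.1) by apply: measurableT_comp.
have mg2' : measurable_fun setT (fun z : R * R => g z.2) by apply: measurableT_comp.
have fi : intg2 f.
  have := intg2_prod (intgZ c (intg_norm gi)) (intg_norm gi).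
  apply: intg2_le; first by rewrite /f; meas.
  move=> z; rewrite /f !normrM mulrC mulrA ler_wpM2r// ler_wpM2r//.
have pi2 : intg2 p.
  apply/intg2P; first by rewrite /p; meas.
  have E x : (\int[mu]_y `|p (x, y)|%:E = (g x ^+ 2)%:E)%E.
    transitivity (\int[mu]_y ((g x ^+ 2)%:E * (gdens s (x - y)%R)%:E))%E.
      by apply: eq_integral => y _; rewrite /p/= normrM (ger0_norm (gdens_ge0 _ s0)) ger0_norm ?sqr_ge0// EFinM.
    rewrite ge0_integralZl//=.
    - by rewrite eint_gdens_shift// mule1.
    - by apply/measurable_EFinP; exact: mNt.
    - by move=> y _; rewrite lee_fin gdens_ge0.
    - by rewrite lee_fin sqr_ge0.
  under eq_integral do rewrite E.
  case/intgP : g2i => _; congr (_ < _)%E; apply: eq_integral => x _.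
  by rewrite ger0_norm ?sqr_ge0.
have qi := intg2_swap pi2.
have gdi t : intg (fun u => gdens s (t - u)) by apply: intg_reflect; exact: intg_gdens.
have -> : \int[mu]_t (g t * \int[mu]_u (g u * gdens s (t - u))) = \int[mu]_t \int[mu]_u f (t, u).
  apply: eq_Rint => t; rewrite -RintZ; last exact: (intg_mulb (M := c)).
  by apply: eq_Rint => u; rewrite /f/= mulrA.
have pE : \int[mu]_t \int[mu]_u p (t, u) = \int[mu]_t (g t ^+ 2).
  apply: eq_Rint => t; rewrite /p/= RintZ// -[LHS]/(_ * _).
  by rewrite /Rintegral eint_gdens_shift//= mulr1.
have qE : \int[mu]_t \int[mu]_u p (u, t) = \int[mu]_t (g t ^+ 2).
  by rewrite -pE (Rint_fubini pi2).
have -> : \int[mu]_t (g t ^+ 2) =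
    \int[mu]_t (2^-1 * \int[mu]_u p (t, u) + 2^-1 * \int[mu]_u p (u, t)).
  have [h1 _] := Rint_fubini1 pi2; have [h2 _] := Rint_fubini2 pi2.
  by rewrite RintD ?RintZ ?pE ?qE//; [field|exact: intgZ..].
have [h1 _] := Rint_fubini1 pi2; have [h2 _] := Rint_fubini2 pi2.
apply: le_Rint; [exact: (Rint_fubini1 fi).1|by apply: intgD; exact: intgZ|].
move=> t.
have i1 : intg (fun u => p (t, u)) by exact: (intgZ (g t ^+ 2) (gdi t)).
have i2 : intg (fun u => p (u, t)).
  by apply: (intg_mulb (M := c)) => //; apply: (measurableT_comp (measurable_gdens s)); meas.
rewrite -!RintZ// -RintD; [|exact: intgZ..].
apply: le_Rint; [|by apply: intgD; exact: intgZ|].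
  apply: (@eq_intg _ (fun u => g t * (g u * gdens s (t - u)))).
    by move=> u; rewrite /f/= mulrA.
  by apply: intgZ; apply: (intg_mulb (M := c)).
move=> u; rewrite /f /p/=.
have -> : gdens s (u - t) = gdens s (t - u) by rewrite -gdensN opprB.
rewrite !mulrA -mulrDl ler_wpM2r ?gdens_ge0//.
move: (g t) (g u) => x y; rewrite -subr_ge0.
have -> : 2^-1 * x * x + 2^-1 * y * y - x * y = 2^-1 * (x - y) ^+ 2 by field.
by rewrite mulr_ge0 ?sqr_ge0.
Qed.

Lemma intg_gdensconv s g t : 0 < s -> intg g -> intg (fun u => g u * gdens s (t - u)).
Proof.
move=> s0 gi; apply: (intg_mulb (M := (s * Num.sqrt (2 * pi))^-1)) => //.
  by apply: (measurableT_comp (measurable_gdens _)); meas.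
by move=> u; rewrite ger0_norm ?gdens_ge0 ?gdens_le.
Qed.

Lemma measurable_gdensconv s g : intg g ->
  measurable_fun setT (fun t => \int[mu]_u (g u * gdens s (t - u))).
Proof.
move=> gi; apply: (@measurable_Rint_param R _ (measurableTypeR R) (fun z => g z.2 * gdens s (z.1 - z.2))).
apply: measurable_funM; first by apply: (measurableT_comp (intg_meas gi)).
by apply: (measurableT_comp (measurable_gdens _)); meas.
Qed.

Lemma gweight_form n g : intg g ->
  \int[mu]_t (g t * \int[mu]_u (g u * cosT (gweight n) (t - u))) =
  2 * pi * \int[mu]_t (g t * \int[mu]_u (g u * gdens (n.+1%:R^-1) (t - u))).
Proof.
move=> gi; have n0 : 0 < n.+1%:R^-1 :> R by rewrite invr_gt0.
rewrite -RintZ.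
  apply: eq_Rint => t; rewrite mulrCA; congr (_ * _).
  rewrite -RintZ; last exact: intg_gdensconv.
  by apply: eq_Rint => u; rewrite cosT_gweight mulrCA.
apply: (intg_mulb (M := (n.+1%:R^-1 * Num.sqrt (2 * pi))^-1 * \int[mu]_x `|g x|)) => //.
  exact: measurable_gdensconv.
move=> t; apply: norm_Rint_mulb => //.
  by apply: (measurableT_comp (measurable_gdens _)); meas.
by move=> u; rewrite ger0_norm ?gdens_ge0 ?gdens_le.
Qed.

(** The Gaussian weights give forms bounded by the integral of g^2; they increase
to 1, and Fatou's lemma applies. *)
Lemma plancherel_le g : intg g ->
  (\int[mu]_s (fnorm2 g s)%:E <= (2 * pi)%:E * \int[mu]_t (g t ^+ 2)%:E)%E.
Proof.
move=> gi; have mg := intg_meas gi.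
have [foo|] := boolP (\int[mu]_t (g t ^+ 2)%:E < +oo)%E; last first.
  rewrite ltey negbK => /eqP ->; rewrite gt0_muley ?leey//.
  by rewrite lte_fin mulr_gt0// pi_gt0.
have g2i : intg (fun t => g t ^+ 2).
  by apply: intg_ge0_lty => //; [meas|move=> x; exact: sqr_ge0].
apply: (@fatou_bound (fun n s => gweight n s * fnorm2 g s)).
- by move=> n; apply: measurable_funM; [exact: measurable_gweight|exact: measurable_fnorm2].
- exact: measurable_fnorm2.
- by move=> n x; rewrite mulr_ge0 ?gweight_ge0 ?fnorm2_ge0.
- by move=> x; exact: fnorm2_ge0.
- apply: aeW => x; rewrite -[X in _ --> X]mul1r; apply: cvgM; last exact: cvg_cst.
  exact: cvg_gweight.
- move=> n; have [i e] := Rint_weight (intg_gweight n) gi.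
  rewrite -EFin_Rint// -[X in (_ <= _ * X)%E]EFin_Rint// -EFinM lee_fin e.
  rewrite gweight_form// ler_pM2l; last by rewrite mulr_gt0// pi_gt0.
  by apply: gdens_form_le => //; rewrite invr_gt0.
Qed.

(** For continuous bounded g the Gaussian forms converge to the integral of g^2,
and they stay below the integral of the square of the transform. *)
Lemma plancherel_ge_cont g M : intg g -> continuous g -> (forall x, `|g x| <= M) ->
  ((2 * pi)%:E * \int[mu]_t (g t ^+ 2)%:E <= \int[mu]_s (fnorm2 g s)%:E)%E.
Proof.
move=> gi cg gM; have mg := intg_meas gi.
have g2i : intg (fun t => g t ^+ 2).
  by apply: (@eq_intg _ (fun t => g t * g t)) => //; exact: (intg_mulb gi mg gM).
rewrite -[X in (_ * X)%E]EFin_Rint// -EFinM.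
have c1 : 2 * pi * \int[mu]_t (g t * \int[mu]_u (g u * gdens (n.+1%:R^-1) (t - u)))
    @[n --> \oo] --> 2 * pi * \int[mu]_t (g t ^+ 2).
  apply: cvgM; first exact: cvg_cst.
  apply: (@dominated_cvg_Rint _ _ _ (fun x => M * `|g x|)).
  - by move=> n; apply: measurable_funM => //; exact: measurable_gdensconv.
  - by meas.
  - by move=> t; rewrite expr2; apply: cvgM; [exact: cvg_cst|exact: gdens_approx gM].
  - by apply: intgZ; exact: intg_norm.
  - move=> n t; have n0 : 0 < n.+1%:R^-1 :> R by rewrite invr_gt0.
    rewrite normrM mulrC ler_wpM2r//.
    have i := intg_gdensconv t n0 gi.
    apply: (le_trans (le_norm_Rint i)).
    have <- : \int[mu]_u (M * gdens (n.+1%:R^-1) (t - u)) = M.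
      rewrite RintZ; first by rewrite /Rintegral eint_gdens_shift//= mulr1.
      by apply: intg_reflect; exact: intg_gdens.
    apply: le_Rint; first exact: intg_norm.
      by apply: intgZ; apply: intg_reflect; exact: intg_gdens.
    by move=> u; rewrite normrM (ger0_norm (gdens_ge0 _ n0)) ler_wpM2r ?gdens_ge0.
have [foo|] := boolP (\int[mu]_s (fnorm2 g s)%:E < +oo)%E; last first.
  by rewrite ltey negbK => /eqP ->; rewrite leey.
have ei : intg (fnorm2 g).
  apply: intg_ge0_lty => //; first exact: measurable_fnorm2.
  by move=> x; exact: fnorm2_ge0.
rewrite -EFin_Rint// lee_fin -(cvg_lim _ c1)//.
apply: limr_le; first by apply/cvg_ex; eexists; exact: c1.
apply: nearW => n; rewrite -gweight_form//.
have [i <-] := Rint_weight (intg_gweight n) gi.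
apply: le_Rint => // s; rewrite -/(fnorm2 g s) -[leRHS]mul1r.
by rewrite ler_wpM2r ?fnorm2_ge0// gweight_le1.
Qed.

Definition convol g k x := \int[mu]_t (g t * k (x - t)).

Lemma intg2_conv g k : intg g -> intg k -> intg2 (fun z => g z.2 * k (z.1 - z.2)).
Proof.
move=> gi ki; have mg := intg_meas gi; have mk := intg_meas ki.
apply/intg2P'.
  apply: measurable_funM; first by apply: (measurableT_comp mg).
  by apply: (measurableT_comp mk); meas.
case/intgP : ki => _; set K := (\int[mu]_x _)%E => K0.
have E y : (\int[mu]_x `|g y * k (x - y)|%:E = `|g y|%:E * K)%E.
  transitivity (\int[mu]_x (`|g y|%:E * `|k (x - y)|%:E))%E.
    by apply: eq_integral => x _; rewrite normrM EFinM.
  rewrite ge0_integralZl//=; last first.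
    apply/measurable_EFinP; apply: meas_norm.
    by apply: (measurableT_comp mk); meas.
  congr (_ * _)%E.
  rewrite /K (ge0_integral_affine (- y) ltr01)//; last first.
    by apply/measurable_EFinP; exact: meas_norm.
  by rewrite mul1e; apply: eq_integral => x _; rewrite mul1r.
under eq_integral do rewrite E.
rewrite ge0_integralZr//; last 2 first.
- by apply/measurable_EFinP; exact: meas_norm.
- exact: integral_ge0.
by case/intgP : gi => _ g0; rewrite lte_mul_pinfty// ?integral_ge0// ge0_fin_numE ?integral_ge0.
Qed.

Lemma intg_conv g k : intg g -> intg k -> intg (convol g k).
Proof. by move=> gi ki; have [h _] := Rint_fubini1 (intg2_conv gi ki). Qed.

(** Tested against a bounded function, a convolution transfers to the two factors
by Fubini and a translation. *)
Lemma Rint_conv_mulb g k h M : intg g -> intg k -> measurable_fun setT h ->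
  (forall x, `|h x| <= M) ->
  \int[mu]_x (convol g k x * h x) = \int[mu]_t (g t * \int[mu]_r (k r * h (r + t))).
Proof.
move=> gi ki mh hM.
have mg := intg_meas gi; have mk := intg_meas ki.
pose f (z : R * R) := g z.2 * k (z.1 - z.2) * h z.1.
have mf : measurable_fun setT f.
  apply: measurable_funM; last by apply: (measurableT_comp mh).
  by have := intg2_conv gi ki => /(measurable_int _)/measurable_EFinP.
have fi : intg2 f.
  have := integrableZl measurableT M (integrable_norm (intg2_conv gi ki)).
  apply: intg2_le => // z; rewrite /f/= normrM mulrC; by rewrite ler_wpM2r.
transitivity (\int[mu]_x \int[mu]_t f (x, t)).
  apply: eq_Rint => x; rewrite /convol /f/= mulrC -RintZ'; last first.
    apply: measurable_funM => //; apply: (measurableT_comp mk); exact: measurable_funB.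
  by apply: eq_Rint => t; rewrite mulrC.
rewrite Rint_fubini//; apply: eq_Rint => t; rewrite /f/=.
rewrite -RintZ'; last first.
  by apply: measurable_funM => //; apply: (measurableT_comp mh); meas.
rewrite [RHS](Rint_shift (- t)); last first.
  apply: measurable_funM; first by meas.
  by apply: measurable_funM => //; apply: (measurableT_comp mh); meas.
by apply: eq_Rint => x; rewrite mulrA subrK.
Qed.

(** The transform of a convolution is the product of the transforms, and that of
a probability density is at most 1 in modulus. *)
Lemma fnorm2_conv_le g k s : intg g -> intg k -> (forall x, 0 <= k x) ->
  \int[mu]_x k x = 1 -> fnorm2 (convol g k) s <= fnorm2 g s.
Proof.
move=> gi ki k0 k1.
have mcos : measurable_fun setT (fun x : R => cos (s * x)) by meas.
have msin : measurable_fun setT (fun x : R => sin (s * x)) by meas.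
have Cc : cosT (convol g k) s = cosT k s * cosT g s - sinT k s * sinT g s.
  rewrite {1}/cosT (Rint_conv_mulb (M := 1) gi ki mcos)//; last by move=> x; exact: cos_max.
  rewrite /cosT -/(cosT k s) /sinT -/(sinT k s) -!RintZ; [|exact: intg_sin|exact: intg_cos].
  rewrite -RintB; [|apply: intgZ; exact: intg_cos|apply: intgZ; exact: intg_sin].
  apply: eq_Rint => t.
  transitivity (g t * (cos (s * t) * cosT k s - sin (s * t) * sinT k s)); last by ring.
  congr (_ * _); rewrite /cosT /sinT -!RintZ; [|exact: intg_sin|exact: intg_cos].
  rewrite -RintB; [|apply: intgZ; exact: intg_cos|apply: intgZ; exact: intg_sin].
  by apply: eq_Rint => r; rewrite mulrDr cosD; ring.
have Sc : sinT (convol g k) s = sinT k s * cosT g s + cosT k s * sinT g s.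
  rewrite {1}/sinT (Rint_conv_mulb (M := 1) gi ki msin)//; last by move=> x; exact: sin_max.
  rewrite /cosT -/(cosT k s) /sinT -/(sinT k s) -!RintZ; [|exact: intg_sin|exact: intg_cos].
  rewrite -RintD; [|apply: intgZ; exact: intg_cos|apply: intgZ; exact: intg_sin].
  apply: eq_Rint => t.
  transitivity (g t * (cos (s * t) * sinT k s + sin (s * t) * cosT k s)); last by ring.
  congr (_ * _); rewrite /cosT /sinT -!RintZ; [|exact: intg_cos|exact: intg_sin].
  rewrite -RintD; [|apply: intgZ; exact: intg_sin|apply: intgZ; exact: intg_cos].
  by apply: eq_Rint => r; rewrite mulrDr sinD; ring.
(* pairing the transform with itself bounds its square by its modulus, so it is at most 1 *)
have kle : fnorm2 k s <= 1.
  rewrite leNgt; apply/negP => lt1.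
  have e0 : 0 < fnorm2 k s by exact: lt_trans lt1.
  have : fnorm2 k s <= Num.sqrt (fnorm2 k s).
    rewrite {1}/fnorm2 !expr2 {2}/cosT {2}/sinT -!RintZ; [|exact: intg_sin|exact: intg_cos].
    rewrite -RintD; [|apply: intgZ; exact: intg_cos|apply: intgZ; exact: intg_sin].
    rewrite -[leRHS]mulr1 -k1 -RintZ//.
    apply: le_Rint; [|exact: intgZ|].
      by apply: intgD; apply: intgZ; [exact: intg_cos|exact: intg_sin].
    move=> x; have -> : cosT k s * (k x * cos (s * x)) + sinT k s * (k x * sin (s * x)) =
      (cosT k s * cos (s * x) + sinT k s * sin (s * x)) * k x by ring.
    rewrite ler_wpM2r//; apply: (le_trans (ler_norm _)).
    rewrite -sqrtr_sqr ler_wsqrtr// /fnorm2.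
    have := cos2Dsin2 (s * x); set c := cos _; set d := sin _; set A := cosT _ _; set B := sinT _ _.
    move=> cd.
    have -> : A ^+ 2 + B ^+ 2 = (A ^+ 2 + B ^+ 2) * (c ^+ 2 + d ^+ 2) by rewrite cd mulr1.
    have := sqr_ge0 (A * d - B * c); lra.
  move=> h; have := sqr_sqrtr (ltW e0); set q := Num.sqrt _ in h *.
  have q0 : 0 <= q by exact: sqrtr_ge0.
  by move=> qe; rewrite -qe in lt1 h; nra.
have -> : fnorm2 (convol g k) s = fnorm2 k s * fnorm2 g s.
  by rewrite {1}/fnorm2 Cc Sc /fnorm2; ring.
by rewrite -[leRHS]mul1r ler_wpM2r ?fnorm2_ge0.
Qed.

Lemma Rint_ae (f h : R -> R) : measurable_fun setT f -> measurable_fun setT h ->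
  {ae mu, forall x, f x = h x} -> \int[mu]_x f x = \int[mu]_x h x.
Proof.
move=> mf mh fh; congr fine; apply: ae_eq_integral => //.
- exact/measurable_EFinP.
- exact/measurable_EFinP.
- by move: fh; apply: aeS => x -> _.
Qed.

Lemma ae_neq (a : R) : {ae mu, forall x, x != a}.
Proof.
exists [set a]; split => //; first exact: lebesgue_measure_set1.
by move=> x /= /negP; rewrite negbK => /eqP.
Qed.

(** Dominated convergence, the integrand being continuous in x except at the
single point t = x. *)
Lemma cont_cumul g : intg g -> continuous (fun x => \int[mu]_t (g t * ((t <= x)%R)%:R)).
Proof.
move=> gi x0; apply/(@cvg_nbhsP _ R^o) => u ux; have mg := intg_meas gi.
have mne : measurable_fun setT (fun t => (t != x0)%:R : R).
  rewrite (_ : (fun t => _) = (fun t => 1 - (t <= x0)%R%:R * (x0 <= t)%R%:R)); first by meas.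
  by apply/funext => t; case: ltgtP => _; rewrite ?mulr0 ?mul0r ?mulr1 ?subr0 ?subrr.
have e x : \int[mu]_t (g t * ((t <= x)%R)%:R) = \int[mu]_t (g t * (t != x0)%:R * ((t <= x)%R)%:R).
  apply: Rint_ae; [by meas|by meas|].
  by have := ae_neq x0; apply: aeS => t ->; rewrite mulr1.
rewrite e; under eq_fun do rewrite e.
apply: (@dominated_cvg_Rint _ _ _ (fun x => `|g x|)).
- by move=> n; meas.
- by meas.
- move=> t; have [->|tx] := eqVneq t x0; first by rewrite mulr0; under eq_fun do rewrite mul0r; rewrite mul0r; exact: cvg_cst.
  rewrite mulr1; apply: cvgM; first exact: cvg_cst.
  apply: cvg_near_cst.
  have [h|h|h] := ltgtP t x0; last by rewrite h eqxx in tx.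
    near=> n; congr (_%:R); congr nat_of_bool; apply: ltW; near: n; exact: (cvgr_gt x0).
  near=> n; apply/eqP; rewrite pnatr_eq0 eqb0 -ltNge; near: n; exact: (cvgr_lt x0).
- exact: intg_norm.
- move=> n t; rewrite !normrM -mulrA -[leRHS]mulr1 ler_wpM2l//.
  by rewrite -[leRHS]mul1r ler_pM// normb_le1.
Unshelve. all: by end_near. Qed.

Definition box (d x : R) : R := (2 * d)^-1 * ((- d <= x)%R%:R * (x < d)%R%:R).

Lemma itv_indic (a b : R) : (fun x : R => (a <= x)%R%:R * (x < b)%R%:R : R) = \1_(`[a, b[%classic).
Proof.
apply/funext => x; rewrite indicE; case: (boolP (x \in _)); rewrite ?inE/= ?notin_setE/= in_itv/=.
  by case/andP => -> ->; rewrite mulr1.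
by case: (a <= x)%R => //=; [case: (x < b)%R => //= _; rewrite mulr0|rewrite mul0r].
Qed.

Lemma intg_itv (a b : R) : intg (fun x => (a <= x)%R%:R * (x < b)%R%:R).
Proof. rewrite itv_indic; exact: (@integrable_indic_itv R a b true true). Qed.

Lemma Rint_itv (a b : R) : a <= b ->
  \int[mu]_x ((a <= x)%R%:R * (x < b)%R%:R) = b - a.
Proof.
move=> ab; have -> : \int[mu]_x ((a <= x)%R%:R * (x < b)%R%:R) = \int[mu]_x (\1_(`[a, b[%classic) x).
  by rewrite -itv_indic.
have -> : \int[mu]_x (\1_(`[a, b[%classic) x) = fine (lebesgue_measure (`[a, b[%classic : set R)).
  by rewrite /Rintegral integral_indic//= setIT.
rewrite lebesgue_measure_itv/= lte_fin.
move: ab; rewrite le_eqVlt => /orP[/eqP ->|->]; last by rewrite -EFinB.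
by rewrite ltxx subrr.
Qed.

Lemma box_props d : 0 < d -> [/\ intg (box d), forall x, 0 <= box d x & \int[mu]_x box d x = 1].
Proof.
move=> d0; split; first by apply: intgZ; exact: intg_itv.
  by move=> x; rewrite !mulr_ge0// invr_ge0 mulr_ge0// ltW.
rewrite RintZ; last exact: intg_itv.
rewrite Rint_itv; last by lra.
by field; rewrite gt_eqF.
Qed.

Lemma intg_cut g x : intg g -> intg (fun t => g t * ((t <= x)%R)%:R).
Proof.
move=> gi; apply: (intg_mulb (M := 1)) => //; first by meas.
by move=> t; exact: normb_le1.
Qed.

Lemma conv_box g d x : 0 < d -> intg g ->
  convol g (box d) x = (2 * d)^-1 * (\int[mu]_t (g t * ((t <= x + d)%R)%:R) -
                                 \int[mu]_t (g t * ((t <= x - d)%R)%:R)).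
Proof.
move=> d0 gi; rewrite -RintB; [|exact: intg_cut..].
rewrite -RintZ; last by apply: intgB; exact: intg_cut.
apply: eq_Rint => t; rewrite /box mulrCA; congr (_ * _).
rewrite -mulrBr; congr (_ * _).
have -> : (- d <= x - t)%R = (t <= x + d)%R by apply/idP/idP => ?; lra.
have -> : (x - t < d)%R = ~~ (t <= x - d)%R by rewrite -ltNge; apply/idP/idP => ?; lra.
have [h1|h1] := leP t (x - d); last by rewrite mulr1 subr0.
by rewrite mulr0 (_ : (t <= x + d)%R = true) ?subrr//; lra.
Qed.

Lemma has_deriv_seq (f : R -> R) x a (d_ : nat -> R) : has_deriv f x a ->
  (forall n, d_ n != 0) -> d_ n @[n --> \oo] --> 0 ->
  (d_ n)^-1 * (f (x + d_ n) - f x) @[n --> \oo] --> a.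
Proof.
move=> [df dfE] dn0 d0.
have h : h^-1 * (f (h + x) - f x) @[h --> 0^'] --> a.
  have := df; rewrite /derivable => /cvg_ex[l hl].
  have : 'D_1 f x = l by rewrite /derive; apply/cvg_lim.
  rewrite dfE => ->; move: hl; apply: cvg_trans; apply: near_eq_cvg.
  by near=> k; rewrite /GRing.scale/= mulr1.
have d0' : d_ n @[n --> \oo] --> 0^'.
  move=> A /= [e /= e0 eA]; have /cvgrPdist_lt/(_ _ e0) := d0.
  by apply: filterS => n dn; apply: eA.
have := cvg_comp _ _ d0' h; apply: cvg_trans; apply: near_eq_cvg.
by near=> n; rewrite /= (addrC (d_ n)).
Unshelve. all: by end_near. Qed.

(** Lebesgue differentiation: the average over a symmetric interval is the mean
of the right and left difference quotients of the primitive. *)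
Lemma conv_box_ae g : intg g ->
  {ae mu, forall x, convol g (box n.+1%:R^-1) x @[n --> \oo] --> g x}.
Proof.
move=> gi.
have mg := intg_meas gi.
have li : locally_integrable [set: R] g.
  by apply: open_integrable_locally => //; exact: openT.
have gy (y : R) : mu.-integrable `]-oo, y] (EFin \o g).
  by apply: integrableS gi => //.
have GE x : \int[mu]_(t in `]-oo, x]) g t = \int[mu]_t (g t * ((t <= x)%R)%:R).
  rewrite Rint_itv_indic; apply: eq_Rint => t; rewrite indicE; congr (_ * _%:R).
  case: (boolP (t <= x)%R) => h; first by rewrite mem_set//= in_itv.
  by rewrite memNset//= in_itv/=; exact/negP.
pose G x := \int[mu]_t (g t * ((t <= x)%R)%:R).
have := @FTC1Ny R g gy li; rewrite /=.
have -> : (fun x : R => \int[mu]_(t in `]-oo, x]) g t) = G by apply/funext => x; exact: GE.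
apply: aeS => x [dG Gg].
have iG : has_deriv G x (g x).
  by apply: (has_deriv_eq (derivableP dG)); rewrite -derive1E.
have dn0 n : n.+1%:R^-1 != 0 :> R by rewrite invr_eq0 pnatr_eq0.
have c1 := has_deriv_seq iG dn0 (@cvg_harmonic R).
have c2 := @has_deriv_seq G x (g x) (fun n => - n.+1%:R^-1) iG.
have {}c2 : (- n.+1%:R^-1)^-1 * (G (x - n.+1%:R^-1) - G x) @[n --> \oo] --> g x.
  apply: c2; first by move=> n; rewrite oppr_eq0.
  by rewrite -oppr0; apply: cvgN; exact: cvg_harmonic.
have -> : (fun n => convol g (box n.+1%:R^-1) x) =
  (fun n => 2^-1 * ((n.+1%:R^-1)^-1 * (G (x + n.+1%:R^-1) - G x) +
           (- n.+1%:R^-1)^-1 * (G (x - n.+1%:R^-1) - G x))).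
  apply/funext => n; rewrite conv_box ?invr_gt0// -/(G _) -/(G (x - _)).
  have := dn0 n; move: (n.+1%:R^-1) => d dd; by field.
have -> : g x = 2^-1 * (g x + g x) by field.
by apply: cvgM; [exact: cvg_cst|exact: cvgD].
Qed.

(** Both sides may be infinite. The reverse inequality is known for bounded
continuous functions, in particular for the averages of g over small
intervals; these have smaller transforms and converge to g almost everywhere. *)
Lemma plancherel g : intg g ->
  (\int[mu]_s (fnorm2 g s)%:E = (2 * pi)%:E * \int[mu]_t (g t ^+ 2)%:E)%E.
Proof.
move=> gi; have mg := intg_meas gi.
apply/eqP; rewrite eq_le plancherel_le//=.
have tp : 0 < 2 * pi :> R by rewrite mulr_gt0// pi_gt0.
rewrite muleC -lee_pdivlMr//.
have hn n : 0 < n.+1%:R^-1 :> R by rewrite invr_gt0.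
have hi n : intg (convol g (box n.+1%:R^-1)).
  by have [bi _ _] := box_props (hn n); exact: intg_conv.
apply: (@fatou_bound (fun n t => convol g (box n.+1%:R^-1) t ^+ 2)).
- by move=> n; have := intg_meas (hi n) => ?; meas.
- by meas.
- by move=> n x; exact: sqr_ge0.
- by move=> x; exact: sqr_ge0.
- have := conv_box_ae gi; apply: aeS => x cx.
  by under eq_fun do rewrite expr2; rewrite expr2; exact: cvgM.
- move=> n; rewrite lee_pdivlMr// muleC.
  have [bi b0 b1] := box_props (hn n).
  apply: (@le_trans _ _ (\int[mu]_s (fnorm2 (convol g (box n.+1%:R^-1)) s)%:E)%E).
    apply: (@plancherel_ge_cont _ ((2 * n.+1%:R^-1)^-1 * \int[mu]_x `|g x|)) => //.
      have -> : convol g (box n.+1%:R^-1) = (fun x => (2 * n.+1%:R^-1)^-1 *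
         (\int[mu]_t (g t * ((t <= x + n.+1%:R^-1)%R)%:R) -
          \int[mu]_t (g t * ((t <= x - n.+1%:R^-1)%R)%:R))).
        by apply/funext => x; exact: conv_box.
      move=> x; apply: cvgM; first exact: cvg_cst.
      have ct (a : R) : continuous (fun x => \int[mu]_t (g t * ((t <= x + a)%R)%:R)).
        move=> y; have ca : (z + a) @[z --> y] --> y + a by apply: cvgD; [exact: cvg_id|exact: cvg_cst].
        apply: (@continuous_comp _ _ _ (fun z : R => z + a)
          (fun x => \int[mu]_t (g t * ((t <= x)%R)%:R)) y) => //.
        exact: cont_cumul.
      by apply: cvgB; exact: ct.
    move=> x; apply: norm_Rint_mulb => //.
      by apply: (measurableT_comp (intg_meas bi)); meas.
    move=> t; rewrite /box normrM ger0_norm; last by rewrite invr_ge0 mulr_ge0// ltW.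
    rewrite -[leRHS]mulr1 ler_wpM2l//.
    by rewrite normrM -[leRHS]mul1r ler_pM// normb_le1.
  apply: ge0_le_integral => //.
  + by move=> s _; rewrite lee_fin fnorm2_ge0.
  + by apply/measurable_EFinP; exact: measurable_fnorm2.
  + by apply/measurable_EFinP; exact: measurable_fnorm2.
  + by move=> s _; rewrite lee_fin fnorm2_conv_le.
Qed.

(** By Plancherel's formula, a function with zero transform has zero L2 norm. *)
Lemma fourier_inj g : intg g -> (forall s, cosT g s = 0) -> (forall s, sinT g s = 0) ->
  {ae mu, forall t, g t = 0}.
Proof.
move=> gi C0 S0; have mg := intg_meas gi.
have := plancherel gi.
under eq_integral do rewrite /fnorm2 C0 S0 expr0n/= addr0.
rewrite integral0 => /esym/eqP; rewrite mule_eq0 => /orP[|/eqP g0].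
  by rewrite eqe gt_eqF// mulr_gt0// pi_gt0.
have : (\int[mu]_t `|(EFin \o (fun t => (g t ^+ 2)%R)) t| = 0)%E.
  by rewrite -[RHS]g0; apply: eq_integral => t _; rewrite /= ger0_norm ?sqr_ge0.
move=> h0; have me : measurable_fun setT (EFin \o (fun t => (g t ^+ 2)%R)).
  by apply/measurable_EFinP; meas.
have := (ae_eq_integral_abs mu measurableT me).1 h0.
by apply: aeS => t /(_ I) [] /eqP; rewrite sqrf_eq0 => /eqP.
Qed.

End fourier.

(** * Uniqueness for Gaussian averages on a half-line *)

Section laplace.
Context {R : realType}.
Notation mu := (@lebesgue_measure R).
Implicit Types (q h f : R -> R) (s t x c : R).

Lemma exp_partial_le x n : 0 <= x -> \sum_(0 <= k < n) x ^+ k / k`!%:R <= expR x.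
Proof.
move=> x0; have := @nondecreasing_cvgn_le R (series (exp_coeff x)).
move=> /(_ _ (is_cvg_series_exp_coeff x) n); apply.
by apply: nondecreasing_series => k _ _; exact: exp_coeff_ge0.
Qed.

(** Members of this class are stable under multiplication by cos(dt) and sin(dt)
for small d, because the power series may be integrated term by term; iterating
reaches all frequencies. This replaces analytic continuation of the Fourier
transform. *)
Definition null_moments q :=
  intg (fun t => expR `|t| * q t) /\ forall n, \int[mu]_t (t ^+ n * q t) = 0.

Lemma pow_le_exp_half n t : `|t| ^+ n <= n`!%:R * 2 ^+ n * expR (`|t| / 2).
Proof.
have := pow_le_exp n (@divr_ge0 _ `|t| 2 (normr_ge0 _) (ler0n _ 2)).
rewrite expr_div_n ler_pdivrMr ?exprn_gt0// => /le_trans; apply.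
by rewrite mulrAC.
Qed.

Lemma intg_exp2 (a : R) q : measurable_fun setT q ->
  intg (fun t => expR (a * t) * q t) -> intg (fun t => expR (- a * t) * q t) ->
  intg (fun t => expR (a * `|t|) * q t).
Proof.
move=> mq i1 i2.
apply: (@intg_le _ _ (fun t => `|expR (a * t) * q t| + `|expR (- a * t) * q t|)).
- by meas.
- move=> t; rewrite !normrM -mulrDl ler_wpM2r// !(ger0_norm (expR_ge0 _)).
  exact: exp_norm_le.
- by apply: intgD; exact: intg_norm.
Qed.

(** The moments are the successive derivatives of the Laplace transform, which
vanishes near c. *)
Lemma laplace_moments q : measurable_fun setT q ->
  (forall c, `|c| < 2 -> intg (fun t => expR (c * t) * q t)) ->
  (forall c, `|c| < 2 -> \int[mu]_t (expR (c * t) * q t) = 0) ->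
  forall n c, `|c| < 1 -> \int[mu]_t (t ^+ n * (expR (c * t) * q t)) = 0.
Proof.
move=> mq qi q0.
(* exponent 3/2: one unit for |c| < 1 and one half for the power of t *)
have i32 : intg (fun t => expR (3 / 2 * `|t|) * q t).
  by apply: intg_exp2 => //; apply: qi; rewrite ?normrN ger0_norm//; lra.
have bound n c t : `|c| < 1 -> `|t ^+ n * (expR (c * t) * q t)| <=
    n`!%:R * 2 ^+ n * (`|expR (3 / 2 * `|t|) * q t|).
  move=> c1; rewrite !normrM normrX (ger0_norm (expR_ge0 _)) (ger0_norm (expR_ge0 (3 / 2 * _))) !mulrA.
  apply: ler_wpM2r => //; have -> : 3 / 2 * `|t| = `|t| / 2 + `|t| by field.
  rewrite expRD mulrA; apply: ler_pM; rewrite ?exprn_ge0 ?expR_ge0 ?pow_le_exp_half//.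
  rewrite ler_expR; apply: (le_trans (ler_norm _)); rewrite normrM.
  by rewrite -[leRHS]mul1r ler_wpM2r// ltW.
have ii n c : `|c| < 1 -> intg (fun t => t ^+ n * (expR (c * t) * q t)).
  move=> c1; apply: (intg_le _ (fun t => bound n c t c1)); first by meas.
  by apply: intgZ; exact: intg_norm.
elim => [|n IH] c c1.
  under eq_Rintegral do rewrite expr0 mul1r.
  by apply: q0; rewrite (lt_trans c1)// ltr1n.
(* the frequencies within e of c stay in the open unit interval *)
pose e := 1 - `|c|.
have e0 : 0 < e by rewrite subr_gt0.
have near1 u : c - e < u < c + e -> `|u| < 1.
  move=> uc; have : `|u - c| < e by rewrite ltr_norml; lra.
  move=> h; have -> : u = (u - c) + c by rewrite subrK.
  by apply: (le_lt_trans (ler_normD _ _)); rewrite /e in h; lra.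
have D := @has_deriv_Rint R (fun u t => t ^+ n * (expR (u * t) * q t))
  (fun u t => t ^+ n.+1 * (expR (u * t) * q t)) c e
  (fun t => n.+1`!%:R * 2 ^+ n.+1 * (`|expR (3 / 2 * `|t|) * q t|)) e0.
have {}D : has_deriv (fun u => \int[mu]_t (t ^+ n * (expR (u * t) * q t))) c
  (\int[mu]_t (t ^+ n.+1 * (expR (c * t) * q t))).
  apply: D.
  - by move=> u /near1; exact: ii.
  - by move=> u t _; eapply has_deriv_eq; [by deriv|rewrite /= exprS; ring].
  - by apply: intgZ; exact: intg_norm.
  - by move=> u t /near1; exact: bound.
have dn (k : nat) : 0 < e / 2 / k.+1%:R by rewrite !divr_gt0.
have dne (k : nat) : e / 2 / k.+1%:R < e.
  rewrite ltr_pdivrMr// ltr_pdivrMr//.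
  have : 1 <= k.+1%:R :> R by rewrite ler1n.
  nra.
have := @has_deriv_seq R _ c _ (fun k => e / 2 / k.+1%:R) D (fun k => lt0r_neq0 (dn k)).
have c0 : e / 2 / k.+1%:R @[k --> \oo] --> (0 : R).
  by rewrite -(mulr0 (e / 2)); apply: cvgM; [exact: cvg_cst|exact: cvg_harmonic].
move=> /(_ c0).
under eq_fun => k.
  rewrite (IH c c1) IH; last first.
    apply: near1; move: (dn k) (dne k); set z := _ / _ / _; move: (e) z => e' z ? ?.
    by apply/andP; split; lra.
  rewrite subrr mulr0; over.
by move=> /(cvg_unique _ (cvg_cst 0)) ->.
Qed.

Lemma laplace_null_moments q : measurable_fun setT q ->
  (forall c, `|c| < 2 -> intg (fun t => expR (c * t) * q t)) ->
  (forall c, `|c| < 2 -> \int[mu]_t (expR (c * t) * q t) = 0) -> null_moments q.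
Proof.
move=> mq qi q0; split.
  apply: (@eq_intg _ (fun t => expR (1 * `|t|) * q t)); first by move=> t; rewrite mul1r.
  by apply: intg_exp2 => //; apply: qi; rewrite ?normrN normr1 ltr1n.
move=> n; have := laplace_moments mq qi q0 n (c := 0).
rewrite normr0 => /(_ (ltr01)) <-.
by apply: eq_Rint => t; rewrite mul0r expR0 mul1r.
Qed.

Lemma null_moments_meas q : null_moments q -> measurable_fun setT q.
Proof.
move=> [i _]; rewrite (_ : q = fun t => expR (- `|t|) * (expR `|t| * q t)).
  by apply: measurable_funM; [meas|exact: intg_meas i].
by apply/funext => t; rewrite mulrA -expRD addNr expR0 mul1r.
Qed.

(** The partial sums of F(dt) are dominated by exp(|t|/2), which leaves room for
one half of the exponential weight to absorb the power of t. *)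
Lemma null_moments_entire q (a : nat -> R) (F : R -> R) d :
  null_moments q -> (forall k, `|a k| <= (k`!%:R)^-1) -> `|d| <= 1 / 2 ->
  measurable_fun setT F -> (forall x, `|F x| <= 1) ->
  (forall x, \sum_(0 <= k < N) (a k * x ^+ k) @[N --> \oo] --> F x) ->
  null_moments (fun t => F (d * t) * q t).
Proof.
move=> Qq a1 d2 mF F1 aF.
have mq := null_moments_meas Qq; have [qi q0] := Qq.
have mFd : measurable_fun setT (fun t => F (d * t)) by apply: (measurableT_comp mF); meas.
split.
  apply: (@eq_intg _ (fun t => (expR `|t| * q t) * F (d * t))).
    by move=> t; rewrite mulrCA mulrC mulrA.
  exact: (intg_mulb (M := 1)).
move=> n.
have bnd N t : `|\sum_(0 <= k < N) (a k * (d * t) ^+ k)| <= expR (`|t| / 2).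
  apply: le_trans (exp_partial_le N (divr_ge0 (normr_ge0 t) (ler0n _ 2))).
  apply: (le_trans (ler_norm_sum _ _ _)); apply: ler_sum => k _.
  rewrite normrM normrX mulrC ler_pM ?exprn_ge0//.
  by rewrite lerXn2r ?nnegrE ?divr_ge0// normrM mulrC ler_wpM2l//; lra.
have B N t : `|t ^+ n * ((\sum_(0 <= k < N) (a k * (d * t) ^+ k)) * q t)| <=
    n`!%:R * 2 ^+ n * `|expR `|t| * q t|.
  rewrite !normrM normrX (ger0_norm (expR_ge0 _)) !mulrA ler_wpM2r//.
  have -> : expR `|t| = expR (`|t| / 2) * expR (`|t| / 2) by rewrite -expRD; congr expR; field.
  by rewrite mulrA ler_pM ?exprn_ge0 ?pow_le_exp_half// bnd.
have ms N : measurable_fun setT (fun t => \sum_(0 <= k < N) (a k * (d * t) ^+ k)).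
  by apply: measurable_sum => k; meas.
have pint k : intg (fun t => t ^+ k * q t).
  apply: (@intg_le _ _ (fun t => k`!%:R * `|expR `|t| * q t|)); first by meas.
    move=> t; rewrite !normrM normrX (ger0_norm (expR_ge0 _)) mulrA ler_wpM2r//.
    by rewrite pow_le_exp.
  by apply: intgZ; exact: intg_norm.
have Z N : \int[mu]_t (t ^+ n * ((\sum_(0 <= k < N) (a k * (d * t) ^+ k)) * q t)) = 0.
  have iN m : intg (fun t => t ^+ n * ((\sum_(0 <= k < m) (a k * (d * t) ^+ k)) * q t)).
    apply: (intg_le _ (B m)); first by have mm := ms m; meas.
    by apply: intgZ; exact: intg_norm.
  elim: N => [|N IH].
    under eq_Rintegral do rewrite big_geq// mul0r mulr0.
    exact: Rint_zero.
  transitivity (\int[mu]_t (t ^+ n * ((\sum_(0 <= k < N) (a k * (d * t) ^+ k)) * q t) +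
      a N * d ^+ N * (t ^+ (n + N) * q t))).
    apply: eq_Rint => t; rewrite big_nat_recr//= exprMn exprD; ring.
  by rewrite RintD ?IH ?RintZ ?q0 ?mulr0 ?addr0//; exact: intgZ.
have C : \int[mu]_t (t ^+ n * ((\sum_(0 <= k < N) (a k * (d * t) ^+ k)) * q t))
    @[N --> \oo] --> \int[mu]_t (t ^+ n * (F (d * t) * q t)).
  apply: (@dominated_cvg_Rint _ _ _ (fun t => n`!%:R * 2 ^+ n * `|expR `|t| * q t|)).
  - by move=> N; have mm := ms N; meas.
  - by meas.
  - move=> t; apply: cvgM; first exact: cvg_cst.
    by apply: cvgM; [exact: aF|exact: cvg_cst].
  - by apply: intgZ; exact: intg_norm.
  - exact: B.
move: C; under eq_fun do rewrite Z.
by move=> /(cvg_unique _ (cvg_cst 0)) <-.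
Qed.

Lemma null_moments_cos q d : null_moments q -> `|d| <= 1 / 2 ->
  null_moments (fun t => cos (d * t) * q t).
Proof.
move=> Qq d2; apply: (@null_moments_entire _ (fun n => (~~(odd n))%:R * (-1) ^+ n./2 * (n`!%:R)^-1)) => //.
- move=> k; rewrite !normrM normrX normrN normr1 expr1n mulr1 ger0_norm//.
  by case: odd; rewrite ?mul0r ?mul1r ?ger0_norm// invr_ge0.
- by apply: meas_cos; exact: measurable_id.
- by move=> x; exact: cos_max.
- by move=> x; have := @is_cvg_series_cos_coeff R x; rewrite cosE cos_coeffE; exact.
Qed.

Lemma null_moments_sin q d : null_moments q -> `|d| <= 1 / 2 ->
  null_moments (fun t => sin (d * t) * q t).
Proof.
move=> Qq d2; apply: (@null_moments_entire _ (fun n => (odd n)%:R * (-1) ^+ n.-1./2 * (n`!%:R)^-1)) => //.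
- move=> k; rewrite !normrM normrX normrN normr1 expr1n mulr1 ger0_norm//.
  by case: odd; rewrite ?mul0r ?mul1r ?ger0_norm// invr_ge0.
- by apply: meas_sin; exact: measurable_id.
- by move=> x; exact: sin_max.
- by move=> x; have := @is_cvg_series_sin_coeff R x; rewrite sinE /pseries sin_coeffE; exact.
Qed.

Lemma null_moments_intg q n : null_moments q -> intg (fun t => t ^+ n * q t).
Proof.
move=> Qq; have mq := null_moments_meas Qq.
apply: (@intg_le _ _ (fun t => n`!%:R * `|expR `|t| * q t|)); first by meas.
  move=> t; rewrite !normrM normrX (ger0_norm (expR_ge0 _)) mulrA ler_wpM2r//.
  by rewrite pow_le_exp.
by apply: intgZ; apply: intg_norm; case: Qq.
Qed.

Lemma null_momentsD q h a b : null_moments q -> null_moments h ->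
  null_moments (fun t => a * q t + b * h t).
Proof.
move=> Qq Qh; split.
  apply: (@eq_intg _ (fun t => a * (expR `|t| * q t) + b * (expR `|t| * h t))).
    by move=> t; ring.
  by apply: intgD; apply: intgZ; [case: Qq|case: Qh].
move=> n; transitivity (\int[mu]_t (a * (t ^+ n * q t) + b * (t ^+ n * h t))).
  by apply: eq_Rint => t; ring.
rewrite RintD; [|by apply: intgZ; exact: null_moments_intg..].
rewrite !RintZ; [|exact: null_moments_intg..].
by rewrite Qq.2 Qh.2 !mulr0 addr0.
Qed.

(** Multiples of d are reached by the addition formulas. *)
Lemma null_moments_trig q d n : null_moments q -> `|d| <= 1 / 2 ->
  null_moments (fun t => cos (n%:R * d * t) * q t) /\
  null_moments (fun t => sin (n%:R * d * t) * q t).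
Proof.
move=> Qq d2; elim: n => [|n [IHc IHs]].
  split.
    by rewrite (_ : (fun t => _) = q)//; apply/funext => t; rewrite !mul0r cos0 mul1r.
  have := null_momentsD 0 0 Qq Qq; congr null_moments.
  by apply/funext => t; rewrite !mul0r sin0 mul0r addr0.
have e t : n.+1%:R * d * t = d * t + n%:R * d * t by rewrite -natr1; ring.
split.
  have := null_momentsD 1 (-1) (null_moments_cos IHc d2) (null_moments_sin IHs d2).
  by congr null_moments; apply/funext => t; rewrite e cosD; ring.
have := null_momentsD 1 1 (null_moments_sin IHc d2) (null_moments_cos IHs d2).
by congr null_moments; apply/funext => t; rewrite e sinD; ring.
Qed.

(** Any frequency s is a multiple of a frequency at most 1/2; the moment of order
0 then says that the transform vanishes at s. *)
Lemma null_moments_ae q : null_moments q -> {ae mu, forall t, q t = 0}.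
Proof.
move=> Qq; have mq := null_moments_meas Qq.
have qi : intg q by apply: (eq_intg _ (null_moments_intg 0 Qq)) => t; rewrite expr0 mul1r.
have tr s : cosT q s = 0 /\ sinT q s = 0.
  have [n n0] : exists n, 2 * `|s| < n.+1%:R.
    exists (Num.truncn (2 * `|s|)); exact: truncnS_gt.
  have d2 : `|s / n.+1%:R| <= 1 / 2.
    rewrite normrM normfV (ger0_norm (ler0n _ n.+1)) ler_pdivrMr//; lra.
  have [Qc Qs] := null_moments_trig n.+1 Qq d2.
  have e t : n.+1%:R * (s / n.+1%:R) * t = s * t.
    by have : n.+1%:R != 0 :> R by []; move: (n.+1%:R) => N N0; field.
  split.
    rewrite -(Qc.2 0); apply: eq_Rint => t; rewrite e expr0; ring.
  by rewrite -(Qs.2 0); apply: eq_Rint => t; rewrite e expr0; ring.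
by apply: fourier_inj => // s; [exact: (tr s).1|exact: (tr s).2].
Qed.

(** Expanding the square in the density, the averages at x = c + M - 2 with |c| < 2
are the Laplace transform of one function near 0, up to a non-zero factor. *)
Lemma gauss_inj f M : measurable_fun setT f ->
  (forall x, x < M -> intg (fun t => gdens 1 (x - t) * f t)) ->
  (forall x, x < M -> \int[mu]_t (gdens 1 (x - t) * f t) = 0) ->
  {ae mu, forall t, f t = 0}.
Proof.
move=> mf fi f0.
pose q t := expR ((M - 2) * t) * (expR (- t ^+ 2 / 2) * f t).
pose K c := Num.sqrt (2 * pi) * expR ((c + (M - 2)) ^+ 2 / 2).
have E c t : expR (c * t) * q t = K c * (gdens 1 (c + (M - 2) - t) * f t).
  rewrite /q /K gdens.unlock mul1r; have q0 := @s2pi_gt0 R.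
  have key : expR (c * t) * expR ((M - 2) * t) * expR (- t ^+ 2 / 2) =
     expR ((c + (M - 2)) ^+ 2 / 2) * expR (- (c + (M - 2) - t) ^+ 2 / (2 * 1 ^+ 2)).
    by rewrite -!expRD; congr expR; field.
  move: key; move: (expR (c * t)) (expR ((M - 2) * t)) (expR (- t ^+ 2 / 2)) => x1 x2 x3.
  move: (expR (_ / 2)) (expR (- _ / _)) (Num.sqrt _) q0 => A B v v0 e.
  by rewrite !mulrA e; field; rewrite gt_eqF.
have mq : measurable_fun setT q by rewrite /q; meas.
have lt c : `|c| < 2 -> c + (M - 2) < M by rewrite ltr_norml; lra.
have : null_moments q.
  apply: laplace_null_moments => // c c2.
    apply: (@eq_intg _ (fun t => K c * (gdens 1 (c + (M - 2) - t) * f t))) => //.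
    by apply: intgZ; apply: fi; exact: lt.
  rewrite (eq_Rint (E c)) RintZ; last by apply: fi; exact: lt.
  by rewrite f0 ?mulr0//; exact: lt.
move/null_moments_ae; apply: aeS => t; rewrite /q => /eqP.
by rewrite !mulf_eq0 !expR_eq0/= => /eqP.
Qed.

End laplace.

(** * Windows, their Gaussian averages, and the function F *)

Section window.
Context {R : realType}.
Notation mu := (@lebesgue_measure R).
Implicit Types (f g rho : R -> R) (s t x c k m : R).

(** At most exponential growth in the mean. Every window of moderate increase
belongs to this class, which is also stable under the products needed below. *)
Definition slow k rho := intg (fun t => expR (- k * `|t|) * rho t).

Lemma slow_meas k rho : slow k rho -> measurable_fun setT rho.
Proof.
move=> h; rewrite (_ : rho = fun t => expR (k * `|t|) * (expR (- k * `|t|) * rho t)).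
  by apply: measurable_funM; [meas|exact: intg_meas h].
by apply/funext => t; rewrite mulrA -expRD mulNr subrr expR0 mul1r.
Qed.

Lemma slow_mon k m rho : k <= m -> slow k rho -> slow m rho.
Proof.
move=> km h; have mr := slow_meas h.
apply: (@intg_le _ _ (fun t => `|expR (- k * `|t|) * rho t|)); first by meas.
  move=> t; rewrite !normrM ler_wpM2r// !(ger0_norm (expR_ge0 _)) ler_expR ler_wpM2r//.
  by rewrite lerN2.
exact: intg_norm.
Qed.

Lemma slowD k f g : slow k f -> slow k g -> slow k (fun t => f t + g t).
Proof.
move=> hf hg; apply: (@eq_intg _ (fun t => expR (- k * `|t|) * f t + expR (- k * `|t|) * g t)).
  by move=> t; rewrite mulrDr.
exact: intgD.
Qed.

Lemma slowZ k c f : slow k f -> slow k (fun t => c * f t).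
Proof.
move=> hf; apply: (@eq_intg _ (fun t => c * (expR (- k * `|t|) * f t))).
  by move=> t; rewrite mulrCA.
exact: intgZ.
Qed.

Lemma slowM k m f g : slow k f -> measurable_fun setT g ->
  (exists K, forall t, `|g t| <= K * expR (m * `|t|)) -> slow (k + m) (fun t => f t * g t).
Proof.
move=> hf mg [K gK]; have mf := slow_meas hf.
apply: (@intg_le _ _ (fun t => K * `|expR (- k * `|t|) * f t|)); first by meas.
  move=> t; rewrite !normrM !(ger0_norm (expR_ge0 _)).
  have -> : expR (- (k + m) * `|t|) = expR (- k * `|t|) * expR (- m * `|t|).
    by rewrite -expRD; congr expR; ring.
  have := gK t; rewrite -ler_pdivrMr ?expR_gt0// -expRN -mulNr => h.
  have -> : expR (- k * `|t|) * expR (- m * `|t|) * (`|f t| * `|g t|) =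
     `|g t| * expR (- m * `|t|) * (expR (- k * `|t|) * `|f t|) by ring.
  by rewrite ler_wpM2r// mulr_ge0 ?expR_ge0.
by apply: intgZ; exact: intg_norm.
Qed.

Lemma slow_id_mul k f : slow k f -> slow (k + 1) (fun t => t * f t).
Proof.
move=> hf; have : slow (k + 1) (fun t => f t * t).
  apply: slowM => //; exists 1 => t; rewrite !mul1r.
  by have := pow_le_exp 1 (normr_ge0 t); rewrite expr1 (_ : 1`! = 1)%N// mul1r.
by apply: eq_intg => t; rewrite (mulrC t).
Qed.

Lemma gdens1E x : gdens 1 x = (Num.sqrt (2 * pi))^-1 * expR (- x ^+ 2 / 2) :> R.
Proof. by rewrite gdens.unlock mul1r expr1n mulr1. Qed.

(** Locally uniform in x, so that it serves to differentiate under the integral. *)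
Lemma gdens_exp_bound m x t : 0 <= m ->
  gdens 1 (x - t) * expR (m * `|t|) <= (Num.sqrt (2 * pi))^-1 * expR (m ^+ 2 / 2 + m * `|x|).
Proof.
move=> m0; rewrite gdens1E -mulrA -expRD ler_wpM2l//.
rewrite ler_expR.
have h : `|t| <= `|x - t| + `|x|.
  by rewrite addrC -{1}(subKr x t) ler_normB.
have := ler_wpM2l m0 h; rewrite -(real_normK (num_real (x - t))) => h2.
have := sqr_ge0 (`|x - t| - m); move: h2.
move: (`|x - t|) (`|t|) (`|x|) => a b c; nra.
Qed.

Lemma intg_slow k m x rho : slow k rho ->
  intg (fun t => gdens 1 (x - t) * (expR (m * `|t|) * rho t)).
Proof.
move=> h; have mr := slow_meas h.
pose M := `|k + m|.
have i := intg_mulb h (h := fun t => expR ((k + m) * `|t|) * gdens 1 (x - t))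
   (M := (Num.sqrt (2 * pi))^-1 * expR (M ^+ 2 / 2 + M * `|x|)).
apply: (eq_intg _ (i _ _)).
- move=> t; have -> : expR (m * `|t|) = expR (- k * `|t|) * expR ((k + m) * `|t|).
    by rewrite -expRD; congr expR; ring.
  by ring.
- apply: measurable_funM; first by meas.
  by apply: (measurableT_comp (measurable_gdens _)); meas.
- move=> t; rewrite normrM (ger0_norm (expR_ge0 _)) (ger0_norm (gdens_ge0 _ ltr01)) mulrC.
  apply: le_trans (gdens_exp_bound x t (normr_ge0 (k + m))).
  by rewrite ler_wpM2l ?gdens_ge0// ler_expR ler_wpM2r// ler_norm.
Qed.

Lemma intg_gauss k x rho : slow k rho -> intg (fun t => gdens 1 (x - t) * rho t).
Proof.
move=> h; apply: (eq_intg _ (intg_slow 0 x h)) => t.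
by rewrite mul0r expR0 mul1r.
Qed.

(** The function gamma * rho on the real axis. *)
Definition gauss_avg rho x := \int[mu]_t (gdens 1 (x - t) * rho t).

(** The derivative of the density at x - t is (t - x) times the density. *)
Lemma has_deriv_gauss_avg k rho x : slow k rho ->
  has_deriv (gauss_avg rho) x (gauss_avg (fun t => t * rho t) x - x * gauss_avg rho x).
Proof.
move=> h; have mr := slow_meas h.
have h1 := slow_id_mul h.
(* k from the window, 1 from the factor t and 1 to spare *)
pose M := `|k + 2|.
pose C := (Num.sqrt (2 * pi))^-1 * expR (M ^+ 2 / 2 + M * (`|x| + 1)).
have D := @has_deriv_Rint R (fun u t => gdens 1 (u - t) * rho t)
   (fun u t => gdens 1 (u - t) * (t * rho t) - u * (gdens 1 (u - t) * rho t)) x 1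
   (fun t => (`|x| + 2) * C * `|expR (- k * `|t|) * rho t|) ltr01.
have {}D : has_deriv (gauss_avg rho) x (\int[mu]_t (gdens 1 (x - t) * (t * rho t) - x * (gdens 1 (x - t) * rho t))).
  apply: D.
  - by move=> u _; exact: intg_gauss h.
  - move=> u t _.
    have d1 : has_deriv (fun u => gdens 1 (u - t)) u (- (u - t) / 1 ^+ 2 * gdens 1 (u - t) * 1).
      have db : has_deriv (fun u : R => u - t) u 1.
        exact: (has_deriv_eq (has_deriv_B (has_deriv_id u) (has_deriv_cst t u)) (subr0 1)).
      exact: (has_deriv_comp db (has_deriv_gdens (u - t) ltr01)).
    by eapply has_deriv_eq; [by deriv|rewrite /= expr1n divr1; ring].
  - by apply: intgZ; apply: intg_norm.
  - move=> u t uI.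
    have ux : `|u| <= `|x| + 1.
      have : `|u - x| < 1 by rewrite ltr_norml; lra.
      move=> /ltW h2; rewrite -[X in `|X| <= _](subrK x) addrC.
      by apply: (le_trans (ler_normD _ _)); rewrite lerD2l.
    have -> : gdens 1 (u - t) * (t * rho t) - u * (gdens 1 (u - t) * rho t) =
       gdens 1 (u - t) * (t - u) * rho t by ring.
    rewrite !normrM (ger0_norm (gdens_ge0 _ ltr01)) (ger0_norm (expR_ge0 _)).
    have e1 : `|t - u| <= (`|x| + 2) * expR (1 * `|t|).
      apply: (le_trans (ler_normB _ _)).
      have := expR_ge1Dx `|t|; have := normr_ge0 t; have := normr_ge0 x.
      move: ux; rewrite mul1r; move: `|u| `|t| `|x| (expR _) => a b c d; nra.
    have e2 : gdens 1 (u - t) * expR ((k + 2) * `|t|) <= C.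
      apply: (le_trans _ (le_trans (gdens_exp_bound u t (normr_ge0 (k + 2))) _)).
        by rewrite ler_wpM2l ?gdens_ge0// ler_expR ler_wpM2r// ler_norm.
      rewrite ler_wpM2l// ?invr_ge0 ?sqrtr_ge0// ler_expR lerD2l ler_wpM2l//.
    have -> : (`|x| + 2) * C * (expR (- k * `|t|) * `|rho t|) =
       (`|x| + 2) * C * expR (- k * `|t|) * `|rho t| by ring.
    rewrite ler_wpM2r//.
    apply: (@le_trans _ _ (gdens 1 (u - t) * ((`|x| + 2) * expR (1 * `|t|)))).
      by rewrite ler_wpM2l ?gdens_ge0.
    have -> : (`|x| + 2) * C * expR (- k * `|t|) = (`|x| + 2) * (C * expR (- k * `|t|)) by ring.
    rewrite mulrCA ler_wpM2l ?addr_ge0//.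
    apply: (@le_trans _ _ (gdens 1 (u - t) * expR ((k + 2) * `|t|) * expR (- k * `|t|))); last first.
      by rewrite ler_wpM2r ?expR_ge0.
    rewrite -mulrA ler_wpM2l ?gdens_ge0// -expRD ler_expR.
    by have := normr_ge0 t; move: `|t| => b; nra.
apply: (has_deriv_eq D); rewrite RintB; [|exact: intg_gauss h1|by apply: intgZ; exact: intg_gauss h].
by rewrite RintZ//; exact: intg_gauss h.
Qed.

(** The function F on the real axis, in real form. *)
Definition Fline t := \int[mu]_s (gdens 1 (t - s) * (s < 0)%R%:R).

Lemma intg_Fline t : intg (fun s => gdens 1 (t - s) * (s < 0)%R%:R).
Proof.
apply: (intg_mulb (M := 1)); [by apply: intg_reflect; exact: intg_gdens|by meas|].
by move=> s; exact: normb_le1.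
Qed.

Lemma measurable_Fline : measurable_fun setT Fline.
Proof.
apply: (@measurable_Rint_param R _ (measurableTypeR R) (fun z => gdens 1 (z.1 - z.2) * (z.2 < 0)%R%:R)).
by apply: measurable_funM; [apply: (measurableT_comp (measurable_gdens _)); meas|meas].
Qed.

Lemma Fline_ge0 t : 0 <= Fline t.
Proof. by apply: Rintegral_ge0 => s _; rewrite mulr_ge0 ?gdens_ge0. Qed.

Lemma gdens_anti x y : `|x| <= `|y| -> gdens 1 y <= gdens 1 x :> R.
Proof.
move=> xy; rewrite !gdens1E ler_wpM2l ?invr_ge0 ?sqrtr_ge0// ler_expR.
rewrite ler_wpM2r// lerN2 -(real_normK (num_real x)) -(real_normK (num_real y)).
by rewrite lerXn2r ?nnegrE.
Qed.

(** The density is at least the bound on a unit interval of negative numbers. *)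
Lemma Fline_lb t : gdens 1 (Num.max t 0 + 1) <= Fline t.
Proof.
(* the unit interval [m - 1, m[ consists of negative numbers at distance at most max t 0 + 1 from t *)
set m := Num.min t 0.
have -> : gdens 1 (Num.max t 0 + 1) = \int[mu]_s (gdens 1 (Num.max t 0 + 1) * ((m - 1 <= s)%R%:R * (s < m)%R%:R)).
  rewrite RintZ; last exact: intg_itv.
  by rewrite Rint_itv; [rewrite subKr mulr1|lra].
apply: le_Rint; [by apply: intgZ; exact: intg_itv|exact: intg_Fline|].
move=> s; have [sm|sm] := ltP s m; last by rewrite mulr0 mulr0 mulr_ge0 ?gdens_ge0.
have s0 : s < 0 by apply: (lt_le_trans sm); rewrite ge_min lexx orbT.
rewrite s0 !mulr1; have [sm1|_] := leP (m - 1) s; last by rewrite mulr0 gdens_ge0.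
rewrite mulr1; apply: gdens_anti; move: sm sm1; rewrite /m.
have [t0|t0] := leP t 0 => sm sm1.
  by rewrite add0r normr1 ler_norml; apply/andP; split; lra.
by rewrite [leRHS]ger0_norm ?ler_norml; [apply/andP; split; lra|lra].
Qed.

Lemma Fline_gt0 t : 0 < Fline t.
Proof. by apply: lt_le_trans (Fline_lb t); exact: gdens_gt0. Qed.

Lemma int_gdens_exp c : \int[mu]_s (gdens 1 s * expR (c * s)) = expR (c ^+ 2 / 2).
Proof.
transitivity (\int[mu]_s (expR (c ^+ 2 / 2) * gdens 1 (c - s))).
  by apply: eq_Rint => s; rewrite mulrC gdens_tilt// expr1n !mulr1.
rewrite RintZ; last by apply: intg_reflect; exact: intg_gdens.
by rewrite /Rintegral eint_gdens_shift//= mulr1.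
Qed.

(** Chernoff's bound: the indicator of s < 0 is at most exp(-cs). *)
Lemma Fline_ub c t : 0 <= c -> Fline t <= expR (- c * t + c ^+ 2 / 2).
Proof.
move=> c0.
have i : intg (fun s => gdens 1 (t - s) * expR (- c * s)).
  apply: (@eq_intg _ (fun s => expR (- c * t) * (expR (c * (t - s)) * gdens 1 (t - s)))).
    move=> s; rewrite mulrA -expRD mulrC; congr (_ * expR _); ring.
  by apply: intgZ; apply: (intg_reflect t (f := fun x => expR (c * x) * gdens 1 x)); exact: intg_exp_gdens.
apply: (@le_trans _ _ (\int[mu]_s (gdens 1 (t - s) * expR (- c * s)))).
  apply: le_Rint => //; first exact: intg_Fline.
  move=> s; rewrite ler_wpM2l ?gdens_ge0//.
  have [s0|_] := ltP s 0; last exact: expR_ge0.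
  by rewrite -[leLHS]expR0 ler_expR mulNr -mulrN mulr_ge0// oppr_ge0 ltW.
rewrite (Rint_reflect t); last exact: intg_meas i.
rewrite expRD -int_gdens_exp -RintZ; last first.
  by apply: (eq_intg _ (intg_exp_gdens c ltr01)) => s; rewrite mulrC.
apply: le_Rint; [exact: intg_reflect i| |].
  apply: intgZ; by apply: (eq_intg _ (intg_exp_gdens c ltr01)) => s; rewrite mulrC.
move=> s; rewrite subKr mulrCA -expRD le_eqVlt; apply/orP; left; apply/eqP; congr (_ * expR _).
by ring.
Qed.

Lemma Fline_le1 t : Fline t <= 1.
Proof. by have := Fline_ub t (lexx 0); rewrite oppr0 mul0r expr0n/= mul0r addr0 expR0. Qed.

(** The half-plane is met at the points 2u with u <= 0; this substitution is how
F enters both equations. *)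
Lemma FlineE_half t : Fline t = \int[mu]_u (2 * (gdens 1 (2 * u - t) * (u <= 0)%R%:R)).
Proof.
rewrite RintZ'; last first.
  by apply: measurable_funM; [apply: (measurableT_comp (measurable_gdens _)); meas|meas].
rewrite (_ : \int[mu]_u _ = \int[mu]_u (gdens 1 (2 * u - t) * (2 * u <= 0)%R%:R)); last first.
  apply: eq_Rint => u; congr (_ * (nat_of_bool _)%:R); apply/idP/idP => ?; lra.
rewrite -(@Rint_scale R 2 (fun v => gdens 1 (v - t) * (v <= 0)%R%:R)) //; last first.
  by apply: measurable_funM; [apply: (measurableT_comp (measurable_gdens _)); meas|meas].
apply: Rint_ae.
- by apply: measurable_funM; [apply: (measurableT_comp (measurable_gdens _)); meas|meas].
- by apply: measurable_funM; [apply: (measurableT_comp (measurable_gdens _)); meas|meas].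
have := ae_neq (0 : R); apply: aeS => s s0.
by rewrite -gdensN opprB le_eqVlt (negbTE s0).
Qed.

Lemma intg_exp_half c : c < 0 -> intg (fun t => expR (c * t) * (0 <= t)%R%:R).
Proof.
move=> c0; have c0' : 0 < - c by rewrite oppr_gt0.
apply: (@eq_intg _ (fun t => (- c)^-1 * exponential_pdf (- c) t)).
  move=> t; have [t0|t0] := leP 0 t; last by rewrite lt0_exponential_pdf// !mulr0.
  by rewrite exponential_pdfE//= mulr1 mulrA mulVf ?gt_eqF// mul1r opprK.
by apply: intgZ; exact: integrable_exponential_pdf.
Qed.

Lemma intg_ae f g : measurable_fun setT g -> {ae mu, forall t, g t = f t} -> intg f -> intg g.
Proof.
move=> mg e fi; have mf := intg_meas fi; apply/intgP; split => //.
case/intgP : fi => _; congr (_ < _)%E; apply: ge0_ae_eq_integral => //.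
- by apply/measurable_EFinP; meas.
- by apply/measurable_EFinP; meas.
- by move: e; apply: aeS => t ->.
Qed.

(** On the right, F(t) is at least a multiple of exp(-(t + 1)^2/2), so that the
quotient is at most a multiple of exp((x + 1)t), which decays. *)
Lemma intg_gdens_divF x f (M : R) : x < -1 -> measurable_fun setT f -> (forall t, `|f t| <= M) ->
  intg (fun t => gdens 1 (x - t) * (f t / Fline t)).
Proof.
move=> x1 mf fM.
have mF := measurable_Fline.
have M0 : 0 <= M by apply: le_trans (fM 0).
apply: (@intg_le _ _ (fun t => (M / gdens 1 1) * gdens 1 (x - t) +
   (M * expR (- x ^+ 2 / 2 + 1 / 2)) * (expR ((x + 1) * t) * (0 <= t)%R%:R))).
- by apply: measurable_funM; [apply: (measurableT_comp (measurable_gdens _)); meas|meas].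
- move=> t; rewrite normrM (ger0_norm (gdens_ge0 _ ltr01)) normrM normfV (ger0_norm (Fline_ge0 t)).
  apply: (@le_trans _ _ (gdens 1 (x - t) * (M / Fline t))).
    by rewrite ler_wpM2l ?gdens_ge0// ler_wpM2r// invr_ge0 Fline_ge0.
  have := Fline_lb t; have [t0|t0] := leP 0 t.
    rewrite mulr1 => FL.
    apply: (@le_trans _ _ (gdens 1 (x - t) * (M / gdens 1 (t + 1)))).
      by rewrite ler_wpM2l ?gdens_ge0// ler_wpM2l// lef_pV2 ?posrE ?gdens_gt0 ?Fline_gt0.
    rewrite [leLHS](_ : _ = M * expR (- x ^+ 2 / 2 + 1 / 2) * expR ((x + 1) * t)).
      by rewrite lerDr mulr_ge0 ?gdens_ge0// divr_ge0// gdens_ge0.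
    rewrite !gdens1E invfM invrK -expRN -!mulrA -expRD.
    have q0 := @s2pi_gt0 R.
    have -> : - x ^+ 2 / 2 + 1 / 2 + (x + 1) * t = - (x - t) ^+ 2 / 2 + - (- (t + 1) ^+ 2 / 2) by field.
    by rewrite expRD; field; rewrite gt_eqF.
  rewrite add0r mulr0 mulr0 addr0 => FL.
  rewrite mulrC ler_wpM2r ?gdens_ge0// ler_wpM2l// lef_pV2 ?posrE ?gdens_gt0 ?Fline_gt0//.
- apply: intgD; apply: intgZ; first by apply: intg_reflect; exact: intg_gdens.
  by apply: intg_exp_half; lra.
Qed.

(** The right-hand side is not known to be slow, but it is integrable against
the Gaussian for x < -1, which suffices for uniqueness. *)
Lemma gauss_avg_eq_divF k rho f (M : R) : slow k rho -> measurable_fun setT f ->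
  (forall t, `|f t| <= M) ->
  (forall x, x < 0 -> gauss_avg rho x = gauss_avg (fun t => f t / Fline t) x) ->
  {ae mu, forall t, rho t = f t / Fline t}.
Proof.
move=> hr mf fM e; have mr := slow_meas hr; have mF := measurable_Fline.
have ir x : intg (fun t => gdens 1 (x - t) * rho t) by exact: intg_gauss hr.
have id x : x < -1 -> intg (fun t => gdens 1 (x - t) * (f t / Fline t)).
  by move=> x1; exact: intg_gdens_divF mf fM.
have E x t : gdens 1 (x - t) * (rho t - f t / Fline t) =
    gdens 1 (x - t) * rho t - gdens 1 (x - t) * (f t / Fline t) by ring.
have := @gauss_inj R (fun t => rho t - f t / Fline t) (-1).
have m1 : measurable_fun setT (fun t => rho t - f t / Fline t) by meas.
have i1 x : x < -1 -> intg (fun t => gdens 1 (x - t) * (rho t - f t / Fline t)).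
  by move=> x1; apply: (@eq_intg _ _ _ (fun t => esym (E x t))); apply: intgB; [exact: ir|exact: id].
have z1 x : x < -1 -> \int[mu]_t (gdens 1 (x - t) * (rho t - f t / Fline t)) = 0.
  move=> x1; rewrite (eq_Rint (E x)) RintB; [|exact: ir|exact: id].
  by rewrite -/(gauss_avg rho x) e ?subrr//; lra.
move=> /(_ m1 i1 z1); apply: aeS => t /eqP; by rewrite subr_eq0 => /eqP.
Qed.

Lemma gauss_avg_eq0 k rho : slow k rho -> (forall x, x < 0 -> gauss_avg rho x = 0) ->
  {ae mu, forall t, rho t = 0}.
Proof.
move=> hr e; apply: (@gauss_inj R rho 0); first exact: slow_meas hr.
- by move=> x _; exact: intg_gauss hr.
- by move=> x x0; exact: e.
Qed.

Lemma gauss_avg_ae rho f x : measurable_fun setT rho -> measurable_fun setT f ->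
  {ae mu, forall t, rho t = f t} -> gauss_avg rho x = gauss_avg f x.
Proof.
move=> mr mf e; have mg : measurable_fun setT (fun t => gdens 1 (x - t)).
  by apply: (measurableT_comp (measurable_gdens _)); meas.
by apply: Rint_ae; [meas|meas|move: e; apply: aeS => t ->].
Qed.

(** Its Fourier transform is, up to elementary factors, gamma * rho on the vertical
line through a. *)
Definition gauss_slice rho a t := Num.sqrt (2 * pi) * (gdens 1 (a - t) * rho t).

Lemma intg_gauss_slice k rho a : slow k rho -> intg (gauss_slice rho a).
Proof. by move=> h; apply: intgZ; exact: intg_gauss h. Qed.

Lemma gdens_gdens x u t : gdens 1 (2 * x - t) * gdens 1 (2 * u - t) =
  (2 * pi)^-1 * (expR (- (x - u) ^+ 2) * (expR (- (x + u - t) ^+ 2 / 2)) ^+ 2).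
Proof.
rewrite !gdens1E; have q0 := @s2pi_gt0 R.
have -> : (2 * pi)^-1 = (Num.sqrt (2 * pi))^-1 ^+ 2 :> R.
  by rewrite exprVn sqr_sqrtr// mulr_ge0// pi_ge0.
have key : expR (- (2 * x - t) ^+ 2 / 2) * expR (- (2 * u - t) ^+ 2 / 2) =
   expR (- (x - u) ^+ 2) * expR (- (x + u - t) ^+ 2 / 2) ^+ 2.
  by rewrite [expR _ ^+ 2]expr2 -!expRD; congr expR; field.
by rewrite -key; ring.
Qed.

Lemma gdens_half (y : R) : gdens 1 (2 * y) = 2^-1 * gdens 2^-1 y.
Proof.
rewrite -{2}[y](mulKf (_ : 2 != 0))// gdens_scale ?invr_gt0// invrK mulrA mulVf// mul1r.
by [].
Qed.

Lemma intg_half t : intg (fun u => 2 * (gdens 1 (2 * u - t) * (u <= 0)%R%:R)).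
Proof.
apply: (@intgZ R 2 (fun u => gdens 1 (2 * u - t) * (u <= 0)%R%:R)).
apply: (intg_mulb (M := 1)); [|by meas|by move=> ?; exact: normb_le1].
apply: (@eq_intg _ (fun u => 2^-1 * gdens 2^-1 (t / 2 - u))).
  by move=> u; rewrite -gdens_half -gdensN; congr (gdens 1 _); field.
by apply: intgZ; apply: intg_reflect; apply: intg_gdens.
Qed.

(** Plancherel's formula on each vertical line turns the integral of |Phi|^2 into
one of rho^2; the product of the two Gaussians then separates, and the
integral over u <= 0 of one of them is F. *)
Lemma mass_formula k rho x : slow k rho ->
  (\int[mu]_u \int[mu]_s ((u <= 0)%R%:R *
     (expR (- (x - u) ^+ 2) * ((2 * pi)^-1 * fnorm2 (gauss_slice rho (x + u)) s)))%:E =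
   pi%:E * \int[mu]_t (gdens 1 (2 * x - t) * (Fline t * rho t ^+ 2))%:E)%E.
Proof.
move=> h; have mr := slow_meas h; have mF := measurable_Fline.
have q0 := @s2pi_gt0 R.
have q2 : Num.sqrt (2 * pi) ^+ 2 = 2 * pi :> R by rewrite sqr_sqrtr// mulr_ge0// pi_ge0.
have p0 : 0 < pi :> R by exact: pi_gt0.
pose f (z : R * R) := (2 * pi) * ((z.1 <= 0)%R%:R * gdens 1 (2 * z.1 - z.2)) *
   (gdens 1 (2 * x - z.2) * rho z.2 ^+ 2).
have f0 z : 0 <= f z.
  rewrite /f; apply: mulr_ge0; last by rewrite mulr_ge0 ?gdens_ge0 ?sqr_ge0.
  by apply: mulr_ge0; [rewrite mulr_ge0// ltW|rewrite mulr_ge0 ?gdens_ge0].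
have mf : measurable_fun setT f.
  have mr2 : measurable_fun setT (fun z : R * R => rho z.2) by apply: measurableT_comp.
  apply: measurable_funM; last first.
    by apply: measurable_funM; [apply: (measurableT_comp (measurable_gdens _)); meas|meas].
  apply: measurable_funM; first by meas.
  by apply: measurable_funM; [meas|apply: (measurableT_comp (measurable_gdens _)); meas].
transitivity (\int[mu]_u \int[mu]_t (f (u, t))%:E)%E.
  apply: eq_integral => u _.
  have gi := intg_gauss_slice (x + u) h.
  have c0 : 0 <= (u <= 0)%R%:R * (expR (- (x - u) ^+ 2) * (2 * pi)^-1).
    by rewrite !mulr_ge0 ?expR_ge0// invr_ge0 mulr_ge0// ltW.
  transitivity (\int[mu]_s (((u <= 0)%R%:R * (expR (- (x - u) ^+ 2) * (2 * pi)^-1))%:E *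
      (fnorm2 (gauss_slice rho (x + u)) s)%:E))%E.
    by apply: eq_integral => s _; rewrite -EFinM !mulrA.
  rewrite ge0_integralZl//; last first.
  - by move=> s _; rewrite lee_fin fnorm2_ge0.
  - by apply/measurable_EFinP; exact: measurable_fnorm2.
  rewrite plancherel// muleA -EFinM -ge0_integralZl//; last first.
  - by rewrite lee_fin mulr_ge0// mulr_ge0// ltW.
  - by move=> t _; rewrite lee_fin sqr_ge0.
  - by apply/measurable_EFinP; have := intg_meas gi => ?; meas.
  apply: eq_integral => t _; rewrite -EFinM /f/= /gauss_slice; congr EFin.
  transitivity ((u <= 0)%R%:R * (2 * pi) * (gdens 1 (2 * x - t) * gdens 1 (2 * u - t)) * rho t ^+ 2); last by ring.
  rewrite gdens_gdens !exprMn q2 gdens1E exprMn exprVn q2.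
  have : 2 * pi != 0 :> R by rewrite gt_eqF// mulr_gt0.
  move: (expR (- (x - u) ^+ 2)) (expR (_ / 2)) (2 * pi) => b c a a0.
  by field.
have mfE : measurable_fun setT (EFin \o f) by exact/measurable_EFinP.
have f0E z : (0 <= (EFin \o f) z)%E by rewrite /= lee_fin f0.
transitivity (\int[mu]_t \int[mu]_u (f (u, t))%:E)%E.
  exact: (fubini_tonelli (m1 := mu) (m2 := mu) (EFin \o f) mfE f0E).
rewrite -ge0_integralZl//; last first.
- by rewrite lee_fin ltW.
- move=> t _; rewrite lee_fin; apply: mulr_ge0; first exact: gdens_ge0.
  by apply: mulr_ge0; [exact: Fline_ge0|exact: sqr_ge0].
- apply/measurable_EFinP; apply: measurable_funM; last by meas.
  by apply: (measurableT_comp (measurable_gdens _)); meas.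
apply: eq_integral => t _.
rewrite -EFinM FlineE_half.
have i := intg_half t.
transitivity (\int[mu]_u ((pi * (gdens 1 (2 * x - t) * rho t ^+ 2))%:E *
   (2 * (gdens 1 (2 * u - t) * (u <= 0)%R%:R))%:E))%E.
  by apply: eq_integral => u _; rewrite -EFinM /f/=; congr EFin; ring.
rewrite ge0_integralZl//; last first.
- rewrite lee_fin; apply: mulr_ge0; first exact: ltW.
  by apply: mulr_ge0; [exact: gdens_ge0|exact: sqr_ge0].
- by move=> u _; rewrite lee_fin !mulr_ge0 ?gdens_ge0.
- by apply/measurable_EFinP; exact: intg_meas i.
by rewrite -EFin_Rint// -EFinM; congr EFin; ring.
Qed.

(** Both sides of the mass-one equation are Gaussian averages on the half-line. *)
Lemma mass_one_window k rho : slow k rho ->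
  (forall x, x <= 0 -> intg (fun t => gdens 1 (2 * x - t) * (Fline t * rho t ^+ 2)) /\
     gauss_avg (fun t => Fline t * rho t ^+ 2) (2 * x) = gauss_avg rho (2 * x)) <->
  {ae mu, forall t, Fline t * rho t ^+ 2 = rho t}.
Proof.
move=> h; have mr := slow_meas h; have mF := measurable_Fline.
have mFr : measurable_fun setT (fun t => Fline t * rho t ^+ 2) by meas.
split=> [H|H x x0]; last first.
  split; last exact: gauss_avg_ae.
  apply: (@intg_ae (fun t => gdens 1 (2 * x - t) * rho t)).
  - by apply: measurable_funM => //; apply: (measurableT_comp (measurable_gdens _)); meas.
  - by move: H; apply: aeS => t ->.
  - exact: intg_gauss h.
have H' x : x < 0 -> intg (fun t => gdens 1 (x - t) * (Fline t * rho t ^+ 2)) /\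
     gauss_avg (fun t => Fline t * rho t ^+ 2) x = gauss_avg rho x.
  move=> x0; have e : 2 * (x / 2) = x by field.
  by have := H (x / 2); rewrite e; apply; lra.
have E x t : gdens 1 (x - t) * (Fline t * rho t ^+ 2) - gdens 1 (x - t) * rho t =
   gdens 1 (x - t) * (Fline t * rho t ^+ 2 - rho t) by ring.
have := @gauss_inj R (fun t => Fline t * rho t ^+ 2 - rho t) 0.
have m1 : measurable_fun setT (fun t => Fline t * rho t ^+ 2 - rho t) by meas.
have i1 x : x < 0 -> intg (fun t => gdens 1 (x - t) * (Fline t * rho t ^+ 2 - rho t)).
  move=> x1; apply: (@eq_intg _ _ _ (E x)); apply: intgB; first exact: (H' x x1).1.
  exact: intg_gauss h.
have z1 x : x < 0 -> \int[mu]_t (gdens 1 (x - t) * (Fline t * rho t ^+ 2 - rho t)) = 0.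
  move=> x1; rewrite -(eq_Rint (E x)) RintB; [|exact: (H' x x1).1|exact: intg_gauss h].
  by rewrite -/(gauss_avg rho x) -(H' x x1).2 subrr.
move=> /(_ m1 i1 z1); apply: aeS => t /eqP; by rewrite subr_eq0 => /eqP.
Qed.

End window.

(** * The Lorentz kernel *)

Section lorentz.
Context {R : realType}.
Notation mu := (@lebesgue_measure R).
Implicit Types (f g p q : R -> R) (a s t x u : R).

Lemma intg_expN_norm a : 0 < a -> intg (fun t => expR (- a * `|t|)).
Proof.
move=> a0; have i : intg (fun t => expR (- a * t) * (0 <= t)%R%:R).
  by apply: intg_exp_half; rewrite oppr_lt0.
apply: (intg_le _ _ (intgD i (intg_reflect 0 i))).
  by meas.
move=> t; rewrite (ger0_norm (expR_ge0 _)) sub0r.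
have [t0|t0] := leP 0 t; first by rewrite ger0_norm// mulr1 lerDl mulr_ge0// expR_ge0.
by rewrite mulr0 add0r ltr0_norm// oppr_ge0 (ltW t0) mulr1.
Qed.

Lemma Rint_exp_cos_half a s : 0 < a ->
  \int[mu]_t (expR (- a * t) * cos (s * t) * \1_(`[0, +oo[%classic) t) =
  a / (a ^+ 2 + s ^+ 2).
Proof.
move=> a0; have d0 : 0 < a ^+ 2 + s ^+ 2 by rewrite ltr_wpDr ?sqr_ge0// exprn_gt0.
have d0' : a ^+ 2 + s ^+ 2 != 0 by rewrite gt_eqF.
pose H t := (a ^+ 2 + s ^+ 2)^-1 * (expR (- a * t) * (s * sin (s * t) - a * cos (s * t))).
have Hd t : has_deriv H t (expR (- a * t) * cos (s * t)).
  eapply has_deriv_eq; [by rewrite /H; deriv|].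
  rewrite /=; move: (expR _) (cos _) (sin _) => e c1 s1; by field.
have Hle t : `|H t| <= (a ^+ 2 + s ^+ 2)^-1 * (`|s| + a) * expR (- a * t).
  rewrite /H normrM (ger0_norm (ltW _))// ?invr_gt0// -mulrA ler_pM2l ?invr_gt0//.
  rewrite normrM (ger0_norm (expR_ge0 _)) mulrC ler_pM2r ?expR_gt0//.
  apply: (le_trans (ler_normB _ _)); rewrite !normrM (gtr0_norm a0).
  rewrite lerD// ler_piMr//; [|exact: ltW|]; rewrite ler_norml.
    by rewrite sin_geN1 sin_le1.
  by rewrite cos_geN1 cos_le1.
have c0 : continuous (fun t => expR (- a * t) * cos (s * t)).
  move=> t; apply: (@has_deriv_cont _ _ _ _).
  by deriv.
have i0 : intg (fun t => expR (- a * t) * cos (s * t) * \1_(`[0, +oo[%classic) t).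
  apply: (intg_le _ _ (intg_exp_half (c := - a) _)); last by rewrite oppr_lt0.
    apply: measurable_funM; first by meas.
    by apply: measurable_indic.
  move=> t; rewrite indicE mem_setE in_itv/= andbT !normrM (ger0_norm (expR_ge0 _)).
  rewrite -mulrA ler_wpM2l ?expR_ge0// normr_nat ler_piMl//.
  by rewrite ler_norml cos_geN1 cos_le1.
rewrite (@FTC_exhaust R _ H _ (fun=> 0) (fun n => n.+1%:R) 0 (- (a / (a ^+ 2 + s ^+ 2))))//.
- by rewrite sub0r opprK.
- by move=> n x /andP[x0 _]; rewrite /= in_itv/= x0.
- move=> x; rewrite /= in_itv/= andbT => x0.
  near=> n; rewrite x0/=; apply: (@le_trans _ _ n%:R); last by rewrite ler_nat.
  near: n; exact: nbhs_infty_ger.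
- apply: (@cvg0_of_norm_le _ _ (fun n => (a ^+ 2 + s ^+ 2)^-1 * (`|s| + a) * (a^-1 * n.+1%:R^-1))).
    move=> n; apply: (le_trans (Hle _)); apply: ler_wpM2l.
      by rewrite mulr_ge0 ?invr_ge0 ?(ltW d0)// addr_ge0// ltW.
    rewrite mulNr expRN -invfM lef_pV2 ?posrE ?expR_gt0 ?mulr_gt0//.
    by apply: (le_trans _ (expR_ge1Dx _)); rewrite lerDr.
  rewrite -[X in _ --> X](mulr0 ((a ^+ 2 + s ^+ 2)^-1 * (`|s| + a))).
  apply: cvgMr; rewrite -[X in _ --> X](mulr0 a^-1); apply: cvgMr.
  exact: cvg_harmonic.
- rewrite (_ : H 0 = - (a / (a ^+ 2 + s ^+ 2))); first exact: cvg_cst.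
  by rewrite /H !mulr0 expR0 sin0 cos0; field.
Unshelve. all: by end_near. Qed.

Lemma cosT_expN_norm a s : 0 < a -> cosT (fun t => expR (- a * `|t|)) s = 2 * (a / (a ^+ 2 + s ^+ 2)).
Proof.
move=> a0; rewrite -(Rint_exp_cos_half s a0) /cosT.
set h := fun t => expR (- a * t) * cos (s * t) * \1_(`[0, +oo[%classic) t.
have i : intg h.
  apply: (intg_le _ _ (intg_exp_half (c := - a) _)); last by rewrite oppr_lt0.
    by apply: measurable_funM; [meas|apply: measurable_indic].
  move=> t; rewrite /h indicE mem_setE in_itv/= andbT !normrM (ger0_norm (expR_ge0 _)).
  rewrite -mulrA ler_wpM2l ?expR_ge0// normr_nat ler_piMl//.
  by rewrite ler_norml cos_geN1 cos_le1.
have mh := intg_meas i.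
rewrite (@Rint_ae _ _ (fun t => h t + h (0 - t))).
- rewrite RintD//; last exact: intg_reflect.
  by rewrite -(Rint_reflect 0 mh); ring.
- by meas.
- by apply: measurable_funD => //; exact: intg_meas (intg_reflect 0 i).
- have := @ae_neq R 0; apply: aeS => t t0.
  rewrite /h !indicE !mem_setE !in_itv/= !andbT sub0r oppr_ge0.
  case: ltgtP t0 => // t0 _; rewrite ?mulr1 ?mulr0 ?addr0 ?add0r.
    by rewrite gtr0_norm.
  by rewrite ltr0_norm// !mulrN cosN.
Qed.

Lemma Rint_odd f : measurable_fun setT f -> (forall t, f (- t) = - f t) ->
  \int[mu]_t f t = 0.
Proof.
move=> mf fN; have e : \int[mu]_t f t = - \int[mu]_t f t.
  rewrite {1}(Rint_reflect 0 mf) -mulN1r -RintZ'//.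
  by apply: eq_Rint => t; rewrite sub0r fN mulN1r.
by lra.
Qed.

Lemma sinT_expN_norm a s : sinT (fun t => expR (- a * `|t|)) s = 0.
Proof.
apply: Rint_odd; first by meas.
by move=> t; rewrite normrN mulrN sinN mulrN.
Qed.

Lemma continuous_expN_norm a : continuous (fun t => expR (- a * `|t|)).
Proof.
move=> t; apply: (@continuous_comp _ _ _ (fun t => - a * `|t|) expR); last exact: continuous_expR.
apply: cvgMr; exact: norm_continuous.
Qed.

Lemma expN_norm_le1 a t : 0 < a -> `|expR (- a * `|t|)| <= 1.
Proof. by move=> a0; rewrite (ger0_norm (expR_ge0 _)) expR_le1 mulNr oppr_le0 mulr_ge0// ltW. Qed.

(** The Lorentz kernel is the transform of exp(-a|u|), so that this is the
formula for the shifted weight. *)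
Lemma gweight_lorentz a n t : 0 < a ->
  \int[mu]_s (gweight n s * (2 * (a / (a ^+ 2 + s ^+ 2)) * cos (s * t))) =
  2 * pi * \int[mu]_u (expR (- a * `|u|) * gdens (n.+1%:R^-1) (t - u)).
Proof.
move=> a0; have i := intg_expN_norm a0.
rewrite -RintZ'; last first.
  by apply: intg_meas; apply: intg_gdensconv.
transitivity (\int[mu]_u (expR (- a * `|u|) * cosT (gweight n) (t - u))).
  rewrite -(Rint_weight_shift t (intg_gweight n) i); apply: eq_Rint => s.
  by rewrite cosT_expN_norm// sinT_expN_norm mulr0 addr0 [cos _ * _]mulrC.
by apply: eq_Rint => u; rewrite cosT_gweight mulrCA.
Qed.

(** The case t = 0 of the previous identity bounds the Gaussian truncations by
2 pi, and Fatou's lemma applies. *)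
Lemma intg_lorentz a : 0 < a -> intg (fun s => 2 * (a / (a ^+ 2 + s ^+ 2))).
Proof.
move=> a0; have i := intg_expN_norm a0.
have w0 s : 0 <= 2 * (a / (a ^+ 2 + s ^+ 2)).
  by rewrite mulr_ge0// divr_ge0 ?(ltW a0)// addr_ge0 ?sqr_ge0.
have mw : measurable_fun setT (fun s => 2 * (a / (a ^+ 2 + s ^+ 2))) by meas.
have iw n : intg (fun s => gweight n s * (2 * (a / (a ^+ 2 + s ^+ 2)))).
  apply: (intg_mulb (M := 2 / a)); [exact: intg_gweight|exact: mw|].
  move=> s; rewrite ger0_norm// ler_pM2l// ler_pdivrMr; last first.
    by rewrite ltr_wpDr ?sqr_ge0// exprn_gt0.
  by rewrite mulrDr expr2 mulrA mulVf ?gt_eqF// mul1r lerDl mulr_ge0 ?sqr_ge0 ?invr_ge0 ?ltW.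
apply: intg_ge0_lty => //.
apply: (@le_lt_trans _ _ (2 * pi)%:E); last by rewrite ltry.
apply: (@fatou_bound _ (fun n s => gweight n s * (2 * (a / (a ^+ 2 + s ^+ 2))))) => //.
- by move=> n; exact: intg_meas (iw n).
- by move=> n x; rewrite mulr_ge0 ?gweight_ge0.
- apply: nearW => s; rewrite -[X in _ --> X]mul1r; apply: cvgMl; exact: cvg_gweight.
- move=> n; rewrite -EFin_Rint// lee_fin.
  have := gweight_lorentz n 0 a0; rewrite (@eq_Rint _ _ (fun s => gweight n s * (2 * (a / (a ^+ 2 + s ^+ 2))))); last first.
    by move=> s; rewrite mulr0 cos0 mulr1.
  move=> ->; rewrite ler_piMr ?mulr_ge0 ?pi_ge0//.
  have n0 : 0 < n.+1%:R^-1 :> R by rewrite invr_gt0.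
  rewrite -[leRHS](int_gdens n0); apply: le_Rint; [exact: intg_gdensconv|exact: intg_gdens|] => u.
  rewrite sub0r gdensN ler_piMl ?gdens_ge0//.
  by apply: le_trans (expN_norm_le1 u a0); exact: ler_norm.
Qed.

(** Fourier inversion for the two-sided exponential, letting n grow in the
truncated identity. *)
Lemma cosT_lorentz a t : 0 < a ->
  cosT (fun s => 2 * (a / (a ^+ 2 + s ^+ 2))) t = 2 * pi * expR (- a * `|t|).
Proof.
move=> a0; have iw := intg_lorentz a0; have mw := intg_meas iw.
have h1 : (\int[mu]_s (gweight n s * (2 * (a / (a ^+ 2 + s ^+ 2)) * cos (s * t))))
    @[n --> \oo] --> cosT (fun s => 2 * (a / (a ^+ 2 + s ^+ 2))) t.
  rewrite /cosT; under [X in _ --> X]eq_Rint => s do rewrite [t * s]mulrC.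
  apply: (@dominated_cvg_Rint _ _ _ (fun s => `|2 * (a / (a ^+ 2 + s ^+ 2))|)).
  - by move=> n; apply: measurable_funM; [exact: measurable_gweight|meas].
  - by meas.
  - by move=> s; rewrite -[X in _ --> X]mul1r; apply: cvgMl; exact: cvg_gweight.
  - exact: intg_norm.
  - move=> n s; rewrite normrM (ger0_norm (gweight_ge0 _ _)) -[leRHS]mul1r ler_pM//.
    + exact: gweight_ge0.
    + exact: gweight_le1.
    + by rewrite normrM ler_piMr// ler_norml cos_geN1 cos_le1.
have h2 : (\int[mu]_s (gweight n s * (2 * (a / (a ^+ 2 + s ^+ 2)) * cos (s * t))))
    @[n --> \oo] --> 2 * pi * expR (- a * `|t|).
  under eq_fun => n do rewrite gweight_lorentz//.
  apply: cvgMr; apply: (@gdens_approx _ _ 1); first exact: continuous_expN_norm.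
  by move=> x; exact: expN_norm_le1.
exact: cvg_unique h1 h2.
Qed.

(** The Lorentz kernel is integrable, so that it can serve as a weight. *)
Lemma Rint_lorentz a g : 0 < a -> intg g ->
  intg (fun s => a / (a ^+ 2 + s ^+ 2) * fnorm2 g s) /\
  \int[mu]_s (a / (a ^+ 2 + s ^+ 2) * fnorm2 g s) =
  pi * \int[mu]_t (g t * \int[mu]_u (g u * expR (- a * `|t - u|))).
Proof.
move=> a0 gi; have [i e] := Rint_weight (intg_lorentz a0) gi.
have E s : 2^-1 * (2 * (a / (a ^+ 2 + s ^+ 2)) * (cosT g s ^+ 2 + sinT g s ^+ 2)) =
   a / (a ^+ 2 + s ^+ 2) * fnorm2 g s.
  by rewrite /fnorm2; move: (a / _) => b; field.
split; first by apply: eq_intg E _; exact: intgZ.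
rewrite -(eq_Rint E) RintZ// e.
have mE : measurable_fun setT (fun t => \int[mu]_u (g u * expR (- a * `|t - u|))).
  apply: (@measurable_Rint_param R _ (measurableTypeR R)
    (fun z => g z.2 * expR (- a * `|z.1 - z.2|))).
  have mg := intg_meas gi; have mg2 : measurable_fun setT (fun z : R * R => g z.2).
    by apply: measurableT_comp.
  by meas.
have mg := intg_meas gi.
rewrite -!RintZ'; last 2 first.
- by apply: measurable_funM => //; exact: mE.
- by apply: measurable_funM => //; apply: (@measurable_Rint_param R _ (measurableTypeR R)
    (fun z => g z.2 * cosT (fun s => 2 * (a / (a ^+ 2 + s ^+ 2))) (z.1 - z.2)));
  apply: measurable_funM; [apply: measurableT_comp|apply: measurableT_comp;
    [exact: measurable_cosT (intg_lorentz a0)|meas]].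
apply: eq_Rint => t.
under [in LHS]eq_Rint => u do rewrite cosT_lorentz// mulrCA.
rewrite RintZ'; last first.
  by meas.
by move: (g t) (\int[mu]_u _) pi => A B C; field.
Qed.

End lorentz.

(** * Ordered pairings and the Berezin kernel on a vertical line *)

Section ordered_pairs.
Context {R : realType}.
Notation mu := (@lebesgue_measure R).
Implicit Types (f g p q rho : R -> R) (a s t x u : R).

Definition ordered p q := \int[mu]_t (p t * \int[mu]_u ((t < u)%R%:R * q u)).

Lemma intg_ltb q t : intg q -> intg (fun u => (t < u)%R%:R * q u).
Proof.
move=> iq; apply: (@eq_intg _ (fun u => q u * (t < u)%R%:R)); first by move=> u; rewrite mulrC.
apply: (intg_mulb (M := 1)) => //; first by meas.
by move=> u; exact: normb_le1.
Qed.

Lemma intg_leb q t : intg q -> intg (fun u => (u <= t)%R%:R * q u).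
Proof.
move=> iq; apply: (@eq_intg _ (fun u => q u * (u <= t)%R%:R)); first by move=> u; rewrite mulrC.
apply: (intg_mulb (M := 1)) => //; first by meas.
by move=> u; exact: normb_le1.
Qed.

Lemma intg2_ordered p q : intg p -> intg q ->
  intg2 (fun z => p z.1 * ((z.1 < z.2)%R%:R * q z.2)).
Proof.
move=> ip iq; apply: (intg2_le _ _ (intg2_prod (intg_norm ip) (intg_norm iq))).
  have mp := intg_meas ip; have mq := intg_meas iq.
  apply: measurable_funM; first by apply: measurableT_comp.
  by apply: measurable_funM; [meas|apply: measurableT_comp].
move=> z; rewrite !normrM ler_wpM2l// ler_piMl// normr_nat.
by case: ltP.
Qed.

Lemma ordered_swap p q : intg p -> intg q ->
  \int[mu]_t (q t * \int[mu]_u ((u <= t)%R%:R * p u)) = ordered p q.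
Proof.
move=> ip iq; have mp := intg_meas ip; have mq := intg_meas iq.
have i2 := intg2_ordered ip iq.
transitivity (\int[mu]_t \int[mu]_u (p t * ((t < u)%R%:R * q u))); last first.
  by apply: eq_Rint => t; rewrite RintZ//; exact: intg_ltb.
rewrite (Rint_fubini i2)/=; apply: eq_Rint => t.
rewrite -RintZ; last exact: intg_leb.
apply: Rint_ae; [by meas|by meas|].
have := @ae_neq R t; apply: aeS => u ut.
by rewrite lt_neqAle ut/=; ring.
Qed.

Lemma ordered_compl p q : intg p -> intg q ->
  \int[mu]_t (p t * \int[mu]_u ((u <= t)%R%:R * q u)) =
  (\int[mu]_t p t) * (\int[mu]_u q u) - ordered p q.
Proof.
move=> ip iq; have mp := intg_meas ip.
have ii : intg (fun t => p t * \int[mu]_u ((t < u)%R%:R * q u)).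
  have [+ _] := Rint_fubini1 (intg2_ordered ip iq); apply: eq_intg => t /=.
  by rewrite RintZ//; exact: intg_ltb.
rewrite [_ * \int[mu]_u q u]mulrC -RintZ// /ordered -RintB//; last exact: intgZ.
apply: eq_Rint => t.
rewrite [X in X * p t](@eq_Rint _ _ (fun u => (u <= t)%R%:R * q u + (t < u)%R%:R * q u)).
  by rewrite RintD; [ring|exact: intg_leb|exact: intg_ltb].
by move=> u; case: leP => _ /=; ring.
Qed.

Lemma gdens_gdens_exp x u t s :
  gdens 1 (2 * x - t) * gdens 1 (2 * u - s) =
  expR (- (x - u) ^+ 2) * (gdens 1 (x + u - t) * gdens 1 (x + u - s)) * expR ((x - u) * (t - s)).
Proof.
rewrite !gdens1E; have e : expR (- (2 * x - t) ^+ 2 / 2) * expR (- (2 * u - s) ^+ 2 / 2) =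
  expR (- (x - u) ^+ 2) * (expR (- (x + u - t) ^+ 2 / 2) * expR (- (x + u - s) ^+ 2 / 2)) *
  expR ((x - u) * (t - s)).
  by rewrite -!expRD; congr expR; field.
rewrite mulrACA e; ring.
Qed.

(** Completing squares turns the factor exp(-|x - u| |t - s|) into a product of
two Gaussians, centred at 2x and 2u in one order or the other according to the
sign of (x - u)(t - s). The two half-planes t < s and t > s contribute equally. *)
Lemma Rint_slice_kernel k rho x u : slow k rho -> x != u ->
  expR (- (x - u) ^+ 2) * ((2 * pi)^-1 * \int[mu]_t (gauss_slice rho (x + u) t *
    \int[mu]_s (gauss_slice rho (x + u) s * expR (- `|x - u| * `|t - s|)))) =
  2 * Num.sg (x - u) *
   (ordered (fun t => gdens 1 (2 * x - t) * rho t) (fun t => gdens 1 (2 * u - t) * rho t)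
    - (x < u)%R%:R * (gauss_avg rho (2 * x) * gauss_avg rho (2 * u))).
Proof.
move=> h xu; have mr := slow_meas h.
set p := fun t => gdens 1 (2 * x - t) * rho t.
set q := fun t => gdens 1 (2 * u - t) * rho t.
have ip : intg p by exact: intg_gauss h.
have iq : intg q by exact: intg_gauss h.
have mp := intg_meas ip; have mq := intg_meas iq.
have ig := intg_gauss_slice (x + u) h; have mg := intg_meas ig.
have q2 : Num.sqrt (2 * pi) ^+ 2 = 2 * pi :> R by rewrite sqr_sqrtr// mulr_ge0// pi_ge0.
have pi0 : 2 * pi != 0 :> R by rewrite gt_eqF// mulr_gt0// pi_gt0.
have K t s : expR (- (x - u) ^+ 2) * ((2 * pi)^-1 *
    (gauss_slice rho (x + u) t * gauss_slice rho (x + u) s)) * expR ((x - u) * (t - s)) = p t * q s.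
  rewrite /p /q [RHS]mulrACA gdens_gdens_exp /gauss_slice.
  transitivity (expR (- (x - u) ^+ 2) * ((2 * pi)^-1 * Num.sqrt (2 * pi) ^+ 2) *
    (gdens 1 (x + u - t) * gdens 1 (x + u - s)) * (rho t * rho s) * expR ((x - u) * (t - s))).
    by ring.
  by rewrite q2 mulVf// mulr1; ring.
have K' t s : expR (- (x - u) ^+ 2) * ((2 * pi)^-1 *
    (gauss_slice rho (x + u) t * gauss_slice rho (x + u) s)) * expR (- ((x - u) * (t - s))) = p s * q t.
  by rewrite -K [gauss_slice rho (x + u) s * _]mulrC; congr (_ * expR _); ring.
have mJ (r : R -> R) : measurable_fun setT r ->
    measurable_fun setT (fun t => \int[mu]_s ((t < s)%R%:R * r s)).
  move=> mr'; apply: (@measurable_Rint_param R _ (measurableTypeR R)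
    (fun z => (z.1 < z.2)%R%:R * r z.2)).
  by apply: measurable_funM; [meas|apply: measurableT_comp].
have mJ' (r : R -> R) : measurable_fun setT r ->
    measurable_fun setT (fun t => \int[mu]_s ((s <= t)%R%:R * r s)).
  move=> mr'; apply: (@measurable_Rint_param R _ (measurableTypeR R)
    (fun z => (z.2 <= z.1)%R%:R * r z.2)).
  by apply: measurable_funM; [meas|apply: measurableT_comp].
have ils (r1 r2 : R -> R) : intg r1 -> intg r2 -> intg (fun t => r1 t * \int[mu]_s ((t < s)%R%:R * r2 s)).
  move=> i1 i2; apply: (intg_mulb (M := \int[mu]_s `|r2 s|)) => //.
    by apply: mJ; exact: intg_meas.
  move=> t; apply: (le_trans (le_norm_Rint (intg_ltb _ i2))).
  apply: le_Rint; [exact: intg_norm (intg_ltb _ i2)|exact: intg_norm|] => s.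
  by rewrite normrM ler_piMl// normb_le1.
have ile (r1 r2 : R -> R) : intg r1 -> intg r2 -> intg (fun t => r1 t * \int[mu]_s ((s <= t)%R%:R * r2 s)).
  move=> i1 i2; apply: (intg_mulb (M := \int[mu]_s `|r2 s|)) => //.
    by apply: mJ'; exact: intg_meas.
  move=> t; apply: (le_trans (le_norm_Rint (intg_leb _ i2))).
  apply: le_Rint; [exact: intg_norm (intg_leb _ i2)|exact: intg_norm|] => s.
  by rewrite normrM ler_piMl// normb_le1.
transitivity (\int[mu]_t \int[mu]_s (expR (- (x - u) ^+ 2) * ((2 * pi)^-1 *
    (gauss_slice rho (x + u) t * gauss_slice rho (x + u) s)) * expR (- `|x - u| * `|t - s|))).
  have mI : measurable_fun setT (fun t =>
      \int[mu]_s (gauss_slice rho (x + u) s * expR (- `|x - u| * `|t - s|))).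
    apply: (@measurable_Rint_param R _ (measurableTypeR R)
      (fun z => gauss_slice rho (x + u) z.2 * expR (- `|x - u| * `|z.1 - z.2|))).
    by apply: measurable_funM; [apply: measurableT_comp|meas].
  rewrite mulrA -RintZ'; last by apply: measurable_funM.
  apply: eq_Rint => t; rewrite mulrA -RintZ'; last by meas.
  by apply: eq_Rint => s; ring.
move: xu; rewrite -subr_eq0 => xu.
have [a0|a0] := ltP 0 (x - u).
  rewrite gtr0_sg// (_ : (x < u) = false) ?mul0r ?subr0 ?mulr1; last first.
    by apply/negbTE; rewrite -leNgt -subr_ge0 ltW.
  transitivity (\int[mu]_t (p t * \int[mu]_s ((t < s)%R%:R * q s) +
     q t * \int[mu]_s ((s <= t)%R%:R * p s))).
    apply: eq_Rint => t; rewrite -!RintZ; [|exact: intg_leb|exact: intg_ltb].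
    rewrite -RintD; [|apply: intgZ; exact: intg_ltb|apply: intgZ; exact: intg_leb].
    apply: eq_Rint => s; rewrite (gtr0_norm a0); have [ts|ts] := ltP t s.
      by rewrite ltr0_norm ?subr_lt0// mulrNN K /=; ring.
    by rewrite ger0_norm ?subr_ge0// mulNr K' /=; ring.
  rewrite RintD; [|exact: ils|exact: ile].
  by rewrite ordered_swap// /ordered; ring.
have {}a0 : x - u < 0 by rewrite lt_neqAle xu.
rewrite ltr0_sg// (_ : (x < u) = true) ?mul1r; last by rewrite -subr_lt0.
transitivity (\int[mu]_t (p t * \int[mu]_s ((s <= t)%R%:R * q s) +
     q t * \int[mu]_s ((t < s)%R%:R * p s))).
  apply: eq_Rint => t; rewrite -!RintZ; [|exact: intg_ltb|exact: intg_leb].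
  rewrite -RintD; [|apply: intgZ; exact: intg_leb|apply: intgZ; exact: intg_ltb].
  apply: eq_Rint => s; rewrite (ltr0_norm a0) opprK; have [ts|ts] := ltP t s.
    by rewrite ltr0_norm ?subr_lt0// mulrN K' /=; ring.
  by rewrite ger0_norm ?subr_ge0// K /=; ring.
rewrite RintD; [|exact: ile|exact: ils].
rewrite -/(ordered q p) -(ordered_swap iq ip) ordered_compl// /gauss_avg -/p -/q.
by ring.
Qed.

End ordered_pairs.

(** * The Cauchy transform of the Berezin kernel *)

Section cauchy.
Context {R : realType}.
Notation mu := (@lebesgue_measure R).
Implicit Types (f g p q rho : R -> R) (a s t x u k : R).

(** This function of the window carries the whole Cauchy transform: Ward's equation
will say that tail + id is constant where the window does not vanish. *)
Definition mass_tail rho t := \int[mu]_s ((t < s)%R%:R * (Fline s * rho s)).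

Lemma slow_norm k rho : slow k rho -> slow k (fun t => `|rho t|).
Proof.
move=> h; apply: eq_intg (intg_norm h) => t.
by rewrite normrM (ger0_norm (expR_ge0 _)).
Qed.

(** Chernoff's bound against the weight of the class, on the half-line s > t. *)
Lemma Fline_mass_tail_le k t s : 0 <= k -> t < s ->
  Fline s <= expR (k ^+ 2 / 2 + 2 * k * `|t|) * expR (- k * `|s|).
Proof.
move=> k0 ts; apply: (le_trans (Fline_ub s k0)); rewrite -expRD ler_expR.
have : `|s| - s <= 2 * `|t|.
  have [s0|s0] := leP 0 s; first by rewrite ger0_norm// subrr mulr_ge0.
  by rewrite ltr0_norm// ltr0_norm; lra.
move=> /(ler_wpM2l k0); lra.
Qed.

Lemma intg_mass_tail k rho t : 0 <= k -> slow k rho ->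
  intg (fun s => (t < s)%R%:R * (Fline s * rho s)).
Proof.
move=> k0 h; have mr := slow_meas h; have mF := @measurable_Fline R.
apply: (intg_le _ _ (intgZ (expR (k ^+ 2 / 2 + 2 * k * `|t|)) (intg_norm h))); first by meas.
move=> s; rewrite !normrM !(ger0_norm (expR_ge0 _)) (ger0_norm (Fline_ge0 _)).
have [ts|ts] := ltP t s; last by rewrite normr0 mul0r !mulr_ge0 ?expR_ge0.
by rewrite normr1 mul1r mulrA ler_wpM2r// Fline_mass_tail_le.
Qed.

Lemma mass_tail_le k rho t : 0 <= k -> slow k rho ->
  `|mass_tail rho t| <= expR (k ^+ 2 / 2) * (\int[mu]_s `|expR (- k * `|s|) * rho s|) *
                   expR (2 * k * `|t|).
Proof.
move=> k0 h; have i := intg_mass_tail t k0 h; apply: (le_trans (le_norm_Rint i)).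
rewrite mulrAC -expRD -RintZ; last exact: intg_norm.
apply: le_Rint; [exact: intg_norm|apply: intgZ; exact: intg_norm|] => s.
rewrite !normrM !(ger0_norm (expR_ge0 _)) (ger0_norm (Fline_ge0 _)).
have [ts|ts] := ltP t s; last by rewrite normr0 mul0r !mulr_ge0 ?expR_ge0.
by rewrite normr1 mul1r mulrA ler_wpM2r// Fline_mass_tail_le.
Qed.

Lemma measurable_mass_tail rho : measurable_fun setT rho -> measurable_fun setT (mass_tail rho).
Proof.
move=> mr; apply: (@measurable_Rint_param R _ (measurableTypeR R)
  (fun z => (z.1 < z.2)%R%:R * (Fline z.2 * rho z.2))).
have mF := @measurable_Fline R.
apply: measurable_funM; [by meas|apply: measurable_funM].
  by apply: measurableT_comp.
by apply: measurableT_comp.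
Qed.

Lemma slow_mass_tail k rho : 0 <= k -> slow k rho -> slow (k + 2 * k) (fun t => rho t * mass_tail rho t).
Proof.
move=> k0 h; apply: slowM => //; first by apply: measurable_mass_tail; exact: slow_meas h.
by eexists => t; exact: mass_tail_le.
Qed.

Lemma intg2_mass_tail k rho t : 0 <= k -> slow k rho ->
  intg2 (fun z => (t < z.2)%R%:R * rho z.2 * (2 * (gdens 1 (2 * z.1 - z.2) * (z.1 <= 0)%R%:R))).
Proof.
move=> k0 h; have mr := slow_meas h; have mF := @measurable_Fline R.
have mr2 : measurable_fun setT (fun z : R * R => rho z.2) by apply: measurableT_comp.
apply/intg2P'.
  apply: measurable_funM; first by meas.
  apply: measurable_funM; first by meas.
  by apply: measurable_funM; [apply: (measurableT_comp (measurable_gdens _)); meas|meas].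
have i := intg_mass_tail t k0 (slow_norm h).
rewrite (_ : (\int[mu]_y _)%E = (\int[mu]_s ((t < s)%R%:R * (Fline s * `|rho s|))%:E)%E).
  by rewrite -EFin_Rint// ltry.
apply: eq_integral => s _.
transitivity (\int[mu]_u ((t < s)%R%:R * `|rho s| * (2 * (gdens 1 (2 * u - s) * (u <= 0)%R%:R)))%:E)%E.
  apply: eq_integral => u _ /=; congr EFin.
  rewrite !normrM !normr_nat (ger0_norm (gdens_ge0 _ _))//.
rewrite -EFin_Rint; last by apply: intgZ; exact: intg_half.
by rewrite RintZ; [rewrite -FlineE_half; congr EFin; ring|exact: intg_half].
Qed.

(** The inner integrals of the ordered pairing with weight 1 on u <= 0, kept
together for Fubini's theorem. *)
Definition halfpair rho t u := (u <= 0)%R%:R * (2 * \int[mu]_s ((t < s)%R%:R * (gdens 1 (2 * u - s) * rho s))).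

Lemma halfpairE k rho t u : slow k rho -> halfpair rho t u =
  \int[mu]_s ((t < s)%R%:R * rho s * (2 * (gdens 1 (2 * u - s) * (u <= 0)%R%:R))).
Proof.
move=> h; have i := intg_ltb t (intg_gauss (2 * u) h).
rewrite /halfpair mulrA -RintZ//; apply: eq_Rint => s; ring.
Qed.

Lemma Rint_halfpair k rho t : 0 <= k -> slow k rho ->
  intg (halfpair rho t) /\ \int[mu]_u halfpair rho t u = mass_tail rho t.
Proof.
move=> k0 h; have i2 := intg2_mass_tail t k0 h; have [i _] := Rint_fubini1 i2.
split; first by apply: eq_intg i => u /=; rewrite (halfpairE _ _ h).
under eq_Rint => u do rewrite (halfpairE _ _ h).
rewrite (Rint_fubini i2)/=; apply: eq_Rint => s.
by rewrite RintZ; [rewrite -FlineE_half; ring|exact: intg_half].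
Qed.

Lemma measurable_halfpair rho : measurable_fun setT rho ->
  measurable_fun setT (fun z : R * R => halfpair rho z.1 z.2).
Proof.
move=> mr; apply: measurable_funM; first by meas.
apply: measurable_funM; first by meas.
apply: (@measurable_Rint_param R _ (measurableTypeR R * measurableTypeR R)%type
  (fun z => (z.1.1 < z.2)%R%:R * (gdens 1 (2 * z.1.2 - z.2) * rho z.2))).
have m1 : measurable_fun setT (fun z : R * R * R => z.1.1).
  by apply: measurableT_comp.
have m2 : measurable_fun setT (fun z : R * R * R => z.1.2).
  by apply: measurableT_comp.
apply: measurable_funM; first by meas.
apply: measurable_funM; first by apply: (measurableT_comp (measurable_gdens _)); meas.
by apply: measurableT_comp.
Qed.

Lemma halfpair_norm k rho t u : slow k rho ->
  `|halfpair rho t u| <= halfpair (fun s => `|rho s|) t u.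
Proof.
move=> h; have i := intg_ltb t (intg_gauss (2 * u) h).
rewrite /halfpair !normrM !normr_nat ler_wpM2l// ler_wpM2l//.
apply: (le_trans (le_norm_Rint i)); rewrite le_eqVlt; apply/orP; left; apply/eqP.
by apply: eq_Rint => s; rewrite !normrM normr_nat (ger0_norm (gdens_ge0 _ _)).
Qed.

Lemma halfpair_ge0 rho t u : (forall s, 0 <= rho s) -> 0 <= halfpair rho t u.
Proof.
move=> r0; rewrite /halfpair mulr_ge0// mulr_ge0//; apply: Rintegral_ge0 => s _.
by rewrite mulr_ge0// mulr_ge0// gdens_ge0.
Qed.

(** In absolute value the u-integral of halfpair is the tail of |rho|, which
grows at most exponentially. *)
Lemma intg2_halfpair k rho x : 0 <= k -> slow k rho ->
  intg2 (fun z => gdens 1 (2 * x - z.1) * rho z.1 * halfpair rho z.1 z.2).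
Proof.
move=> k0 h; have mr := slow_meas h; have h' := slow_norm h; have mr' := slow_meas h'.
have mg : measurable_fun setT (fun z : R * R => gdens 1 (2 * x - z.1) : R).
  by apply: (measurableT_comp (measurable_gdens _)); meas.
have m1 : measurable_fun setT (fun z : R * R => rho z.1) by apply: measurableT_comp.
apply: (intg2_le (g := fun z => gdens 1 (2 * x - z.1) * `|rho z.1| * halfpair (fun s => `|rho s|) z.1 z.2)).
- by apply: measurable_funM; [meas|exact: measurable_halfpair].
- move=> z; rewrite normrM ler_pM//; last exact: halfpair_norm h.
  by rewrite normrM (ger0_norm (gdens_ge0 _ _)).
apply/intg2P.
  by apply: measurable_funM; [meas|exact: measurable_halfpair].
rewrite (_ : (\int[mu]_t _)%E = (\int[mu]_t (gdens 1 (2 * x - t) * (`|rho t| * mass_tail (fun s => `|rho s|) t))%:E)%E).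
  by rewrite -EFin_Rint ?ltry//; exact: intg_gauss (slow_mass_tail k0 h').
apply: eq_integral => t _ /=.
have [i e] := Rint_halfpair t k0 h'.
rewrite -e mulrA -RintZ// EFin_Rint; last exact: intgZ.
apply: eq_integral => u _; congr EFin; rewrite ger0_norm//.
by rewrite mulr_ge0 ?halfpair_ge0// mulr_ge0// gdens_ge0.
Qed.

(** Integrate in u first: the integral of the Gaussian centred at 2u is F. *)
Lemma Rint_ordered k rho x : 0 <= k -> slow k rho ->
  let ord u := (u <= 0)%R%:R * (2 * ordered (fun t => gdens 1 (2 * x - t) * rho t)
     (fun t => gdens 1 (2 * u - t) * rho t)) in
  intg ord /\ \int[mu]_u ord u = gauss_avg (fun t => rho t * mass_tail rho t) (2 * x).
Proof.
move=> k0 h ord; have mr := slow_meas h; have i2 := intg2_halfpair x k0 h.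
have E u : \int[mu]_t (gdens 1 (2 * x - t) * rho t * halfpair rho t u) = ord u.
  rewrite /ord /ordered mulrA -RintZ'.
    by apply: eq_Rint => t; rewrite /halfpair; ring.
  have mx : measurable_fun setT (fun t => gdens 1 (2 * x - t) : R).
    by apply: (measurableT_comp (measurable_gdens _)); meas.
  apply: measurable_funM; first by meas.
  apply: (@measurable_Rint_param R _ (measurableTypeR R)
    (fun z => (z.1 < z.2)%R%:R * (gdens 1 (2 * u - z.2) * rho z.2))).
  apply: measurable_funM; first by meas.
  apply: measurable_funM; first by apply: (measurableT_comp (measurable_gdens _)); meas.
  by apply: measurableT_comp.
have [i _] := Rint_fubini2 i2; split; first exact: eq_intg E i.
rewrite -(eq_Rint E) -(Rint_fubini i2); apply: eq_Rint => t /=.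
have [i' e] := Rint_halfpair t k0 h.
by rewrite RintZ// e mulrA.
Qed.

Lemma has_deriv_near f g x a : (\forall y \near x, f y = g y) -> has_deriv f x a -> has_deriv g x a.
Proof.
move=> fg h; have [d e] := h.
have fg' : \forall y \near x, g y = f y by near do symmetry.
split; first by apply: near_eq_derivable fg d; rewrite oner_neq0.
rewrite -e; apply: near_eq_derive => //; by rewrite oner_neq0.
Unshelve. all: by end_near. Qed.

(** The fundamental theorem of calculus for an integral from minus infinity. *)
Lemma has_deriv_cumul g x : intg g -> {for x, continuous g} ->
  has_deriv (fun y => \int[mu]_t (g t * (t <= y)%R%:R)) x (g x).
Proof.
move=> ig cg.
have E (y : R) : \int[mu]_t (g t * (t <= y)%R%:R) =
    \int[mu]_(t in [set` Interval (BInfty R true) (BRight y)]) g t.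
  rewrite [RHS]Rint_itv_indic; apply: eq_Rint => t; by rewrite indicE mem_setE in_itv/=.
have i1 : mu.-integrable [set` Interval (BInfty R true) (BRight (x + 1))] (EFin \o g).
  by apply: (integrableS measurableT) => //; exact: measurable_itv.
have x1 : x < x + 1 by rewrite ltrDl.
have [d e] := @continuous_FTC1 R g (BInfty R true) x (x + 1) x1 i1 (ltNyr _) cg.
rewrite (_ : (fun y => _) = (fun y => \int[mu]_(t in [set` Interval (BInfty R true) (BRight y)]) g t)).
  by split; [exact: d|rewrite -derive1E e].
by apply/funext.
Qed.

Lemma intg_segment f x : continuous f -> intg (fun u => (x < u)%R%:R * ((u <= 0)%R%:R * f u)).
Proof.
move=> cf; have mf : measurable_fun setT f by exact: continuous_measurable_fun.
have c : compact (`[x, 0]%classic : set R) by exact: segment_compact.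
have := @continuous_compact_integrable R f _ c _.
move=> /(_ (continuous_subspaceT cf)).
move=> i0; have mD : measurable (`[x, 0]%classic : set (measurableTypeR R)) by exact: measurable_itv.
have i := (@integrable_mkcond _ _ R mu _ _ mD).1 i0.
have i1 : intg (fun u => f u * ((x <= u)%R && (u <= 0)%R)%:R).
  apply: eq_integrable i => // u _ /=; rewrite !patchE mem_setE in_itv/=.
  by case: ifP => _; rewrite ?mulr1 ?mulr0.
apply: (intg_le _ _ (intg_norm i1)); first by meas.
move=> u; rewrite !normrM !normr_nat.
case: ltP => xu/=; last by rewrite mul0r mulr_ge0.
by rewrite (ltW xu) mul1r mulrC.
Qed.

(** The integral over [x, 0] is a constant minus a primitive, near x. *)
Lemma has_deriv_segment f x : continuous f -> x < 0 ->
  has_deriv (fun y => \int[mu]_u ((y < u)%R%:R * ((u <= 0)%R%:R * f u))) x (- f x).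
Proof.
move=> cf x0; set g := fun u => (x - 1 < u)%R%:R * ((u <= 0)%R%:R * f u).
have ig : intg g by exact: intg_segment.
have near_x : \forall y \near x, (x - 1 < y) && (y < 0).
  near=> y; apply/andP; split; near: y.
    by apply: lt_nbhsr; rewrite ltrBlDr ltrDl.
  by apply: lt_nbhsl.
have gx : g x = f x by rewrite /g (ltW x0) ltrBlDr ltrDl ltr01 !mul1r.
have fg : \forall y \near x, f y = g y.
  near=> y; have /andP[y1 y2] : (x - 1 < y) && (y < 0) by near: y.
  by rewrite /g y1 (ltW y2) !mul1r.
have cg : {for x, continuous g}.
  apply: (cvg_trans (near_eq_cvg fg)); rewrite gx; exact: cf.
apply: (@has_deriv_near (fun y => \int[mu]_t g t - \int[mu]_t (g t * (t <= y)%R%:R))).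
  near=> y; have /andP[y1 y2] : (x - 1 < y) && (y < 0) by near: y.
  rewrite -RintB//; last exact: intg_cut.
  apply: eq_Rint => u; rewrite /g.
  have [uy|uy] := leP u y; first by rewrite /=; ring.
  by rewrite (lt_trans y1 uy) /=; ring.
eapply has_deriv_eq; [apply: has_deriv_B; [exact: has_deriv_cst|exact: has_deriv_cumul]|].
by rewrite gx sub0r.
Unshelve. all: by end_near. Qed.

Lemma measurable_slice_fnorm2 rho x : measurable_fun setT rho ->
  measurable_fun setT (fun z : R * R => fnorm2 (gauss_slice rho (x + z.1)) z.2).
Proof.
move=> mr; have m1 : measurable_fun setT (fun z : R * R * R => z.1.1) by apply: measurableT_comp.
have m2 : measurable_fun setT (fun z : R * R * R => z.1.2) by apply: measurableT_comp.
have mg : measurable_fun setT (fun z : R * R * R => gauss_slice rho (x + z.1.1) z.2).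
  apply: measurable_funM; first by meas.
  apply: measurable_funM; first by apply: (measurableT_comp (measurable_gdens _)); meas.
  by apply: measurableT_comp.
apply: measurable_funD; apply: meas_pow.
  apply: (@measurable_Rint_param R _ (measurableTypeR R * measurableTypeR R)%type
   (fun z => gauss_slice rho (x + z.1.1) z.2 * cos (z.1.2 * z.2))).
  by meas.
apply: (@measurable_Rint_param R _ (measurableTypeR R * measurableTypeR R)%type
   (fun z => gauss_slice rho (x + z.1.1) z.2 * sin (z.1.2 * z.2))).
by meas.
Qed.

(** The numerator of the Berezin kernel B(z, w), with z = x + iy and w = u + i(y - s). *)
Definition berezin_slice rho x u s :=
  expR (- (x - u) ^+ 2) * ((2 * pi)^-1 * fnorm2 (gauss_slice rho (x + u)) s).

Lemma measurable_berezin_slice rho x : measurable_fun setT rho ->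
  measurable_fun setT (fun z : R * R => berezin_slice rho x z.1 z.2).
Proof.
move=> mr; apply: measurable_funM; first by meas.
by apply: measurable_funM; [meas|exact: measurable_slice_fnorm2].
Qed.

Lemma berezin_slice_even rho x u s k : slow k rho -> berezin_slice rho x u (- s) = berezin_slice rho x u s.
Proof.
move=> h; have i := intg_gauss_slice (x + u) h; have mi := intg_meas i.
rewrite /berezin_slice /fnorm2; congr (_ * (_ * (_ + _))).
  by congr (_ ^+ 2); apply: eq_Rint => t; rewrite mulNr cosN.
rewrite -[RHS]sqrrN -mulN1r /sinT -RintZ'; last by meas.
by congr (_ ^+ 2); apply: eq_Rint => t; rewrite mulNr sinN mulrN mulN1r.
Qed.

(** The sign of x - u decides which of the two orders of the pairing appears; the
two cases differ by the full product of the averages. *)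
Lemma Rint_berezin_slice k rho x u : slow k rho -> x != u ->
  intg (fun s => berezin_slice rho x u s * ((x - u) / ((x - u) ^+ 2 + s ^+ 2))) /\
  \int[mu]_s (berezin_slice rho x u s * ((x - u) / ((x - u) ^+ 2 + s ^+ 2))) =
  pi * (2 * (ordered (fun t => gdens 1 (2 * x - t) * rho t) (fun t => gdens 1 (2 * u - t) * rho t)
    - (x < u)%R%:R * (gauss_avg rho (2 * x) * gauss_avg rho (2 * u)))).
Proof.
move=> h xu; have ig := intg_gauss_slice (x + u) h.
have a0 : x - u != 0 by rewrite subr_eq0.
have a1 : 0 < `|x - u| by rewrite normr_gt0.
have [i e] := Rint_lorentz a1 ig.
have E s : expR (- (x - u) ^+ 2) * (2 * pi)^-1 * Num.sg (x - u) *
   (`|x - u| / (`|x - u| ^+ 2 + s ^+ 2) * fnorm2 (gauss_slice rho (x + u)) s) =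
   berezin_slice rho x u s * ((x - u) / ((x - u) ^+ 2 + s ^+ 2)).
  rewrite /berezin_slice real_normK ?num_real//.
  have : Num.sg (x - u) * `|x - u| = x - u by rewrite -numEsg.
  move: (((x - u) ^+ 2 + s ^+ 2)^-1) (expR _) (Num.sg (x - u)) (`|x - u|) => D b c n <-.
  ring.
split; first by apply: eq_intg E _; exact: intgZ.
rewrite -(eq_Rint E) RintZ// e.
have := Rint_slice_kernel h xu.
set L := (\int[mu]_t _) => Le.
transitivity (pi * Num.sg (x - u) * (expR (- (x - u) ^+ 2) * ((2 * pi)^-1 * L))); first by ring.
rewrite Le; have : Num.sg (x - u) * Num.sg (x - u) = 1.
  by rewrite -expr2 sqr_sg a0.
move: (ordered _ _) (_ * (_ * _)) (Num.sg _) => A B C C2.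
transitivity (pi * (C * C) * (2 * (A - B))); first by ring.
by rewrite C2 mulr1.
Qed.

(** Real part of the Cauchy transform, as an iterated integral. The vertical line
through z itself is negligible. *)
Lemma Rint_cauchy k rho x : 0 <= k -> slow k rho ->
  \int[mu]_u ((u <= 0)%R%:R * \int[mu]_s (berezin_slice rho x u s * ((x - u) / ((x - u) ^+ 2 + s ^+ 2)))) =
  pi * (gauss_avg (fun t => rho t * mass_tail rho t) (2 * x) -
    gauss_avg rho (2 * x) * \int[mu]_u ((x < u)%R%:R * ((u <= 0)%R%:R * (2 * gauss_avg rho (2 * u))))).
Proof.
move=> k0 h; have mr := slow_meas h.
have [i1 <-] := Rint_ordered x k0 h.
have cP : continuous (fun u => 2 * gauss_avg rho (2 * u)).
  move=> u; apply: cvgMr.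
  apply: (@continuous_comp _ _ _ (fun u => 2 * u) (gauss_avg rho)).
    exact: mulrl_continuous.
  exact: has_deriv_cont (has_deriv_gauss_avg _ h).
have i2 := intg_segment x cP.
rewrite -RintZ// -RintB//; last exact: intgZ.
rewrite -RintZ; last by apply: intgB => //; exact: intgZ.
apply: Rint_ae.
- apply: measurable_funM; first by meas.
  apply: (@measurable_Rint_param R _ (measurableTypeR R)
    (fun z => berezin_slice rho x z.1 z.2 * ((x - z.1) / ((x - z.1) ^+ 2 + z.2 ^+ 2)))).
  by apply: measurable_funM; [exact: measurable_berezin_slice|meas].
- have m1 := intg_meas i1; have m2 := intg_meas i2.
  by apply: measurable_funM; [meas|apply: measurable_funB => //; meas].
have := @ae_neq R x; apply: aeS => u; rewrite eq_sym => xu.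
have [_ ->] := Rint_berezin_slice h xu.
ring.
Qed.

Lemma Rint_cauchy_im k rho x u : slow k rho ->
  \int[mu]_s (berezin_slice rho x u s * (s / ((x - u) ^+ 2 + s ^+ 2))) = 0.
Proof.
move=> h; have ig := intg_gauss_slice (x + u) h; have me := measurable_fnorm2 ig.
apply: Rint_odd.
  by rewrite /berezin_slice; meas.
by move=> s; rewrite (berezin_slice_even _ _ _ h) sqrrN mulNr mulrN.
Qed.

End cauchy.

(** * Windows solving the integrated equation *)

Section interval_windows.
Context {R : realType}.
Notation mu := (@lebesgue_measure R).
Implicit Types (f g h rho : R -> R) (a c k s t x : R).

Lemma aeS2 (P Q S : R -> Prop) : (forall x, P x -> Q x -> S x) ->
  {ae mu, forall x, P x} -> {ae mu, forall x, Q x} -> {ae mu, forall x, S x}.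
Proof.
move=> H p q.
have F : Filter (nbhs (almost_everywhere mu)) by exact: ae_filter_ringOfSetsType.
exact: filterS2 p q.
Qed.

(** If h has slope one off its zero set, then between two zeros it has no
positive maximum, as h would increase to the right of it, and no negative
minimum, as h would be smaller to the left of it. *)
Lemma slope_one_zeros h : continuous h ->
  (forall a b, a < b -> (forall t, a < t < b -> h t != 0) -> h b - h a = b - a) ->
  is_interval [set t | h t = 0].
Proof.
move=> ch H p q hp hq t /andP[pt tq] /=.
have cw (a b : R) : {within `[a, b], continuous h} by exact: continuous_subspaceT.
have pq : p <= q by exact: le_trans pt tq.
have [m mI hm] := EVT_max pq (cw p q); have [n nI hn] := EVT_min pq (cw p q).
have tI : t \in `[p, q]%R by rewrite in_itv/= pt.
have m0 : h m <= 0.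
  rewrite leNgt; apply/negP => hm0.
  have mq : m < q.
    rewrite lt_neqAle; move: mI; rewrite in_itv/= => /andP[_ ->]; rewrite andbT.
    by apply/eqP => e; move: hm0; rewrite e hq ltxx.
  have /nbhs_ballP[e /= e0 He] : \forall y \near m, 0 < h y.
    exact: (cvgr_gt _ (ch m) _ hm0).
  (* a point to the right of m at which h exceeds its maximum h m *)
  pose y := Num.min q (m + e / 2).
  have my : m < y by rewrite lt_min mq ltrDl divr_gt0.
  have : h y - h m = y - m.
    apply: H => // z /andP[mz zy]; rewrite gt_eqF//; apply: He.
    rewrite /ball/= ltr0_norm ?subr_lt0// opprB.
    have : z < m + e / 2 by apply: (lt_le_trans zy); rewrite ge_min lexx orbT.
    by move: e0; lra.
  have : h y <= h m.
    apply: hm; rewrite in_itv/= ge_min lexx/= andbT.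
    by move: mI; rewrite in_itv/= => /andP[pm _]; apply: (le_trans pm); exact: ltW.
  by move: my; lra.
have n0 : 0 <= h n.
  rewrite leNgt; apply/negP => hn0.
  have pn : p < n.
    rewrite lt_neqAle eq_sym; move: nI; rewrite in_itv/= => /andP[-> _]; rewrite andbT.
    by apply/eqP => e; move: hn0; rewrite e hp ltxx.
  have /nbhs_ballP[e /= e0 He] : \forall y \near n, h y < 0.
    exact: (cvgr_lt _ (ch n) _ hn0).
  (* a point to the left of n at which h is below its minimum h n *)
  pose y := Num.max p (n - e / 2).
  have yn : y < n by rewrite gt_max pn/= ltrBlDr ltrDl divr_gt0.
  have : h n - h y = n - y.
    apply: H => // z /andP[yz zn]; rewrite lt_eqF//; apply: He.
    rewrite /ball/= gtr0_norm ?subr_gt0//.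
    have : n - e / 2 < z by apply: (le_lt_trans _ yz); rewrite le_max lexx orbT.
    by move: e0; lra.
  have : h n <= h y.
    apply: hn; rewrite in_itv/= le_max lexx/=.
    by move: nI; rewrite in_itv/= => /andP[_ nq]; apply: (le_trans _ nq); exact: ltW.
  by move: yn; lra.
apply/eqP; rewrite eq_le (le_trans (hm t tI) m0)/=.
exact: le_trans n0 (hn t tI).
Qed.

Lemma mass_tail_cumul k rho m t : 0 <= k -> slow k rho -> m <= t ->
  mass_tail rho t = \int[mu]_s ((m < s)%R%:R * (Fline s * rho s)) -
    \int[mu]_s ((m < s)%R%:R * (Fline s * rho s) * (s <= t)%R%:R).
Proof.
move=> k0 h mt; have i := intg_mass_tail m k0 h.
rewrite -RintB//; last exact: intg_cut.
apply: eq_Rint => s; have [st|st] := leP s t; first by rewrite /=; ring.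
by rewrite (le_lt_trans mt st) /=; ring.
Qed.

Lemma cont_mass_tail k rho : 0 <= k -> slow k rho -> continuous (mass_tail rho).
Proof.
move=> k0 h t; set m := t - 1.
set c0 := \int[mu]_s ((m < s)%R%:R * (Fline s * rho s)).
set g := fun u => c0 - \int[mu]_s ((m < s)%R%:R * (Fline s * rho s) * (s <= u)%R%:R).
have gE : \forall u \near t, g u = mass_tail rho u.
  near=> u; rewrite /g (mass_tail_cumul k0 h (m := m))//.
  by apply: ltW; near: u; apply: lt_nbhsr; rewrite /m ltrBlDr ltrDl.
apply: (cvg_trans (near_eq_cvg gE)).
rewrite -(nbhs_singleton gE).
apply: cvgB; first exact: cvg_cst.
exact: (cont_cumul (intg_mass_tail m k0 h)).
Unshelve. all: by end_near. Qed.

(** Off the zero set Z of tail + id - c the window vanishes, so that the tail is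
constant and tail + id has slope one; hence Z is an interval. On Z the tail is
c - t, so that its derivative -F rho is -1 almost everywhere. *)
Lemma mass_tail_interval k rho c : 0 <= k -> slow k rho ->
  {ae mu, forall t, rho t * (mass_tail rho t + t - c) = 0} ->
  exists I : interval R, {ae mu, forall t, rho t = \1_[set` I] t / Fline t}.
Proof.
move=> k0 h H; have mr := slow_meas h; have mF := @measurable_Fline R.
set d := fun t => mass_tail rho t + t - c.
have cd : continuous d.
  move=> t; apply: cvgB; last exact: cvg_cst.
  by apply: cvgD; [exact: (cont_mass_tail k0 h)|exact: cvg_id].
have slope a b : a < b -> (forall t, a < t < b -> d t != 0) -> d b - d a = b - a.
  move=> ab hab; suff : mass_tail rho a = mass_tail rho b by rewrite /d => ->; ring.
  apply: Rint_ae; [by meas|by meas|].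
  move: H (@ae_neq R b); apply: aeS2 => t rd tb.
  have [bt|tb'] := ltP b t; first by rewrite (lt_trans ab bt).
  have [at'|ta] := ltP a t; last by rewrite !mul0r.
  have /hab d0 : a < t < b by rewrite at' lt_neqAle tb.
  move/eqP: rd; rewrite mulf_eq0 -/(d t) (negbTE d0) orbF => /eqP ->.
  by rewrite mulr0 mul0r mulr0.
pose Z := [set t | d t = 0].
have iZ : is_interval Z by exact: slope_one_zeros.
have ZE : Z = [set` Rhull Z] by apply/is_intervalP.
exists (Rhull Z); rewrite -ZE.
(* the possible end points of Z are two points, which are negligible *)
have end1 : exists m, forall t, Z t -> (forall s, Z s -> s <= t) -> t = m.
  have [[m [Zm mm]]|n] := pselect (exists m, Z m /\ forall s, Z s -> s <= m).
    by exists m => t Zt ht; apply/eqP; rewrite eq_le mm//= ht.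
  by exists 0 => t Zt ht; exfalso; apply: n; exists t.
have end2 : exists m, forall t, Z t -> (forall s, Z s -> t <= s) -> t = m.
  have [[m [Zm mm]]|n] := pselect (exists m, Z m /\ forall s, Z s -> m <= s).
    by exists m => t Zt ht; apply/eqP; rewrite eq_le mm//= ht.
  by exists 0 => t Zt ht; exfalso; apply: n; exists t.
have [m1 h1] := end1; have [m2 h2] := end2.
have leb : {ae mu, forall t, forall n : nat,
    convol (fun s => (- n%:R < s)%R%:R * (Fline s * rho s)) (box j.+1%:R^-1) t @[j --> \oo] -->
    (- n%:R < t)%R%:R * (Fline t * rho t)}.
  by apply/ae_foralln => n; apply: conv_box_ae; exact: intg_mass_tail h.
move: (aeS2 (fun _ p q => conj p q) H leb) (aeS2 (fun _ p q => conj p q) (@ae_neq R m1) (@ae_neq R m2)).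
apply: aeS2 => t [rd lt_] [t1 t2].
rewrite indicE; have [tZ|tZ] := boolP (t \in Z); last first.
  move: rd => /eqP; rewrite mulf_eq0 => /orP[/eqP ->|]; first by rewrite mul0r.
  by move=> /eqP e; move: tZ; rewrite notin_setE.
rewrite inE in tZ.
have [q [Zq tq]] : exists q, Z q /\ t < q.
  apply: contrapT => n; move/eqP: t1; apply; apply: h1 => // s Zs.
  by rewrite leNgt; apply/negP => ts; apply: n; exists s.
have [p [Zp pt]] : exists p, Z p /\ p < t.
  apply: contrapT => n; move/eqP: t2; apply; apply: h2 => // s Zs.
  by rewrite leNgt; apply/negP => ts; apply: n; exists s.
(* the tail is integrable only on half-lines bounded below; -N lies below the interval around t *)
pose N := `|Num.ceil (- p)|%N.
have Np : - N%:R <= p.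
  rewrite lerNl /N natr_absz; apply: (le_trans (ceil_ge _)); rewrite ler_int; exact: ler_norm.
have lim1 := lt_ N.
have : convol (fun s => (- N%:R < s)%R%:R * (Fline s * rho s)) (box j.+1%:R^-1) t @[j --> \oo] --> (1 : R).
  apply: cvg_near_cst; near=> j.
  have j0 : 0 < j.+1%:R^-1 :> R by rewrite invr_gt0.
  have jp : j.+1%:R^-1 < t - p.
    by near: j; apply: (cvgr_lt _ (@cvg_harmonic R)); rewrite subr_gt0.
  have jq : j.+1%:R^-1 < q - t.
    by near: j; apply: (cvgr_lt _ (@cvg_harmonic R)); rewrite subr_gt0.
  move: j0 jp jq; set e := j.+1%:R^-1 => e0 ep eq.
  have i := intg_mass_tail (- N%:R) k0 h.
  rewrite conv_box//.
  have Zl : Z (t - e) by apply: (iZ p q) => //; lra.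
  have Zr : Z (t + e) by apply: (iZ p q) => //; lra.
  have /(mass_tail_cumul k0 h) eA : - N%:R <= t + e by lra.
  have /(mass_tail_cumul k0 h) eB : - N%:R <= t - e by lra.
  move: Zl Zr; rewrite /Z /d/= eA eB => Zl Zr.
  have e1 : (2 * e)^-1 * (2 * e) = 1 by rewrite mulVf// gt_eqF// mulr_gt0.
  by rewrite -[RHS]e1; congr (_ * _); lra.
move=> /cvg_unique /(_ lim1) => /(_ (@Rhausdorff R)).
rewrite (le_lt_trans Np pt) mul1r => e; rewrite e mulrAC divff ?mul1r//.
by rewrite gt_eqF// Fline_gt0.
Unshelve. all: by end_near. Qed.

Lemma gauss_avg_gt0 f x : measurable_fun setT f -> (forall t, 0 <= f t) ->
  intg (fun t => gdens 1 (x - t) * f t) -> ~ {ae mu, forall t, f t = 0} -> 0 < gauss_avg f x.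
Proof.
move=> mf f0 i n; rewrite lt_neqAle; apply/andP; split; last first.
  by apply: Rintegral_ge0 => t _; rewrite mulr_ge0 ?gdens_ge0.
apply/eqP => e; apply: n.
have : (\int[mu]_t `|(gdens 1 (x - t) * f t)%:E| = 0)%E.
  under eq_integral => t _.
    rewrite abse_EFin ger0_norm; last by rewrite mulr_ge0 ?gdens_ge0.
    over.
  by rewrite -EFin_Rint// -/(gauss_avg f x) -e.
move=> /ae_eq_integral_abs; move=> /(_ measurableT) /=.
move=> /(_ (measurable_int _ i)).
apply: aeS => t /= /(_ I) /eqP; rewrite eqe mulf_eq0 => /orP[|/eqP//].
by rewrite gt_eqF// gdens_gt0.
Qed.

Lemma ae_indic0 (E : set R) : measurable E -> {ae mu, forall t, \1_E t / Fline t = 0} ->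
  mu E = 0%E.
Proof.
move=> mE [N [mN N0 sN]]; apply/eqP; rewrite eq_le measure_ge0 andbT -N0.
apply: le_measure; rewrite ?inE// => t Et; apply: sN => /= /eqP.
by rewrite indicE mem_set// mul1r invr_eq0 gt_eqF// Fline_gt0.
Qed.

(** On an unbounded interval the function exp(-k|t|)/F(t) is bounded below by a
positive constant, by Chernoff's bound. *)
Lemma slow_divF_bounded k (I : interval R) : 0 <= k -> slow k (fun t => \1_[set` I] t / Fline t) ->
  has_ubound [set` I].
Proof.
move=> k0 h; apply: contrapT => nb.
have [x0 Ix0] : exists x, [set` I] x.
  by apply: contrapT => n; apply: nb; exists 0 => y Iy; exfalso; apply: n; exists y.
have iI : is_interval [set` I] by exact: interval_is_interval.
(* an interval with no upper bound contains a half-line ]a, +oo[ with a >= 0 *)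
pose a := Num.max x0 0.
have Ia t : a < t -> [set` I] t.
  move=> at'; have [y [Iy ty]] : exists y, [set` I] y /\ t < y.
    apply: contrapT => n; apply: nb; exists t => y Iy; rewrite leNgt; apply/negP => ty.
    by apply: n; exists y.
  apply: (iI x0 y) => //; rewrite (ltW ty) andbT ltW//.
  by apply: (le_lt_trans _ at'); rewrite le_max lexx.
have i : intg (fun t => expR (- (k ^+ 2 / 2)) * (a < t)%R%:R).
  apply: (@intg_le _ _ _ _ _ h); first by meas.
  move=> t; rewrite normrM (ger0_norm (expR_ge0 _)) normr_nat indicE.
  have [at'|ta] := ltP a t; last first.
    by rewrite mulr0 mulr_ge0 ?expR_ge0// divr_ge0// Fline_ge0.
  rewrite mem_set ?mul1r ?mulr1; last exact: Ia.
  have t0 : 0 < t by apply: (le_lt_trans _ at'); rewrite le_max lexx orbT.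
  rewrite ler_pdivlMr ?Fline_gt0//; apply: (le_trans (ler_wpM2l (expR_ge0 _) (Fline_ub t k0))).
  by rewrite -expRD ler_expR gtr0_norm//; lra.
have := intgZ (expR (k ^+ 2 / 2)) i.
move=> /intgP[_]; apply/negP; rewrite -leNgt leye_eq; apply/eqP.
transitivity (\int[mu]_(x in `]a, +oo[%classic) 1)%E.
  rewrite [RHS]integral_mkcond; apply: eq_integral => t _.
  rewrite patchE mem_setE in_itv/= andbT mulrA -expRD subrr expR0 mul1r.
  by case: ltP => _; rewrite ?normr1 ?normr0.
rewrite integral_cst//= mul1e.
by rewrite lebesgue_measure_itv/= ltry.
Qed.

(** F rho is the indicator of I, so that the tail is the length of what is left
of I on the right of t. *)
Lemma mass_tail_divF k (I : interval R) t : slow k (fun t => \1_[set` I] t / Fline t) ->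
  has_ubound [set` I] -> [set` I] t ->
  mass_tail (fun t => \1_[set` I] t / Fline t) t = sup [set` I] - t.
Proof.
move=> h ub It; set c := sup _.
have mI : measurable ([set` I] : set (measurableTypeR R)) by exact: measurable_itv.
have tc : t <= c by exact: ub_le_sup.
rewrite -(Rint_itv tc) /mass_tail; apply: Rint_ae.
- have mr := slow_meas h; have mF := @measurable_Fline R; by meas.
- by meas.
move: (@ae_neq R t) (@ae_neq R c); apply: aeS2 => s st sc.
rewrite [Fline s * _]mulrC divfK ?gt_eqF ?Fline_gt0// indicE [t <= s]le_eqVlt [t == s]eq_sym (negbTE st)/=.
have [ts|ts] := ltP t s; rewrite ?mul0r// !mul1r.
have [sc'|cs] := ltP s c.
  have [e Ie se] : exists2 e, [set` I] e & c - (c - s) < e.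
    by apply: sup_adherent; [rewrite subr_gt0|split => //; exists t].
  rewrite mem_set//; have iI := @interval_is_interval _ I.
  by apply: (iI t e) => //; rewrite (ltW ts) ltW//; lra.
rewrite memNset// => Is.
have : s <= c by exact: ub_le_sup.
by rewrite le_eqVlt (negbTE sc) ltNge cs.
Qed.

(** By uniqueness of Gaussian averages, rho (tail + id - c) = 0 almost everywhere.
The interval is not negligible since otherwise the average of rho would be 0. *)
Lemma ward_window k rho : 0 <= k -> slow k rho -> (forall x, x < 0 -> 0 < gauss_avg rho x) ->
  (exists c, forall x, x < 0 ->
    gauss_avg (fun t => rho t * (mass_tail rho t + t)) x = c * gauss_avg rho x) ->
  exists I : interval R, (0 < mu [set` I])%E /\
    {ae mu, forall t, rho t = \1_[set` I] t / Fline t}.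
Proof.
move=> k0 h P0 [c Hc]; have mr := slow_meas h.
have sT : slow (k + 2 * k + 1) (fun t => rho t * (mass_tail rho t + t)).
  apply: (@eq_intg _ (fun t => expR (- (k + 2 * k + 1) * `|t|) * (rho t * mass_tail rho t + t * rho t))).
    by move=> t; ring.
  apply: slowD.
    by apply: slow_mon (slow_mass_tail k0 h); lra.
  by apply: slow_mon (slow_id_mul h); lra.
have s1 : slow (k + 2 * k + 1) rho by apply: slow_mon h; lra.
have s2 : slow (k + 2 * k + 1) (fun t => rho t * (mass_tail rho t + t) + (- c) * rho t).
  by apply: slowD => //; exact: slowZ.
have H : {ae mu, forall t, rho t * (mass_tail rho t + t) + (- c) * rho t = 0}.
  apply: (gauss_avg_eq0 s2) => x x0; rewrite /gauss_avg.
  under eq_Rint => t do rewrite mulrDr [_ * (- c * _)]mulrCA.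
  rewrite RintD ?RintZ; [|exact: intg_gauss h|exact: intg_gauss sT|].
    by rewrite -!/(gauss_avg _ _) Hc//; ring.
  by apply: intgZ; exact: intg_gauss h.
have [|I HI] := @mass_tail_interval k rho c k0 h.
  by move: H; apply: aeS => t <-; ring.
exists I; split => //; rewrite lt_neqAle measure_ge0 andbT; apply/eqP => m0.
have mI : measurable ([set` I] : set (measurableTypeR R)) by exact: measurable_itv.
have mi : mu.-negligible [set` I] by exists [set` I]; split.
have r0 : {ae mu, forall t, rho t = 0}.
  have nI : {ae mu, forall t, ~ [set` I] t} by apply: negligibleS mi => t /= /contrapT.
  move: HI nI; apply: aeS2 => t -> It.
  by rewrite indicE memNset// mul0r.
have := P0 (-1); rewrite (@gauss_avg_ae _ rho (fun=> 0) (-1))//.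
rewrite /gauss_avg; under eq_Rint => t do rewrite mulr0.
by rewrite Rint_zero ltxx => /(_ (ltrN10 _)).
Qed.

(** The constant is the right end of I; it is finite, so that 1/F is bounded on I. *)
Lemma ward_window_conv k (I : interval R) : 0 <= k -> (0 < mu [set` I])%E ->
  let rho t := \1_[set` I] t / Fline t in slow k rho ->
  [/\ forall x, 0 < gauss_avg rho x,
    exists M, forall t, `|rho t| <= M &
    exists c, forall x, gauss_avg (fun t => rho t * (mass_tail rho t + t)) x = c * gauss_avg rho x].
Proof.
move=> k0 I0 rho h; have mr := slow_meas h.
have mI : measurable ([set` I] : set (measurableTypeR R)) by exact: measurable_itv.
have ub := slow_divF_bounded k0 h.
split.
- move=> x; apply: gauss_avg_gt0 => //.
  + by move=> t; rewrite divr_ge0// Fline_ge0.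
  + exact: intg_gauss h.
  + by move=> /(ae_indic0 mI) e; move: I0; rewrite e ltxx.
- have [M HM] := ub; exists ((gdens 1 (Num.max M 0 + 1))^-1) => t.
  have g0 : 0 < gdens 1 (Num.max M 0 + 1) :> R by exact: gdens_gt0.
  rewrite /rho normrM normfV (ger0_norm (Fline_ge0 _)) indicE normr_nat.
  have [It|It] := boolP (t \in [set` I]); last by rewrite mul0r invr_ge0 ltW.
  rewrite mul1r lef_pV2 ?posrE ?Fline_gt0//; apply: (le_trans _ (Fline_lb t)).
  apply: gdens_anti; rewrite !ger0_norm ?addr_ge0 ?le_max ?lexx ?orbT// lerD2r.
  rewrite inE in It; rewrite ge_max le_max (HM t)//= le_max lexx orbT.
  by [].
- exists (sup [set` I]) => x; rewrite /gauss_avg -RintZ; last exact: intg_gauss h.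
  apply: eq_Rint => t; have [It|It] := pselect ([set` I] t).
    by rewrite (mass_tail_divF h)// subrK; ring.
  by rewrite /rho indicE memNset// !mul0r !mulr0.
Qed.

End interval_windows.

(** * Integrability of the Cauchy transform *)

Section integrability.
Context {R : realType}.
Notation mu := (@lebesgue_measure R).
Implicit Types (rho : R -> R) (f g : R * R -> R) (a b k s t x u M : R).

(** The function s^(-1/2), through the logarithm. *)
Definition rsqrt s := expR (- (ln s / 2)).
Definition rsqrt01 s := (0 < `|s|)%R%:R * (`|s| <= 1)%R%:R * rsqrt `|s|.

Lemma meas_ln d (T : measurableType d) (f : T -> R) :
  measurable_fun setT f -> measurable_fun setT (fun y => ln (f y)).
Proof. by move=> mf; apply: measurableT_comp => //; exact: measurable_ln. Qed.

Lemma measurable_rsqrt : measurable_fun setT (rsqrt : R -> R).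
Proof.
apply: meas_exp; apply: meas_N; apply: measurable_funM; last by meas.
by apply: meas_ln.
Qed.

Lemma measurable_rsqrt01 : measurable_fun setT rsqrt01.
Proof.
apply: measurable_funM; last by apply: (measurableT_comp measurable_rsqrt); meas.
by meas.
Qed.

Lemma rsqrt01_ge0 s : 0 <= rsqrt01 s.
Proof. by rewrite !mulr_ge0// expR_ge0. Qed.

Lemma has_deriv_2sqrt s : 0 < s -> has_deriv (fun t => 2 * expR (ln t / 2)) s (rsqrt s).
Proof.
move=> s0; eapply has_deriv_eq.
  apply: has_deriv_M; first exact: has_deriv_cst.
  apply: has_deriv_exp; apply: has_deriv_M; last exact: has_deriv_cst.
  apply: (@has_deriv_ln R id s 1) => //; exact: has_deriv_id.
rewrite /= mul0r add0r mulr0 addr0 /rsqrt expRN.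
have e : s = expR (ln s / 2) ^+ 2 by rewrite expr2 -expRD -splitr lnK.
have := expR_gt0 (ln s / 2); move: (expR _) e => c -> c0.
by field; rewrite gt_eqF.
Qed.

(** The primitive is 2 s^(1/2). *)
Lemma int_rsqrt (b : R) : 0 < b -> b < 1 ->
  (\int[mu]_(x in `[b, 1%R]) (rsqrt x)%:E = (2 - 2 * expR (ln b / 2))%:E)%E.
Proof.
move=> b0 b1.
have pos x : x \in `[b, 1]%R -> 0 < x.
  by rewrite in_itv/= => /andP[bx _]; exact: lt_le_trans bx.
have cr x : 0 < x -> {for x, continuous rsqrt}.
  move=> x0; apply: (@continuous_comp _ _ _ (fun s => - (ln s / 2)) expR); last exact: continuous_expR.
  by apply: cvgN; apply: cvgMl; exact: continuous_ln.
rewrite (@continuous_FTC2 _ _ (fun t => 2 * expR (ln t / 2)))//.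
- by rewrite ln1 mul0r expR0 mulr1 EFinB.
- apply: continuous_in_subspaceT => x; rewrite inE/= => xI; apply: cr; exact: pos.
- split.
  + move=> x xI; apply: has_deriv_derivable (has_deriv_2sqrt _); apply: pos.
    by apply: subset_itv_oo_cc xI.
  + by apply: cvg_at_right_filter; apply: has_deriv_cont (has_deriv_2sqrt _).
  + by apply: cvg_at_left_filter; apply: has_deriv_cont (has_deriv_2sqrt _).
- move=> x xI; apply: has_deriv_derive1 (has_deriv_2sqrt _); apply: pos.
  by apply: subset_itv_oo_cc xI.
Qed.

Lemma intg_rsqrt01 : intg rsqrt01.
Proof.
pose h s := (0 < s)%R%:R * (s <= 1)%R%:R * rsqrt s.
have mh : measurable_fun setT h.
  apply: measurable_funM; last exact: measurable_rsqrt.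
  by meas.
have h0 s : 0 <= h s by rewrite !mulr_ge0// expR_ge0.
have ih : intg h.
  apply: intg_ge0_lty => //; apply: (@le_lt_trans _ _ 2%:E); last by rewrite ltry.
  apply: (@fatou_bound _ (fun n s => (n.+2%:R^-1 <= s)%R%:R * (s <= 1)%R%:R * rsqrt s)) => //.
  - move=> n; apply: measurable_funM; last exact: measurable_rsqrt.
    by meas.
  - by move=> n s; rewrite !mulr_ge0// expR_ge0.
  - apply: nearW => s; rewrite /h; apply: cvgMl; apply: cvgMl; apply: cvg_near_cst.
    have [s0|s0] := ltP 0 s.
      near=> n; rewrite (_ : (_ <= s) = true)//.
      apply: ltW; apply: (@lt_trans _ _ n.+1%:R^-1).
        by rewrite ltf_pV2 ?posrE// ltr_nat.
      by near: n; apply: (cvgr_lt _ (@cvg_harmonic R)).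
    near=> n; rewrite /=; rewrite (_ : (_ <= s) = false)//.
    by apply/negbTE; rewrite -ltNge (le_lt_trans s0)// invr_gt0.
  - move=> n; rewrite (_ : (\int[mu]_x _)%E = (\int[mu]_(x in `[(n.+2%:R^-1)%R, 1%R]) (rsqrt x)%:E)%E).
      rewrite int_rsqrt// ?invr_gt0//; last by rewrite invf_lt1// ltr1n.
      by rewrite lee_fin gerBl mulr_ge0// expR_ge0.
    rewrite [RHS]integral_mkcond; apply: eq_integral => s _.
    rewrite patchE mem_setE in_itv/=; case: (_ <= s); case: (s <= 1);
      by rewrite /= ?mul1r ?mul0r ?mulr0 ?mul0r.
apply: (@intg_le _ _ (fun s => h s + h (0 - s))); first exact: measurable_rsqrt01.
  move=> s; rewrite (ger0_norm (rsqrt01_ge0 _)) /rsqrt01 /h sub0r.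
  have [s0|s0] := ltP 0 s.
    by rewrite (gtr0_norm s0) s0 lerDl !mulr_ge0 ?expR_ge0.
  by rewrite (ler0_norm s0) !mul0r add0r.
by apply: intgD => //; exact: intg_reflect.
Unshelve. all: by end_near. Qed.

(** Near the origin a^2 + s^2 >= 2|a s| bounds the kernel by |a s|^(-1/2), a product
of integrable functions of a and of s; away from it 1 is a bound. *)
Lemma weight_le (c a s : R) : a != 0 -> s != 0 -> `|c| <= `|a| \/ `|c| <= `|s| ->
  `|c / (a ^+ 2 + s ^+ 2)| <= 1 + rsqrt01 a * rsqrt01 s.
Proof.
move=> a0 s0 H.
have D0 : 0 < a ^+ 2 + s ^+ 2 by rewrite ltr_wpDr ?sqr_ge0// exprn_even_gt0.
have c2 : `|c| ^+ 2 <= a ^+ 2 + s ^+ 2.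
  rewrite -(real_normK (num_real a)) -(real_normK (num_real s)).
  by case: H => H; [rewrite ler_wpDr ?sqr_ge0// lerXn2r ?nnegrE|rewrite ler_wpDl ?sqr_ge0// lerXn2r ?nnegrE].
rewrite normrM normfV (gtr0_norm D0) ler_pdivrMr//.
have c0 : 0 <= `|c| by [].
have ss0 : 0 <= rsqrt01 a * rsqrt01 s by rewrite mulr_ge0 ?rsqrt01_ge0.
(* with |a| = q^2 and |s| = p^2, the case of a point near 0 is q^3 p <= q^4 + p^4 or q p^3 <= q^4 + p^4 *)
have [D1|D1] := leP 1 (a ^+ 2 + s ^+ 2).
  apply: (@le_trans _ _ (a ^+ 2 + s ^+ 2)).
    by move: D1 c2 c0; move: (a ^+ 2 + s ^+ 2) `|c| => D b; nra.
  by rewrite ler_peMl ?(ltW D0)// lerDl.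
have small t : 0 <= t -> t ^+ 2 <= 1 -> t <= 1 by move=> t0 t2; nra.
have a1 : `|a| <= 1.
  apply: small => //; rewrite real_normK ?num_real//; move: (sqr_ge0 s) D1; lra.
have s1 : `|s| <= 1.
  apply: small => //; rewrite real_normK ?num_real//; move: (sqr_ge0 a) D1; lra.
have aE : 0 < `|a| by rewrite normr_gt0.
have sE : 0 < `|s| by rewrite normr_gt0.
rewrite mulrDl mul1r ler_wpDl ?(ltW D0)//.
rewrite /rsqrt01 aE a1 sE s1 !mul1r /rsqrt !expRN.
have qa : `|a| = expR (ln `|a| / 2) ^+ 2 by rewrite expr2 -expRD -splitr lnK.
have qs : `|s| = expR (ln `|s| / 2) ^+ 2 by rewrite expr2 -expRD -splitr lnK.
rewrite -(real_normK (num_real a)) -(real_normK (num_real s)).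
have := expR_gt0 (ln `|a| / 2); have := expR_gt0 (ln `|s| / 2).
move: H; move: (expR (ln `|a| / 2)) (expR (ln `|s| / 2)) qa qs => q p -> -> H p0 q0.
rewrite -invfM mulrC ler_pdivlMr ?mulr_gt0//.
have [pq|qp] := leP q p; last first.
  apply: (@le_trans _ _ (q ^+ 2 * (q * q))).
    apply: ler_pM => //; first by rewrite mulr_ge0// ltW.
      by case: H => // H; apply: (le_trans H); rewrite lerXn2r ?nnegrE// ltW.
    by rewrite ler_pM2l// ltW.
  have := sqr_ge0 (p ^+ 2); nra.
apply: (@le_trans _ _ (p ^+ 2 * (p * p))).
  apply: ler_pM => //; first by rewrite mulr_ge0// ltW.
    by case: H => // H; apply: (le_trans H); rewrite lerXn2r ?nnegrE// ltW.
  by rewrite ler_pM2r// ltW.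
have := sqr_ge0 (q ^+ 2); nra.
Qed.

Lemma eint_ae_neq a (F G : R -> \bar R) : measurable_fun setT F -> measurable_fun setT G ->
  (forall x, 0 <= F x)%E -> (forall x, 0 <= G x)%E -> (forall x, x != a -> F x = G x) ->
  (\int[mu]_x F x = \int[mu]_x G x)%E.
Proof.
move=> mF mG F0 G0 FG; apply: ge0_ae_eq_integral => //.
by have := @ae_neq R a; apply: aeS => x /FG.
Qed.

(** A horizontal and a vertical line are negligible for iterated integrals. On
these two lines the pointwise bounds on the kernel fail. *)
Lemma intg2_off_cross a b f : measurable_fun setT f ->
  intg2 (fun z => (z.1 != a)%R%:R * (z.2 != b)%R%:R * f z) -> intg2 f.
Proof.
move=> mf.
have mne (c : R) (p : R * R -> R) : measurable_fun setT p -> measurable_fun setT (fun z => (p z != c)%R%:R : R).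
  move=> mp; rewrite (_ : (fun z => _) = (fun z => (p z < c)%R%:R + (c < p z)%R%:R)).
    by meas.
  by apply/funext => z; case: ltgtP => _; rewrite ?addr0 ?add0r.
have mg : measurable_fun setT (fun z : R * R => (z.1 != a)%R%:R * (z.2 != b)%R%:R * f z).
  apply: measurable_funM => //; apply: measurable_funM; apply: mne; by meas.
move=> /(intg2P mg) i; apply/(intg2P mf); apply: le_lt_trans i.
rewrite le_eqVlt; apply/orP; left; apply/eqP.
have mA (h : R * R -> R) : measurable_fun setT h ->
    measurable_fun setT (fun x => \int[mu]_y `|h (x, y)|%:E)%E.
  move=> mh; apply: (@measurable_fun_fubini_tonelli_F _ _ _ _ R mu (fun z => `|h z|%:E)).
  - by apply/measurable_EFinP; meas.
  - by move=> z; rewrite lee_fin.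
apply: (@eint_ae_neq a); [exact: (mA _ mf)|exact: (mA _ mg)|by move=> ?; exact: integral_ge0|by move=> ?; exact: integral_ge0|].
move=> x xa; apply: (@eint_ae_neq b).
- by apply/measurable_EFinP; apply: meas_norm; apply: measurableT_comp.
- by apply/measurable_EFinP; apply: meas_norm; apply: (measurableT_comp mg).
- by [].
- by [].
- by move=> y yb; rewrite /= xa yb !mul1r.
Qed.

Lemma berezin_slice_ge0 rho x u s : 0 <= berezin_slice rho x u s.
Proof.
by rewrite /berezin_slice mulr_ge0 ?expR_ge0// mulr_ge0 ?fnorm2_ge0// invr_ge0 mulr_ge0 ?pi_ge0.
Qed.

Lemma berezin_slice_le k rho M x u s : slow k rho -> (forall t, `|rho t| <= M) ->
  berezin_slice rho x u s <= 2 * M ^+ 2.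
Proof.
move=> h rM; have ig := intg_gauss_slice (x + u) h.
have M0 : 0 <= M by apply: le_trans (rM 0).
have q0 := @s2pi_gt0 R.
have q2 : Num.sqrt (2 * pi) ^+ 2 = 2 * pi :> R by rewrite sqr_sqrtr// mulr_ge0// pi_ge0.
have L : \int[mu]_t `|gauss_slice rho (x + u) t| <= Num.sqrt (2 * pi) * M.
  have i1 : intg (fun t => gdens 1 (x + u - t)) by apply: intg_reflect; exact: intg_gdens.
  apply: (@le_trans _ _ (\int[mu]_t (Num.sqrt (2 * pi) * M * gdens 1 (x + u - t)))).
    apply: le_Rint; [exact: intg_norm|exact: intgZ|] => t.
    rewrite /gauss_slice !normrM (gtr0_norm q0) (ger0_norm (gdens_ge0 _ _))// -mulrA ler_pM2l//.
    by rewrite mulrC ler_wpM2r ?gdens_ge0.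
  rewrite RintZ// -(Rint_reflect (x + u) (measurable_gdens 1)) int_gdens// mulr1.
  by [].
have S (y : R) : `|y| <= \int[mu]_t `|gauss_slice rho (x + u) t| -> y ^+ 2 <= 2 * pi * M ^+ 2.
  move=> yL; rewrite -q2 -exprMn -(real_normK (num_real y)).
  by rewrite lerXn2r ?nnegrE ?mulr_ge0 ?(ltW q0)//; exact: le_trans yL L.
have E : fnorm2 (gauss_slice rho (x + u)) s <= 2 * pi * M ^+ 2 + 2 * pi * M ^+ 2.
  by rewrite /fnorm2 lerD// S//; [exact: cosT_le|exact: sinT_le].
rewrite /berezin_slice; apply: (@le_trans _ _ (1 * ((2 * pi)^-1 * (2 * pi * M ^+ 2 + 2 * pi * M ^+ 2)))).
  have p2 : 0 <= (2 * pi)^-1 :> R by rewrite invr_ge0 mulr_ge0// pi_ge0.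
  apply: ler_pM; [exact: expR_ge0|by rewrite mulr_ge0 ?fnorm2_ge0| |by rewrite ler_wpM2l].
  by rewrite expR_le1 oppr_le0 sqr_ge0.
have p0 : 2 * pi != 0 :> R by rewrite gt_eqF// mulr_gt0// pi_gt0.
rewrite le_eqVlt; apply/orP; left; apply/eqP.
move: p0; move: (2 * pi) (M ^+ 2) => P N p0; by field.
Qed.

Lemma intg2D f g : intg2 f -> intg2 g -> intg2 (fun z => f z + g z).
Proof. exact: integrableD. Qed.

(** The mass formula, with the bound on the window. *)
Lemma intg2_berezin_slice k rho M x : slow k rho -> (forall t, `|rho t| <= M) ->
  intg2 (fun z => (z.1 <= 0)%R%:R * berezin_slice rho x z.1 z.2).
Proof.
move=> h rM; have mr := slow_meas h; have mF := @measurable_Fline R.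
apply/intg2P.
  by apply: measurable_funM; [meas|exact: measurable_berezin_slice].
rewrite (_ : (\int[mu]_u _)%E = (\int[mu]_u \int[mu]_s ((u <= 0)%R%:R * berezin_slice rho x u s)%:E)%E); last first.
  apply: eq_integral => u _; apply: eq_integral => s _ /=; congr EFin.
  by rewrite ger0_norm// mulr_ge0// berezin_slice_ge0.
have := mass_formula x h; rewrite /berezin_slice => ->.
rewrite lte_mul_pinfty ?lee_fin ?pi_ge0//.
rewrite -EFin_Rint ?ltry//.
apply: (intg_mulb (M := M ^+ 2)); [by apply: intg_reflect; exact: intg_gdens|by meas|].
move=> t; rewrite normrM (ger0_norm (Fline_ge0 _)) normrX -[leRHS]mul1r.
apply: ler_pM; rewrite ?Fline_ge0 ?Fline_le1 ?sqr_ge0//.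
by rewrite lerXn2r ?nnegrE//; apply: le_trans (rM 0).
Qed.

(** Near the singularity the numerator is bounded and the kernel is dominated by
an integrable product; away from it the numerator alone is integrable. *)
Lemma intg2_berezin k rho M x (w : R -> R -> R) : slow k rho -> (forall t, `|rho t| <= M) ->
  measurable_fun setT (fun z : R * R => w z.1 z.2) ->
  (forall u s, `|w u s| <= `|x - u| \/ `|w u s| <= `|s|) ->
  intg2 (fun z => (z.1 <= 0)%R%:R * (berezin_slice rho x z.1 z.2 * (w z.1 z.2 / ((x - z.1) ^+ 2 + z.2 ^+ 2)))).
Proof.
move=> h rM mw wle; have mr := slow_meas h; have mb := measurable_berezin_slice x mr.
have mi : measurable_fun setT (fun z : R * R =>
    (z.1 <= 0)%R%:R * (berezin_slice rho x z.1 z.2 * (w z.1 z.2 / ((x - z.1) ^+ 2 + z.2 ^+ 2)))).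
  by meas.
apply: (intg2_off_cross (a := x) (b := 0)) => //.
apply: (intg2_le (g := fun z => (z.1 <= 0)%R%:R * berezin_slice rho x z.1 z.2 +
   (2 * M ^+ 2 * rsqrt01 (x - z.1)) * rsqrt01 z.2)).
- have mne (c : R) (p : R * R -> R) : measurable_fun setT p -> measurable_fun setT (fun z => (p z != c)%R%:R : R).
    move=> mp; rewrite (_ : (fun z => _) = (fun z => (p z < c)%R%:R + (c < p z)%R%:R)).
      by meas.
    by apply/funext => z; case: ltgtP => _; rewrite ?addr0 ?add0r.
  apply: measurable_funM => //; apply: measurable_funM; apply: mne; by meas.
- move=> [u s] /=; have b0 := berezin_slice_ge0 rho x u s; have bM := berezin_slice_le x u s h rM.
  have s0 := rsqrt01_ge0 (x - u); have s1 := rsqrt01_ge0 s; have ss := mulr_ge0 s0 s1.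
  have g0 : 0 <= (u <= 0)%R%:R * berezin_slice rho x u s + 2 * M ^+ 2 * rsqrt01 (x - u) * rsqrt01 s.
    by rewrite addr_ge0// mulr_ge0// mulr_ge0// mulr_ge0// sqr_ge0.
  have [ux|ux] := eqVneq u x; first by rewrite /= !mul0r normr0.
  have [sn|sn] := eqVneq s 0; first by rewrite /= mulr0 !mul0r normr0.
  rewrite /= !mul1r normrM normr_nat normrM (ger0_norm b0).
  have [u0|u0] := leP u 0; last by rewrite !mul0r add0r -mulrA mulr_ge0// mulr_ge0// sqr_ge0.
  rewrite !mul1r; have xu : x - u != 0 by rewrite subr_eq0 eq_sym.
  have W := weight_le xu sn (wle u s).
  apply: (le_trans (ler_wpM2l b0 W)); rewrite mulrDr mulr1 lerD2l -mulrA.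
  by rewrite ler_wpM2r.
apply: (intg2D (f := fun z => (z.1 <= 0)%R%:R * berezin_slice rho x z.1 z.2)); first exact: intg2_berezin_slice h rM.
apply: (intg2_prod (f := fun u => 2 * M ^+ 2 * rsqrt01 (x - u)) (g := rsqrt01)).
  by apply: intgZ; apply: intg_reflect; exact: intg_rsqrt01.
exact: intg_rsqrt01.
Qed.

End integrability.

(** * Complex derivatives of functions of the real part *)

Section plane_derivatives.
Context {R : realType}.
Implicit Types (c : R -> R) (x y d : R).

(** Differentiability is local: the differential of f serves for g. *)
Lemma near_differentiable (f g : R * R -> R) (p : R * R) :
  (\forall q \near p, f q = g q) -> differentiable f p -> differentiable g p.
Proof.
move=> fg /diff_locallyP[cd df].
have fgp := nbhs_singleton fg.
have E : g \o shift p = cst (g p) + 'd f p +o_ (0 : R * R) id.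
  apply/eqaddoP => e e0; move: df => /eqaddoP/(_ e e0) H.
  have fg0 : \forall h \near (0 : R * R), f (h + p) = g (h + p).
    have /nbhs_ballP[r r0 Hr] := fg.
    apply/nbhs_ballP; exists r => // h hr; apply: Hr.
    move: hr; rewrite -!ball_normE /= sub0r normrN => hr.
    by rewrite opprD addrCA subrr addr0 normrN.
  near=> h; have e1 : f (h + p) = g (h + p) by near: h.
  have -> : (g \o shift p - (cst (g p) + 'd f p)) h = (f \o shift p - (cst (f p) + 'd f p)) h.
    by rewrite !fctE /= -e1 -fgp.
  by near: h; exact: H.
have dE := diff_unique cd E.
by apply/diff_locallyP; rewrite dE.
Unshelve. all: by end_near. Qed.

Lemma diff_fst_comp c (p : R * R) d : has_deriv c p.1 d ->
  [/\ differentiable (fun q : R * R => c q.1) p,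
      'D_(1, 0) (fun q : R * R => c q.1) p = d &
      'D_(0, 1) (fun q : R * R => c q.1) p = 0].
Proof.
move=> h; have dc : differentiable c p.1 by apply/derivable1_diffP; exact: has_deriv_derivable h.
have cf : continuous (fst : R * R -> R) by move=> q; exact: cvg_fst.
have df : differentiable (fst : R * R -> R) p.
  exact: (@linear_differentiable R (R * R)%type R fst).
have dcomp : differentiable (fun q : R * R => c q.1) p.
  exact: (@differentiable_comp R (R * R)%type R R fst c).
have D v : 'D_v (fun q : R * R => c q.1) p = v.1 * d.
  rewrite deriveE//.
  rewrite (@diff_comp R (R * R)%type R R fst c)//=.
  rewrite (diff1E dc) (@diff_lin R (R * R)%type R fst)//.
  by rewrite (has_deriv_derive1 h).
by split => //; rewrite D ?mul1r ?mul0r.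
Qed.

(** Such a function is the composition of its profile with the first projection,
and its imaginary part is constant. *)
Lemma profile_derivatives (f : R[i] -> R[i]) c (z : R[i]) d :
  (\forall p \near (Re z, Im z), f (ofpair p) = (c p.1)%:C) -> has_deriv c (Re z) d ->
  [/\ real_differentiable f z, partial_x f z = d%:C & partial_y f z = 0].
Proof.
move=> fc h; have [dd Dx Dy] := @diff_fst_comp c (Re z, Im z) d h.
have nR : \forall p \near (Re z, Im z), c p.1 = Re (f (ofpair p)).
  by near=> p; rewrite (near fc p).
have nI : \forall p \near (Re z, Im z), 0 = Im (f (ofpair p)).
  by near=> p; rewrite (near fc p).
have dI : differentiable (fun _ : R * R => 0 : R) (Re z, Im z) by exact: differentiable_cst.
split.
- split; first exact: near_differentiable nR dd.
  exact: near_differentiable nI dI.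
- rewrite /partial_x -(near_eq_derive _ nR) Dx.
  by rewrite -(near_eq_derive _ nI) derive_cst.
- rewrite /partial_y -(near_eq_derive _ nR) Dy.
  by rewrite -(near_eq_derive _ nI) derive_cst.
Unshelve. all: by end_near. Qed.

Lemma half_real (d : R) : d%:C / 2 = (d / 2)%:C :> R[i].
Proof.
have e2 : (2 : R[i]) = (2 : R)%:C by rewrite (rmorph_nat (real_complex R)).
by rewrite e2 -fmorphV -rmorphM.
Qed.

Lemma near_half (P : R[i] -> Prop) (z : R[i]) : open_halfplane z ->
  (forall w, open_halfplane w -> P w) -> \forall p \near (Re z, Im z), P (ofpair p).
Proof.
rewrite /open_halfplane/= => z0 H.
have : \forall q \near (Re z, Im z), q.1 < 0.
  have cf : continuous (fst : R * R -> R) by move=> q; exact: cvg_fst.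
  exact: (cvgr_lt _ (cf (Re z, Im z)) _ z0).
by apply: filterS => q q0; apply: H.
Qed.

Lemma profile_delbar (f : R[i] -> R[i]) c (z : R[i]) d :
  (\forall p \near (Re z, Im z), f (ofpair p) = (c p.1)%:C) -> has_deriv c (Re z) d ->
  delbar f z = (d / 2)%:C.
Proof.
move=> fc h; have [_ px py] := profile_derivatives fc h.
by rewrite /delbar px py mulr0 addr0 half_real.
Qed.

Lemma profile_lap (f : R[i] -> R[i]) c c1 (z : R[i]) d :
  (forall w, open_halfplane w -> f w = (c (Re w))%:C) ->
  (forall x, x < 0 -> has_deriv c x (c1 x)) -> open_halfplane z -> has_deriv c1 (Re z) d ->
  lap f z = (d / 4)%:C.
Proof.
move=> fc hc z0 h1; have db w : open_halfplane w -> delbar f w = (c1 (Re w) / 2)%:C.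
  by move=> w0; apply: (profile_delbar (near_half w0 fc)); exact: hc.
have h2 : has_deriv (fun x => c1 x / 2) (Re z) (d / 2).
  eapply has_deriv_eq; [apply: has_deriv_M; [exact: h1|exact: has_deriv_cst]|].
  by rewrite mulr0 addr0.
have [_ px py] := profile_derivatives (f := delbar f) (c := fun x => c1 x / 2) (near_half z0 db) h2.
rewrite /lap /del px py mulr0 subr0 half_real; congr (_%:C); by field.
Qed.

End plane_derivatives.

(** * Area integrals over the half-plane *)

Section plane_integrals.
Context {R : realType}.
Notation mu := (@lebesgue_measure R).
Implicit Types (f g : R * R -> R).

Definition half_cut f (p : R * R) := (p.1 <= 0)%R%:R * f p.

Lemma measurable_half_cut f : measurable_fun setT f -> measurable_fun setT (half_cut f).
Proof. by move=> mf; apply: measurable_funM => //; meas. Qed.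

Lemma half_patch f p : ((EFin \o f) \_ [set p : R * R | p.1 <= 0]) p = (half_cut f p)%:E.
Proof.
rewrite patchE /half_cut; have [p0|p0] := boolP (p.1 <= 0).
  by rewrite mem_set// mul1r.
by rewrite memNset ?mul0r//; exact/negP.
Qed.

Lemma measurable_half : measurable ([set p : R * R | p.1 <= 0] : set (measurableTypeR R * measurableTypeR R)).
Proof.
rewrite (_ : [set p | _] = fst @^-1` (`]-oo, 0]%classic : set R)).
  by rewrite -[X in measurable X]setTI; apply: measurable_fst => //; exact: measurable_itv.
by apply/seteqP; split => p /=; rewrite in_itv/=.
Qed.

Lemma half_integrable (h f : R * R -> R) : (forall p, p.1 <= 0 -> h p = f p) ->
  (plane_measure R).-integrable [set p : R * R | p.1 <= 0] (EFin \o h) <-> intg2 (half_cut f).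
Proof.
move=> hf; split=> [i|i].
  have i' : (plane_measure R).-integrable [set p : R * R | p.1 <= 0] (EFin \o f).
    apply: eq_integrable i; first exact: measurable_half.
    by move=> p; rewrite inE/= => /hf ->.
  have := (@integrable_mkcond _ _ R (plane_measure R) _ _ measurable_half).1 i'.
  by apply: eq_integrable => // p _; rewrite half_patch.
apply: (@eq_integrable _ _ _ _ _ measurable_half (EFin \o f)).
  by move=> p; rewrite inE/= => /hf ->.
apply: (@integrable_mkcond _ _ R (plane_measure R) _ _ measurable_half).2.
by apply: eq_integrable i => // p _; rewrite half_patch.
Qed.

Lemma half_integral (h f : R * R -> R) : (forall p, p.1 <= 0 -> h p = f p) ->
  intg2 (half_cut f) ->
  \int[plane_measure R]_(p in [set p : R * R | p.1 <= 0]) h p =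
  \int[mu]_u \int[mu]_v half_cut f (u, v).
Proof.
move=> hf i; have [_ ->] := Rint_fubini1 i.
rewrite /Rintegral; congr fine; rewrite integral_mkcond.
apply: eq_integral => p _; rewrite patchE /half_cut.
have [p0|p0] := boolP (p.1 <= 0); first by rewrite mem_set// mul1r hf.
by rewrite memNset ?mul0r//; exact/negP.
Qed.

Lemma half_preimage : ofpair @^-1` (@halfplane R) = [set p : R * R | p.1 <= 0].
Proof. by apply/seteqP; split. Qed.

Lemma area_integrableP (h : R[i] -> R[i]) f g :
  (forall p, p.1 <= 0 -> h (ofpair p) = f p +i* g p) ->
  area_integrable halfplane h <-> intg2 (half_cut f) /\ intg2 (half_cut g).
Proof.
move=> hfg; rewrite /area_integrable /cintegrable half_preimage.
have hf p : p.1 <= 0 -> Re ((h \o ofpair) p) = f p by move=> p0; rewrite /= hfg.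
have hg p : p.1 <= 0 -> Im ((h \o ofpair) p) = g p by move=> p0; rewrite /= hfg.
by rewrite (half_integrable hf) (half_integrable hg).
Qed.

(** The identification of C with the plane, and Fubini's theorem. *)
Lemma area_integralE (h : R[i] -> R[i]) f g :
  (forall p, p.1 <= 0 -> h (ofpair p) = f p +i* g p) ->
  intg2 (half_cut f) -> intg2 (half_cut g) ->
  area_integral halfplane h =
  (pi^-1 * \int[mu]_u \int[mu]_v half_cut f (u, v)) +i*
  (pi^-1 * \int[mu]_u \int[mu]_v half_cut g (u, v)).
Proof.
move=> hfg fi gi; rewrite /area_integral /cintegral half_preimage.
have hf p : p.1 <= 0 -> Re ((h \o ofpair) p) = f p by move=> p0; rewrite /= hfg.
have hg p : p.1 <= 0 -> Im ((h \o ofpair) p) = g p by move=> p0; rewrite /= hfg.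
rewrite (half_integral hf fi) (half_integral hg gi).
move: (Rintegral _ _ _) (Rintegral _ _ _) => a b.
by rewrite /real_complex_def; simpc.
Qed.

Lemma intg2_reflect (y : R) f : measurable_fun setT f ->
  intg2 (fun p => f (p.1, y - p.2)) <-> intg2 f.
Proof.
move=> mf; have mf' : measurable_fun setT (fun p : R * R => f (p.1, y - p.2)).
  by apply: (measurableT_comp mf); apply: measurable_fun_pair; meas.
have E : (\int[mu]_x \int[mu]_v `|f (x, y - v)|%:E = \int[mu]_x \int[mu]_s `|f (x, s)|%:E)%E.
  apply: eq_integral => x _; rewrite [RHS](ge0_integral_reflect y)//.
  by apply/measurable_EFinP; apply: meas_norm; apply: (measurableT_comp mf); apply: measurable_fun_pair; meas.
by rewrite (intg2P mf) (intg2P mf') /= E.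
Qed.

Lemma Rint_reflect2 (y : R) f : measurable_fun setT f ->
  \int[mu]_u \int[mu]_v half_cut (fun p => f (p.1, y - p.2)) (u, v) =
  \int[mu]_u ((u <= 0)%R%:R * \int[mu]_s f (u, s)).
Proof.
move=> mf; apply: eq_Rint => u; rewrite /half_cut/=.
have mu' : measurable_fun setT (fun s => f (u, s)).
  by apply: (measurableT_comp mf); apply: measurable_fun_pair; meas.
rewrite RintZ'; last by apply: (measurableT_comp mu'); meas.
by rewrite -(Rint_reflect y mu').
Qed.

End plane_integrals.

(** * Gaussian convolution of complex windows *)

Section window_transforms.
Context {R : realType}.
Notation mu := (@lebesgue_measure R).
Implicit Types (rho : R -> R) (a b k s t x y : R) (phi : R -> R[i]).

Lemma half_complex (z : R[i]) : z / 2 = (Re z / 2) +i* (Im z / 2).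
Proof.
have e2 : (2 : R[i]) = (2 : R)%:C by rewrite (rmorph_nat (real_complex R)).
by case: z => a b; rewrite e2 -fmorphV /real_complex_def/=; simpc.
Qed.

Lemma gaussE a b : gauss (a +i* b) =
  (gdens 1 a * expR (b ^+ 2 / 2) * cos (a * b)) +i* (- (gdens 1 a * expR (b ^+ 2 / 2) * sin (a * b))).
Proof.
rewrite /gauss half_complex /cexp /real_complex_def expr2 /= gdens1E.
rewrite (_ : - (a * a - b * b) / 2 = - a ^+ 2 / 2 + b ^+ 2 / 2); last by field.
rewrite (_ : - (a * b + b * a) / 2 = - (a * b)); last by field.
rewrite expRD cosN sinN; simpc; congr (_ +i* _); ring.
Qed.

Definition real_window rho : R -> R[i] := fun t => (rho t)%:C.

Lemma gauss_conv_real rho a b : gauss_conv (real_window rho) (a +i* b) =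
  (\int[mu]_t (expR (b ^+ 2 / 2) * (gdens 1 (a - t) * rho t * cos ((a - t) * b)))) +i*
  (\int[mu]_t (- expR (b ^+ 2 / 2) * (gdens 1 (a - t) * rho t * sin ((a - t) * b)))).
Proof.
have E t : gauss (a +i* b - t%:C) * real_window rho t =
  (expR (b ^+ 2 / 2) * (gdens 1 (a - t) * rho t * cos ((a - t) * b))) +i*
  (- expR (b ^+ 2 / 2) * (gdens 1 (a - t) * rho t * sin ((a - t) * b))).
  rewrite (_ : a +i* b - t%:C = (a - t) +i* b); last by rewrite /real_complex_def; simpc.
  by rewrite gaussE /real_window /real_complex_def; simpc; congr (_ +i* _); ring.
by rewrite /gauss_conv /cintegral; congr (_ +i* _); apply: eq_Rint => t; rewrite E.
Qed.

Lemma gauss_conv_axis rho x : gauss_conv (real_window rho) x%:C = (gauss_avg rho x)%:C.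
Proof.
rewrite -[x%:C]/(x +i* 0) gauss_conv_real; congr (_ +i* _).
  by apply: eq_Rint => t; rewrite mulr0 cos0 mulr1 expr2 mulr0 mul0r expR0 mul1r.
transitivity (\int[mu]_t (0 : R)); last exact: Rint_zero.
by apply: eq_Rint => t; rewrite mulr0 sin0 !mulr0.
Qed.

Lemma normc_sqr (z : R[i]) : `|z| ^+ 2 = (Re z ^+ 2 + Im z ^+ 2)%:C.
Proof. by rewrite add_Re2_Im2. Qed.

(** Up to the factor exp(b^2/2), the two coordinates are the transform of the
slice at b, rotated by the angle ab, which does not change the modulus. *)
Lemma gauss_conv_norm k rho a b : slow k rho ->
  `|gauss_conv (real_window rho) (a +i* b)| ^+ 2 =
  (expR (b ^+ 2) * ((2 * pi)^-1 * fnorm2 (gauss_slice rho a) b))%:C.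
Proof.
move=> h; have ig := intg_gauss_slice a h; have mg := intg_meas ig.
have i0 := intg_gauss a h; have m0 := intg_meas i0.
rewrite normc_sqr gauss_conv_real /=; congr (_%:C).
have q2 : Num.sqrt (2 * pi) ^+ 2 = 2 * pi :> R by rewrite sqr_sqrtr// mulr_ge0// pi_ge0.
have q0 : Num.sqrt (2 * pi) != 0 :> R by rewrite gt_eqF// s2pi_gt0.
have ic := intg_cos b ig; have is' := intg_sin b ig.
rewrite !RintZ'; [|by meas|by meas].
have eC : \int[mu]_t (gdens 1 (a - t) * rho t * cos ((a - t) * b)) =
   (Num.sqrt (2 * pi))^-1 * (cos (a * b) * cosT (gauss_slice rho a) b + sin (a * b) * sinT (gauss_slice rho a) b).
  rewrite /cosT /sinT -!RintZ// -RintD; [|exact: intgZ|exact: intgZ].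
  rewrite -RintZ; last by apply: intgD; apply: intgZ.
  apply: eq_Rint => t; rewrite mulrBl cosB [b * t]mulrC /gauss_slice.
  by move: (cos _) (sin _) (cos _) (sin _) => c1 s1 c2 s2; field.
have eS : \int[mu]_t (gdens 1 (a - t) * rho t * sin ((a - t) * b)) =
   (Num.sqrt (2 * pi))^-1 * (sin (a * b) * cosT (gauss_slice rho a) b - cos (a * b) * sinT (gauss_slice rho a) b).
  rewrite /cosT /sinT -!RintZ// -RintB; [|exact: intgZ|exact: intgZ].
  rewrite -RintZ; last by apply: intgB; apply: intgZ.
  apply: eq_Rint => t; rewrite mulrBl sinB [b * t]mulrC /gauss_slice.
  by move: (cos _) (sin _) (cos _) (sin _) => c1 s1 c2 s2; field.
rewrite eC eS /fnorm2 (_ : (2 * pi)^-1 = (Num.sqrt (2 * pi) ^+ 2)^-1); last by rewrite q2.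
rewrite (_ : expR (b ^+ 2) = expR (b ^+ 2 / 2) ^+ 2); last first.
  by rewrite [RHS]expr2 -expRD -splitr.
have := cos2Dsin2 (a * b).
move: (cos _) (sin _) (cosT _ _) (sinT _ _) (expR _) (Num.sqrt _) q0 => c s C S e q q0 cs.
transitivity (e ^+ 2 * ((q ^+ 2)^-1 * ((c ^+ 2 + s ^+ 2) * (C ^+ 2 + S ^+ 2)))).
  by field.
by rewrite cs mul1r.
Qed.

Lemma gauss_conv_ae (phi psi : R -> R[i]) : measurable_window phi -> measurable_window psi ->
  {ae mu, forall t, phi t = psi t} -> gauss_conv phi = gauss_conv psi.
Proof.
move=> [m1 m2] [m3 m4] H; apply/funext => -[a b].
have E (c d : R) (r i : R) : (c +i* d) * (r +i* i) = (c * r - d * i) +i* (c * i + d * r).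
  by simpc.
pose g1 t := gdens 1 (a - t) * expR (b ^+ 2 / 2) * cos ((a - t) * b).
pose g2 t := - (gdens 1 (a - t) * expR (b ^+ 2 / 2) * sin ((a - t) * b)).
have mgd : measurable_fun setT (fun t => gdens 1 (a - t) : R).
  by apply: (measurableT_comp (measurable_gdens _)); meas.
have mg1 : measurable_fun setT g1 by rewrite /g1; meas.
have mg2 : measurable_fun setT g2 by rewrite /g2; meas.
have F (p : R -> R[i]) t : gauss (a +i* b - t%:C) * p t =
   (g1 t * Re (p t) - g2 t * Im (p t)) +i* (g1 t * Im (p t) + g2 t * Re (p t)).
  rewrite (_ : a +i* b - t%:C = (a - t) +i* b); last by rewrite /real_complex_def; simpc.
  by rewrite gaussE; case: (p t) => r i; rewrite E.
rewrite /gauss_conv /cintegral; congr (_ +i* _).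
  transitivity (\int[mu]_t (g1 t * Re (phi t) - g2 t * Im (phi t))).
    by apply: eq_Rint => t; rewrite F.
  transitivity (\int[mu]_t (g1 t * Re (psi t) - g2 t * Im (psi t))).
    by apply: Rint_ae; [by meas|by meas|move: H; apply: aeS => t ->].
  by apply: eq_Rint => t; rewrite F.
transitivity (\int[mu]_t (g1 t * Im (phi t) + g2 t * Re (phi t))).
  by apply: eq_Rint => t; rewrite F.
transitivity (\int[mu]_t (g1 t * Im (psi t) + g2 t * Re (psi t))).
  by apply: Rint_ae; [by meas|by meas|move: H; apply: aeS => t ->].
by apply: eq_Rint => t; rewrite F.
Qed.

Lemma gauss_conv_im phi x : Im (gauss_conv phi x%:C) = gauss_avg (fun t => Im (phi t)) x.
Proof.
rewrite /gauss_conv /cintegral /=; apply: eq_Rint => t.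
rewrite (_ : x%:C - t%:C = (x - t) +i* 0); last by rewrite /real_complex_def; simpc.
rewrite gaussE mulr0 cos0 sin0 mulr0 oppr0 expr2 mulr0 mul0r expR0 !mulr1.
by case: (phi t) => r i; simpc.
Qed.

Lemma Ffun_axis t : Ffun t%:C = (Fline t)%:C.
Proof.
rewrite -gauss_conv_axis; congr (gauss_conv _ _).
apply/funext => s; rewrite /real_window !indicE mem_setE in_itv/=.
by rewrite rmorph_nat.
Qed.

Lemma HfunE (E : set R) : Hfun E = gauss_conv (real_window (fun t => \1_E t / Fline t)).
Proof.
congr gauss_conv; apply/funext => t.
by rewrite Ffun_axis /real_window !indicE rmorphM/= fmorphV rmorph_nat.
Qed.

Lemma exp_le_pow (N : nat) t : expR (- `|t|) * (1 + `|t|) ^+ N <= N`!%:R * expR 1.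
Proof.
have t0 : 0 <= 1 + `|t| by rewrite addr_ge0.
have := pow_le_exp N t0; move=> /(ler_wpM2l (expR_ge0 (- `|t|))) /le_trans; apply.
by rewrite mulrCA -expRD addrCA addNr addr0.
Qed.

(** An exponential weight beats a polynomial one. *)
Lemma moderate_slow phi : moderate_increase phi ->
  slow 1 (fun t => Re (phi t)) /\ slow 1 (fun t => Im (phi t)).
Proof.
move=> [N [iR iI]].
have K (r : R -> R) : intg (fun t => ((1 + `|t|) ^+ N)^-1 * r t) -> slow 1 r.
  move=> i; have mi := intg_meas i.
  have E t : expR (- `|t|) * (1 + `|t|) ^+ N * (((1 + `|t|) ^+ N)^-1 * r t) = expR (- 1 * `|t|) * r t.
    have n0 : (1 + `|t|) ^+ N != 0 by rewrite expf_neq0// gt_eqF// ltr_wpDr.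
    by rewrite mulN1r -mulrA mulVKf.
  apply: (eq_intg E); apply: (@eq_intg _ (fun t => ((1 + `|t|) ^+ N)^-1 * r t *
    (expR (- `|t|) * (1 + `|t|) ^+ N))); first by move=> t; rewrite mulrC.
  apply: (intg_mulb (M := N`!%:R * expR 1)) => //; first by meas.
  move=> t; rewrite ger0_norm; first exact: exp_le_pow.
  by rewrite mulr_ge0 ?expR_ge0// exprn_ge0// addr_ge0.
have D t : phi t / (1 + `|t|)%:C ^+ N =
  (((1 + `|t|) ^+ N)^-1 * Re (phi t)) +i* (((1 + `|t|) ^+ N)^-1 * Im (phi t)).
  rewrite -rmorphXn -fmorphV /real_complex_def; case: (phi t) => r i; simpc.
  by rewrite mulrC [i * _]mulrC.
split; apply: K.
  by apply: eq_integrable iR => // t _; rewrite /= D.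
by apply: eq_integrable iI => // t _; rewrite /= D.
Qed.

Lemma complex_eta (z : R[i]) : z = (Re z) +i* (Im z).
Proof. by case: z. Qed.

(** The imaginary part of the window has zero Gaussian averages on the half-line,
hence it vanishes almost everywhere. *)
Lemma window_real phi : measurable_window phi -> moderate_increase phi ->
  (forall x, x < 0 -> Im (gauss_conv phi x%:C) = 0) ->
  exists rho, slow 1 rho /\ gauss_conv phi = gauss_conv (real_window rho).
Proof.
move=> mphi /moderate_slow[sR sI] H; exists (fun t => Re (phi t)); split=> //.
apply: gauss_conv_ae => //; first by split; [exact: mphi.1|exact: measurable_cst].
have : {ae mu, forall t, Im (phi t) = 0}.
  by apply: (gauss_avg_eq0 sI) => x /H; rewrite gauss_conv_im.
by apply: aeS => t It; rewrite [LHS]complex_eta It.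
Qed.

(** It is enough to have the identity on the negative axis, by uniqueness of
Gaussian averages; it then holds on the whole plane. *)
Lemma eq_HfunP k rho (E : set R) : slow k rho -> measurable E ->
  eq_Hfun (gauss_conv (real_window rho)) E <->
  {ae mu, forall t, rho t = \1_E t / Fline t}.
Proof.
move=> h mE; have mr := slow_meas h.
have m1 : measurable_fun setT (fun t => \1_E t / Fline t : R).
  have mF := @measurable_Fline R.
  by apply: measurable_funM; [exact: measurable_indic|meas].
split=> [H|H z _].
  apply: (gauss_avg_eq_divF (M := 1) h).
  - exact: measurable_indic.
  - by move=> t; rewrite indicE normb_le1.
  - move=> x x0; apply: complexI; rewrite -!gauss_conv_axis H ?HfunE//.
rewrite HfunE; congr (_ z); apply: gauss_conv_ae.
- by split => //; exact: measurable_cst.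
- by split => //; exact: measurable_cst.
- by move: H; apply: aeS => t; rewrite /real_window => ->.
Qed.

Lemma Hfun_axis_real (E : set R) x : Im (Hfun E x%:C) = 0.
Proof. by rewrite HfunE gauss_conv_axis. Qed.

End window_transforms.

(** * The two equations in terms of the window *)

Section kernels.
Context {R : realType}.
Notation mu := (@lebesgue_measure R).
Implicit Types (rho : R -> R) (k s t x y u v : R) (z w : R[i]).

Lemma cexp_norm z : `|cexp z| ^+ 2 = (expR (Re z) ^+ 2)%:C.
Proof.
rewrite normc_sqr /cexp /real_complex_def /=; simpc; congr (_%:C).
have := cos2Dsin2 (Im z); move: (cos _) (sin _) (expR _) => c s e cs.
by rewrite /= -[RHS]mulr1 -cs; ring.
Qed.

Lemma cexp_real x : cexp x%:C = (expR x)%:C.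
Proof. by rewrite /cexp /= cos0 sin0 /real_complex_def; simpc. Qed.

Lemma addc_conj x y u v : (x +i* y) + (u +i* v)^*%C = (x + u) +i* (y - v).
Proof. by simpc. Qed.

Lemma mass_one_integrand_real (Phi : R[i] -> R[i]) z w : Im (mass_one_integrand Phi z w) = 0.
Proof. by rewrite /mass_one_integrand !normc_sqr -rmorphN cexp_real -rmorphM. Qed.

Lemma area_integral_real (A : set R[i]) (F : R[i] -> R[i]) : (forall w, Im (F w) = 0) ->
  Im (area_integral A F) = 0.
Proof.
move=> F0; rewrite /area_integral /cintegral /Rintegral.
rewrite [X in _ +i* fine X](_ : _ = 0%E).
  by rewrite /= mulr0 mul0r addr0.
by rewrite -[RHS](@integral0 _ _ R (plane_measure R) (ofpair @^-1` A)); apply: eq_integral => p _; rewrite F0.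
Qed.

(** The Gaussian in y - v cancels the growth of Phi in the vertical direction. *)
Lemma mass_one_integrandE k rho x y (p : R * R) : slow k rho ->
  mass_one_integrand (gauss_conv (real_window rho)) (x +i* y) (ofpair p) =
  (berezin_slice rho x p.1 (y - p.2))%:C.
Proof.
move=> h; rewrite /mass_one_integrand /ofpair addc_conj (gauss_conv_norm _ _ h).
rewrite normc_sqr /= -[- _%:C]rmorphN cexp_real -rmorphM; congr (_%:C).
rewrite mulrA -expRD /berezin_slice; congr (expR _ * _); ring.
Qed.

Lemma onepointE rho z : Re z <= 0 ->
  onepoint (gauss_conv (real_window rho)) z = (gauss_avg rho (2 * Re z))%:C.
Proof.
move=> z0; rewrite /onepoint indicE mem_set// mulr1 -gauss_conv_axis; congr gauss_conv.
by case: z z0 => x y _; rewrite addc_conj subrr /real_complex_def /=; congr (_ +i* _); ring.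
Qed.

Lemma Gkernel_norm x y u v :
  `|Gkernel (x +i* y) (u +i* v)| ^+ 2 = (expR (- ((x - u) ^+ 2 + (y - v) ^+ 2)))%:C.
Proof.
rewrite /Gkernel cexp_norm !normc_sqr !half_complex /=; congr (_%:C).
rewrite expr2 -expRD; congr expR; simpc; by field.
Qed.

Lemma berezinE k rho x y (p : R * R) : slow k rho -> x <= 0 -> p.1 <= 0 ->
  berezin (gauss_conv (real_window rho)) (x +i* y) (ofpair p) =
  ((gauss_avg rho (2 * x))^-1 * berezin_slice rho x p.1 (y - p.2))%:C.
Proof.
move=> h x0 p0; rewrite /berezin onepointE//= /Kkernel !indicE !mem_set// !mulr1.
rewrite normrM exprMn /ofpair Gkernel_norm addc_conj (gauss_conv_norm _ _ h).
rewrite -!rmorphM -fmorphV -rmorphM; congr (_%:C).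
rewrite [LHS]mulrC /berezin_slice; congr (_ * _); rewrite mulrA -expRD; congr (expR _ * _); ring.
Qed.

Lemma invcE x y : (x +i* y)^-1 = (x / (x ^+ 2 + y ^+ 2)) -i* (y / (x ^+ 2 + y ^+ 2)).
Proof. by []. Qed.

Lemma cauchy_integrandE k rho x y (p : R * R) : slow k rho -> x <= 0 -> p.1 <= 0 ->
  berezin (gauss_conv (real_window rho)) (x +i* y) (ofpair p) / (x +i* y - ofpair p) =
  ((gauss_avg rho (2 * x))^-1 * (berezin_slice rho x p.1 (y - p.2) *
     ((x - p.1) / ((x - p.1) ^+ 2 + (y - p.2) ^+ 2)))) +i*
  (- (gauss_avg rho (2 * x))^-1 * (berezin_slice rho x p.1 (y - p.2) *
     ((y - p.2) / ((x - p.1) ^+ 2 + (y - p.2) ^+ 2)))).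
Proof.
move=> h x0 p0; rewrite (berezinE y h x0 p0) /ofpair.
rewrite (_ : (x +i* y) - (p.1 +i* p.2) = (x - p.1) +i* (y - p.2)); last by simpc.
by rewrite invcE /real_complex_def; simpc; congr (_ +i* _); ring.
Qed.

Lemma intg2Z c (f : R * R -> R) : intg2 f -> intg2 (fun p => c * f p).
Proof. exact: integrableZl. Qed.

Lemma eq_intg2 (f g : R * R -> R) : (forall p, f p = g p) -> intg2 f -> intg2 g.
Proof. by move=> fg; rewrite (_ : f = g)//; apply/funext. Qed.

(** The area integral does not depend on Im z, as z only enters it through
translations in the vertical direction. *)
Lemma solves_mass_oneP k rho : slow k rho ->
  solves_mass_one (gauss_conv (real_window rho)) <->
  {ae mu, forall t, Fline t * rho t ^+ 2 = rho t}.
Proof.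
move=> h; have mr := slow_meas h; have mF := @measurable_Fline R.
rewrite -(mass_one_window h).
pose Bf x (p : R * R) := berezin_slice rho x p.1 p.2.
have mB x : measurable_fun setT (Bf x) by exact: measurable_berezin_slice.
have hfg x y (p : R * R) : p.1 <= 0 -> mass_one_integrand (gauss_conv (real_window rho)) (x +i* y) (ofpair p) =
    (Bf x (p.1, y - p.2)) +i* (0 : R).
  by move=> _; rewrite (mass_one_integrandE _ _ _ h).
have i0 : intg2 (half_cut (fun=> 0 : R)).
  apply: (intg2_le (g := fun=> 0)) => //; first by apply: measurable_half_cut; exact: measurable_cst.
    by move=> p; rewrite /half_cut mulr0 normr0.
  by apply: (@integrable0).
have mG x : measurable_fun setT (fun t => gdens 1 (2 * x - t) * (Fline t * rho t ^+ 2)).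
  by apply: measurable_funM; [apply: (measurableT_comp (measurable_gdens _)); meas|meas].
have g0 x t : 0 <= gdens 1 (2 * x - t) * (Fline t * rho t ^+ 2).
  by apply: mulr_ge0; [exact: gdens_ge0|apply: mulr_ge0; [exact: Fline_ge0|exact: sqr_ge0]].
have mf x := mass_formula x h.
have iE x y : intg2 (half_cut (fun p => Bf x (p.1, y - p.2))) <->
    intg (fun t => gdens 1 (2 * x - t) * (Fline t * rho t ^+ 2)).
  rewrite (_ : half_cut _ = fun p => half_cut (Bf x) (p.1, y - p.2))//.
  rewrite intg2_reflect; last exact: measurable_half_cut.
  rewrite intg2P; last exact: measurable_half_cut.
  rewrite (_ : (\int[mu]_u _)%E = (\int[mu]_u \int[mu]_s ((u <= 0)%R%:R * berezin_slice rho x u s)%:E)%E); last first.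
    apply: eq_integral => u _; apply: eq_integral => s _; congr EFin.
    by rewrite ger0_norm// mulr_ge0// berezin_slice_ge0.
  rewrite /berezin_slice mf; split=> [i|i].
    apply: intg_ge0_lty => //; rewrite ltey; apply/eqP => e.
    by move: i; rewrite e gt0_muley ?ltxx// lte_fin pi_gt0.
  by rewrite lte_mul_pinfty ?lee_fin ?pi_ge0// -EFin_Rint ?ltry.
have vE x y : intg (fun t => gdens 1 (2 * x - t) * (Fline t * rho t ^+ 2)) ->
    \int[mu]_u \int[mu]_v half_cut (fun p => Bf x (p.1, y - p.2)) (u, v) =
    pi * gauss_avg (fun t => Fline t * rho t ^+ 2) (2 * x).
  move=> i; have i2 := (iE x 0).2 i.
  have i2' : intg2 (half_cut (Bf x)).
    apply/(intg2_reflect 0); first exact: measurable_half_cut.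
    exact: i2.
  rewrite (Rint_reflect2 _ (mB x)).
  transitivity (\int[mu]_u \int[mu]_s half_cut (Bf x) (u, s)).
    apply: eq_Rint => u; rewrite /half_cut /= RintZ'//.
    by apply: (measurableT_comp (mB x)); apply: measurable_fun_pair; meas.
  have [_ ->] := Rint_fubini1 i2'.
  rewrite -(integral12_prod_meas1 i2').
  transitivity (fine (pi%:E * \int[mu]_t (gdens 1 (2 * x - t) * (Fline t * rho t ^+ 2))%:E)%E).
    by rewrite -mf.
  by rewrite -EFin_Rint// -EFinM.
split=> [H x x0|H [x y] x0].
- have [/(area_integrableP (hfg x 0))[/iE i _] e] := H (x +i* 0) x0; split => //.
  move: e; rewrite (area_integralE (hfg x 0) ((iE x 0).2 i) i0) vE//.
  rewrite addc_conj subrr (_ : x + x = 2 * x); last by ring.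
  rewrite -[_ +i* 0]/((2 * x)%:C) gauss_conv_axis => -[] <- _.
  by rewrite mulrA mulVf ?mul1r// gt_eqF// pi_gt0.
- have [i e] := H x x0; split.
    by apply/(area_integrableP (hfg x y)); split => //; apply/iE.
  rewrite (area_integralE (hfg x y) ((iE x y).2 i) i0) vE//.
  rewrite addc_conj subrr (_ : x + x = 2 * x); last by ring.
  rewrite -[(2 * x) +i* 0]/((2 * x)%:C) gauss_conv_axis e /real_complex_def; congr (_ +i* _).
    by rewrite mulrA mulVf ?mul1r// gt_eqF// pi_gt0.
  transitivity (pi^-1 * \int[mu]_u (0 : R)); last by rewrite Rint_zero mulr0.
  congr (_ * _); apply: eq_Rint => u; rewrite -[RHS]Rint_zero; apply: eq_Rint => v.
  by rewrite /half_cut mulr0.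
Qed.

(** The value of the Cauchy transform at any point with real part x. *)
Definition cauchy_profile rho x :=
  gauss_avg (fun t => rho t * mass_tail rho t) (2 * x) / gauss_avg rho (2 * x) -
  \int[mu]_u ((x < u)%R%:R * ((u <= 0)%R%:R * (2 * gauss_avg rho (2 * u)))).

Lemma measurable_berezin_slice_line k rho x u : slow k rho ->
  measurable_fun setT (fun s => berezin_slice rho x u s).
Proof.
move=> h; have me := measurable_fnorm2 (intg_gauss_slice (x + u) h).
by rewrite /berezin_slice; meas.
Qed.

(** A translation in the vertical direction reduces to iterated integrals of the
slice; the imaginary part integrates an odd function over each vertical line. *)
Lemma cauchy_berezinE k rho z : 0 <= k -> slow k rho -> Re z < 0 ->
  gauss_avg rho (2 * Re z) != 0 ->
  area_integrable halfplane (fun w => berezin (gauss_conv (real_window rho)) z w / (z - w)) ->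
  cauchy_berezin (gauss_conv (real_window rho)) z = (cauchy_profile rho (Re z))%:C.
Proof.
case: z => x y k0 h /= x0 P0; have mr := slow_meas h; have mb := measurable_berezin_slice x mr.
pose P1 := (gauss_avg rho (2 * x))^-1.
pose f (p : R * R) := P1 * (berezin_slice rho x p.1 p.2 * ((x - p.1) / ((x - p.1) ^+ 2 + p.2 ^+ 2))).
pose g (p : R * R) := - P1 * (berezin_slice rho x p.1 p.2 * (p.2 / ((x - p.1) ^+ 2 + p.2 ^+ 2))).
have mf : measurable_fun setT f by rewrite /f; meas.
have mg : measurable_fun setT g by rewrite /g; meas.
have E (p : R * R) : p.1 <= 0 ->
    berezin (gauss_conv (real_window rho)) (x +i* y) (ofpair p) / (x +i* y - ofpair p) =
    f (p.1, y - p.2) +i* g (p.1, y - p.2).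
  by move=> p0; rewrite (cauchy_integrandE y h (ltW x0) p0).
move=> /(area_integrableP E)[fi gi].
rewrite /cauchy_berezin (area_integralE E fi gi) /real_complex_def.
rewrite (Rint_reflect2 _ mf) (Rint_reflect2 _ mg); congr (_ +i* _).
  transitivity (pi^-1 * (P1 * \int[mu]_u ((u <= 0)%R%:R *
      \int[mu]_s (berezin_slice rho x u s * ((x - u) / ((x - u) ^+ 2 + s ^+ 2)))))).
    congr (_ * _); rewrite -RintZ'; last first.
      apply: measurable_funM; first by meas.
      apply: (@measurable_Rint_param R _ (measurableTypeR R)
        (fun p => berezin_slice rho x p.1 p.2 * ((x - p.1) / ((x - p.1) ^+ 2 + p.2 ^+ 2)))).
      by meas.
    apply: eq_Rint => u; rewrite mulrCA; congr (_ * _).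
    have mu' := measurable_berezin_slice_line x u h.
    by rewrite -RintZ'//; meas.
  rewrite (Rint_cauchy x k0 h) /cauchy_profile /P1.
  have : pi != 0 :> R by rewrite gt_eqF// pi_gt0.
  move: (Rintegral _ _ _) (gauss_avg _ _) pi P0 => V P p P0 p0.
  by field; rewrite P0 p0.
transitivity (pi^-1 * \int[mu]_u (0 : R)); last by rewrite Rint_zero mulr0.
congr (_ * _); apply: eq_Rint => u.
have mu' := measurable_berezin_slice_line x u h.
by rewrite /g /= RintZ' ?(Rint_cauchy_im x u h) ?mulr0//; meas.
Qed.

Lemma area_integrable_berezin k rho M z : slow k rho -> (forall t, `|rho t| <= M) -> Re z < 0 ->
  area_integrable halfplane (fun w => berezin (gauss_conv (real_window rho)) z w / (z - w)).
Proof.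
case: z => x y h rM /= x0.
have mr := slow_meas h; have mb := measurable_berezin_slice x mr.
pose P1 := (gauss_avg rho (2 * x))^-1.
pose f (p : R * R) := P1 * (berezin_slice rho x p.1 p.2 * ((x - p.1) / ((x - p.1) ^+ 2 + p.2 ^+ 2))).
pose g (p : R * R) := - P1 * (berezin_slice rho x p.1 p.2 * (p.2 / ((x - p.1) ^+ 2 + p.2 ^+ 2))).
have mf : measurable_fun setT f by rewrite /f; meas.
have mg : measurable_fun setT g by rewrite /g; meas.
have E (p : R * R) : p.1 <= 0 ->
    berezin (gauss_conv (real_window rho)) (x +i* y) (ofpair p) / (x +i* y - ofpair p) =
    f (p.1, y - p.2) +i* g (p.1, y - p.2).
  by move=> p0; rewrite (cauchy_integrandE y h (ltW x0) p0).
apply/(area_integrableP E); split.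
- apply: ((@intg2_reflect R y (half_cut f) (measurable_half_cut mf)).2).
  have i := @intg2_berezin R k rho M x (fun u s => x - u) h rM.
  apply: (eq_intg2 _ (intg2Z P1 (i _ _))).
  + by move=> p; rewrite /half_cut /f /=; ring.
  + by meas.
  + by move=> u s; left.
- apply: ((@intg2_reflect R y (half_cut g) (measurable_half_cut mg)).2).
  have i := @intg2_berezin R k rho M x (fun u s => s) h rM.
  apply: (eq_intg2 _ (intg2Z (- P1) (i _ _))).
  + by move=> p; rewrite /half_cut /g /=; ring.
  + by meas.
  + by move=> u s; right.
Qed.

(** Write P, A and B for the Gaussian averages of rho, rho tail and t rho. Then
P' = B - x P, and at x = 2 Re z Ward's equation reads
(A/P)' + P = P - 1 - (P'/P)', where P'/P = B/P - x. The functions P and 1 cancel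
and W' = 0 is left, with W = (A + B)/P. *)
Lemma ward_equation k rho z : 0 <= k -> slow k rho ->
  (forall x, x < 0 -> 0 < gauss_avg rho x) ->
  (forall w, open_halfplane w ->
    area_integrable halfplane (fun w' => berezin (gauss_conv (real_window rho)) w w' / (w - w'))) ->
  open_halfplane z ->
  let W x := gauss_avg (fun t => rho t * (mass_tail rho t + t)) x / gauss_avg rho x in
  let Phi := gauss_conv (real_window rho) in
  real_differentiable (cauchy_berezin Phi) z /\
  (delbar (cauchy_berezin Phi) z = onepoint Phi z - 1 - lap (log_onepoint Phi) z <->
   has_deriv W (2 * Re z) 0).
Proof.
move=> k0 h P0 iw z0 W Phi; have z0' : Re z < 0 by [].
pose P := gauss_avg rho; pose A := gauss_avg (fun t => rho t * mass_tail rho t).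
pose B := gauss_avg (fun t => t * rho t).
have sA := slow_mass_tail k0 h; have sB := slow_id_mul h.
pose A1 x := gauss_avg (fun t => t * (rho t * mass_tail rho t)) x - x * A x.
pose B1 x := gauss_avg (fun t => t * (t * rho t)) x - x * B x.
pose P1 x := B x - x * P x.
have dA x : has_deriv A x (A1 x) by exact: has_deriv_gauss_avg sA.
have dB x : has_deriv B x (B1 x) by exact: has_deriv_gauss_avg sB.
have dP x : has_deriv P x (P1 x) by exact: has_deriv_gauss_avg h.
have neg2 x : x < 0 -> 2 * x < 0 by move=> x0; lra.
have Pn x : x < 0 -> P x != 0 by move=> /P0; rewrite /P => p; rewrite gt_eqF.
have d2 (f : R -> R) x a : has_deriv f (2 * x) a -> has_deriv (fun y => f (2 * y)) x (a * 2).
  move=> hf; apply: has_deriv_comp hf.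
  by eapply has_deriv_eq; [by deriv|rewrite mul0r add0r mulr1].
pose Q1 x := (A1 x * P x - A x * P1 x) / P x ^+ 2.
pose S1 x := (B1 x * P x - B x * P1 x) / P x ^+ 2.
have dQ x : x < 0 -> has_deriv (fun y => A y / P y) x (Q1 x).
  move=> x0; eapply has_deriv_eq; [apply: has_deriv_M; [exact: dA|apply: has_deriv_V; [exact: Pn|exact: dP]]|].
  by have := Pn _ x0; rewrite /Q1; move: (A1 x) (P x) (A x) (P1 x) => a b c e b0; field.
have dS x : x < 0 -> has_deriv (fun y => B y / P y) x (S1 x).
  move=> x0; eapply has_deriv_eq; [apply: has_deriv_M; [exact: dB|apply: has_deriv_V; [exact: Pn|exact: dP]]|].
  by have := Pn _ x0; rewrite /S1; move: (B1 x) (P x) (B x) (P1 x) => a b c e b0; field.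
have WE : W = (fun y => A y / P y + B y / P y).
  apply/funext => y; rewrite /W -mulrDl; congr (_ / _).
  rewrite /A /B /gauss_avg -RintD; [|exact: intg_gauss sA|exact: intg_gauss sB].
  by apply: eq_Rint => t; ring.
have dW : has_deriv W (2 * Re z) (Q1 (2 * Re z) + S1 (2 * Re z)).
  by rewrite WE; apply: has_deriv_D; [apply: dQ|apply: dS]; exact: neg2.
have cP : continuous (fun u => 2 * P (2 * u)).
  move=> u; apply: has_deriv_cont.
  by apply: has_deriv_M; [exact: has_deriv_cst|apply: d2; exact: dP].
have dC x : x < 0 -> has_deriv (cauchy_profile rho) x (Q1 (2 * x) * 2 + 2 * P (2 * x)).
  move=> x0; eapply has_deriv_eq.
    apply: has_deriv_B; first by apply: (d2 (fun y => A y / P y)); apply: dQ; exact: neg2.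
    exact: (has_deriv_segment cP x0).
  by rewrite opprK.
have CE w : open_halfplane w -> cauchy_berezin Phi w = (cauchy_profile rho (Re w))%:C.
  move=> w0; apply: (cauchy_berezinE k0 h w0); last exact: iw.
  by apply: Pn; exact: neg2.
(* the derivative of ln P(2x), as P' = B - x P *)
pose l1 x := 2 * (B (2 * x) / P (2 * x)) - 4 * x.
have dl x : x < 0 -> has_deriv (fun y => ln (P (2 * y))) x (l1 x).
  move=> x0; have x2 := neg2 _ x0; eapply has_deriv_eq.
    by apply: has_deriv_ln; [exact: P0|apply: d2; exact: dP].
  have := Pn _ x2; rewrite /l1 /P1; move: (P _) (B _) => p b p0; by field.
have dl1 x : x < 0 -> has_deriv l1 x (4 * S1 (2 * x) - 4).
  move=> x0; eapply has_deriv_eq.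
    apply: has_deriv_B.
      apply: has_deriv_M; first exact: has_deriv_cst.
      by apply: (d2 (fun y => B y / P y)); apply: dS; exact: neg2.
    by apply: has_deriv_M; [exact: has_deriv_cst|exact: has_deriv_id].
  by rewrite /=; ring.
have LE w : open_halfplane w -> log_onepoint Phi w = (ln (P (2 * Re w)))%:C.
  by move=> w0; rewrite /log_onepoint onepointE//; exact: ltW.
have [rd _ _] := profile_derivatives (near_half z0 CE) (dC _ z0').
have db := profile_delbar (near_half z0 CE) (dC _ z0').
have lp := profile_lap (c := fun x => ln (P (2 * x))) LE dl z0 (dl1 _ z0').
split=> //; rewrite db lp onepointE; last exact: ltW.
rewrite -/(P (2 * Re z)).
have -> : (P (2 * Re z))%:C - 1 - ((4 * S1 (2 * Re z) - 4) / 4)%:C =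
   (P (2 * Re z) - 1 - (4 * S1 (2 * Re z) - 4) / 4)%:C :> R[i].
  by rewrite !rmorphB rmorph1.
split=> [/complexI e|w1].
  apply: (has_deriv_eq dW); move: e; move: (Q1 _) (S1 _) (P _) => q s p e; lra.
congr (_%:C); have := has_deriv_val dW; rewrite (has_deriv_val w1).
by move: (Q1 _) (S1 _) (P _) => q s p e; lra.
Qed.

Lemma has_deriv0_cst (f : R -> R) : (forall x, x < 0 -> has_deriv f x 0) -> forall x, x < 0 -> f x = f (-1).
Proof.
move=> df; have lt_case a b : a < b -> b < 0 -> f b = f a.
  move=> ab b0; have [c _] : exists2 c, c \in `]a, b[%R & f b - f a = 0 * (b - a).
    apply: (@MVT R f (fun=> 0)) => //.
      by move=> x; rewrite in_itv/= => /andP[_ xb]; apply: has_deriv_is; apply: df; exact: lt_trans b0.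
    apply: continuous_in_subspaceT => x; rewrite inE/= in_itv/= => /andP[_ xb].
    by apply: has_deriv_cont; apply: df; exact: le_lt_trans b0.
  by rewrite mul0r => /eqP; rewrite subr_eq0 => /eqP.
move=> x x0; have [x1|x1|->//] := ltgtP x (-1).
  by rewrite (lt_case x (-1))// ltrN10.
by rewrite (lt_case (-1) x).
Qed.

Lemma ae_divF_mass (E : set R) rho : {ae mu, forall t, rho t = \1_E t / Fline t} ->
  {ae mu, forall t, Fline t * rho t ^+ 2 = rho t}.
Proof.
apply: aeS => t ->; have F0 : Fline t != 0 by rewrite gt_eqF// Fline_gt0.
by rewrite indicE; case: (t \in E) => /=; field.
Qed.

(** Where rho does not vanish, it can be cancelled. *)
Lemma ae_mass_divF rho : {ae mu, forall t, Fline t * rho t ^+ 2 = rho t} ->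
  {ae mu, forall t, rho t = \1_[set t | rho t != 0] t / Fline t}.
Proof.
apply: aeS => t e; have F0 : Fline t != 0 by rewrite gt_eqF// Fline_gt0.
have [r0|r0] := eqVneq (rho t) 0.
  by rewrite indicE memNset ?mul0r//= r0 eqxx.
rewrite indicE mem_set// mul1r; apply: (mulfI F0); rewrite divff//.
by apply: (mulIf r0); rewrite mul1r -mulrA -expr2.
Qed.

End kernels.

Theorem theorem8 (R : realType) (Phi : R[i] -> R[i])
    (hPhi : error_function_type Phi) :
  (solves_ward Phi <->
     exists I : interval R,
       (0 < @lebesgue_measure R [set` I])%E /\ eq_Hfun Phi [set` I]) /\
  ((exists z : R[i], Phi z <> 0) ->
     (solves_mass_one Phi <->
        exists E : set R,
          [/\ measurable E, (0 < @lebesgue_measure R E)%E & eq_Hfun Phi E])).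
Proof.
have [phi [mphi gphi ePhi]] := hPhi.
have real_axis : (forall x, x < 0 -> Im (Phi x%:C) = 0) ->
    exists rho, slow 1 rho /\ Phi = gauss_conv (real_window rho).
  by rewrite ePhi; exact: window_real.
have halfE (x : R) : (x / 2)%:C + ((x / 2)%:C)^*%C = x%:C.
  by rewrite conjc_real -rmorphD -splitr.
have eq_real E : eq_Hfun Phi E -> forall x, x < 0 -> Im (Phi x%:C) = 0.
  by move=> e x x0; rewrite e ?Hfun_axis_real.
have k0 : 0 <= 1 :> R by [].
split; [split|move=> nz; split].
- move=> [pos sol].
  have [|rho [h e]] := real_axis.
    move=> x x0; have : open_halfplane (x / 2)%:C by rewrite /open_halfplane/=; lra.
    move=> z0; have := pos _ z0; rewrite /onepoint halfE indicE mem_set.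
      by rewrite mulr1 ltcE => /andP[/eqP].
    exact: ltW z0.
  rewrite {}e in sol pos *.
  have P0 x : x < 0 -> 0 < gauss_avg rho x.
    move=> x0; have z0 : open_halfplane (x / 2)%:C by rewrite /open_halfplane/=; lra.
    have := pos _ z0; rewrite onepointE; last exact: ltW z0.
    by rewrite ltcR /= (_ : 2 * (x / 2) = x); last by field.
  have iw w : open_halfplane w -> area_integrable halfplane
      (fun w' => berezin (gauss_conv (real_window rho)) w w' / (w - w')).
    by move=> /sol[].
  have [|I [I0 HI]] := ward_window k0 h P0.
    pose W x := gauss_avg (fun t => rho t * (mass_tail rho t + t)) x / gauss_avg rho x.
    exists (W (-1)) => x x0.
    have W0 y : y < 0 -> has_deriv W y 0.
      move=> y0; have z0 : open_halfplane (y / 2)%:C by rewrite /open_halfplane/=; lra.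
      have [_ E] := ward_equation k0 h P0 iw z0.
      have [_ _ /E] := sol _ z0; rewrite /= (_ : 2 * (y / 2) = y)//; by field.
    have Px : gauss_avg rho x != 0 by rewrite gt_eqF//; exact: P0.
    by rewrite -(has_deriv0_cst W0 x0) /W divfK.
  exists I; split=> //; apply/(eq_HfunP h) => //; exact: measurable_itv.
- move=> [I [I0 e]]; have mI : measurable ([set` I] : set (measurableTypeR R)) by exact: measurable_itv.
  have [rho0 [h0 e0]] := real_axis (eq_real _ e).
  pose rho t := \1_[set` I] t / Fline t.
  have r0 : {ae @lebesgue_measure R, forall t, rho0 t = rho t}.
    by apply/(eq_HfunP h0 mI); rewrite -e0.
  have mr : measurable_fun setT rho.
    have mF := @measurable_Fline R.
    by apply: measurable_funM; [exact: measurable_indic|meas].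
  have h : slow 1 rho.
    apply: (@intg_ae _ (fun t => expR (- 1 * `|t|) * rho0 t)) h0; first by meas.
    by move: r0; apply: aeS => t ->.
  have {}e0 : Phi = gauss_conv (real_window rho).
    rewrite e0; apply: gauss_conv_ae.
    + by split; [exact: slow_meas h0|exact: measurable_cst].
    + by split => //; exact: measurable_cst.
    + by move: r0; apply: aeS => t; rewrite /real_window => ->.
  have [P0 [M rM] [c Hc]] := ward_window_conv k0 I0 h.
  rewrite {}e0; split.
    move=> z z0; rewrite onepointE; last exact: ltW z0.
    by rewrite ltcR.
  have iw w : open_halfplane w -> area_integrable halfplane
      (fun w' => berezin (gauss_conv (real_window rho)) w w' / (w - w')).
    by move=> w0; exact: area_integrable_berezin h rM w0.
  move=> z z0; have [rd E] := ward_equation k0 h (fun x _ => P0 x) iw z0.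
  split; [exact: iw|exact: rd|apply/E].
  rewrite (_ : (fun x => _) = fun=> c); first exact: has_deriv_cst.
  by apply/funext => x; rewrite Hc mulfK// gt_eqF.
- move=> sol; have [|rho [h e]] := real_axis.
    move=> x x0; have z0 : halfplane (x / 2)%:C by rewrite /halfplane/=; lra.
    have [_] := sol _ z0; rewrite halfE => <-.
    by apply: area_integral_real => w; exact: mass_one_integrand_real.
  rewrite {}e in nz sol *; have mr := slow_meas h.
  have /ae_mass_divF H := (solves_mass_oneP h).1 sol.
  have mE : measurable ([set t | rho t != 0] : set (measurableTypeR R)).
    rewrite (_ : [set t | _] = rho @^-1` (~` [set 0])).
      by rewrite -[X in measurable X]setTI; apply: mr => //; apply: measurableC; exact: measurable_set1.
    by apply/seteqP; split => t /= /eqP.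
  exists [set t | rho t != 0]; split => //; last exact/(eq_HfunP h).
  rewrite lt_neqAle measure_ge0 andbT; apply/eqP => m0.
  have [z nz0] := nz; apply: nz0.
  have r0 : {ae @lebesgue_measure R, forall t, rho t = 0}.
    exists [set t | rho t != 0]; split => // t /= /eqP.
    by [].
  rewrite (@gauss_conv_ae R _ (real_window (fun=> 0))).
  + case: z => a b; rewrite gauss_conv_real.
    by rewrite /real_complex_def; congr (_ +i* _); rewrite -[RHS](@Rint_zero R); apply: eq_Rint => t; rewrite mulr0 mul0r mulr0.
  + by split; [exact: mr|exact: measurable_cst].
  + by split; exact: measurable_cst.
  + by move: r0; apply: aeS => t; rewrite /real_window => ->.
- move=> [E [mE E0 e]]; have [rho [h e0]] := real_axis (eq_real _ e).
  rewrite e0 in e *; apply/(solves_mass_oneP h); apply: ae_divF_mass.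
  exact/(eq_HfunP h mE).
Qed.
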